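(* Let $M$ be an expansion $0\to A^*\xrightarrow{\iota}B\xrightarrow{\nu}C^*\to0$ of a pure short exact sequence of Abelian structures expanded by $\Phi$, with $\Phi$ a fundamental system for $B$ (see context). Let $\Gamma\subseteq\Delta\subseteq M^{eq}$ with $\Gamma=\mathrm{dcl}^{eq}(\Gamma)$, $\Delta=\mathrm{dcl}^{eq}(\Delta)$, where $M$ is $|\Delta|^+$-saturated and strongly $|\Delta|^+$-homogeneous, and let $u$ be a finite tuple of $M$ (from the sorts of $A^*,B,C^*$). Assume: (H1) for every $\phi\in\Phi$, each coset in $C/\phi(C)$ which belongs to $\mathrm{acl}^{eq}(\Gamma)$ belongs to $\Gamma$; (H2) $\Delta=\mathrm{dcl}^{eq}(A^*(\Delta)\cup B(\Delta)\cup C^*(\Delta))$. Let $p_0$ be the partial type over $\Gamma$ associated with $u$ defined in the context. Then the following are equivalent: (i) $\mathrm{tp}(u/\Delta)$ does not fork over $\Gamma$; (ii) neither of the partial types $\mathrm{tp}_C(u/\Delta)$ and $p_0\cup\mathrm{tp}_A(u/\Delta)$ forks over $\Gamma$.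
   Context: Fix a multi-sorted language $\mathcal{L}$. p.p.-formulas are the formulas in the closure of parameter-free atomic formulas under finite conjunction and existential quantification. An Abelian structure is an $\mathcal{L}$-structure such that each sort expands an Abelian group, each parameter-free term is a group homomorphism, and each p.p.-formula $\phi(x_{s_1},\dots,x_{s_n})$ defines a subgroup of the product of the corresponding sorts. For an Abelian structure $A$, $A/\phi(A)$ denotes the quotient of that product by $\phi(A)$. A fundamental system for $B$ is a set $\Phi$ of p.p.-formulas such that, modulo the theory of $B$, every p.p.-formula is equivalent to a finite conjunction of formulas $\phi(t(x))$ with $\phi\in\Phi$ and $t$ a tuple of parameter-free terms. An embedding $\iota:A\to B$ is pure if $\iota^{-1}(\phi(B))=\phi(A)$ for every p.p.-formula $\phi$. A pure short exact sequence expanded by $\Phi$ consists of Abelian structures $A,B,C$ on disjoint copies of $\mathcal{L}$, a pure embedding $\iota:A\to B$, a surjective morphism $\nu:B\to C$ with $\mathrm{Im}(\iota)=\mathrm{Ker}(\nu)$ on each sort and $\nu^{-1}(\phi(C))=\phi(B)+\iota(A)$ for all p.p. $\phi$, and for each $\phi\in\Phi$ the sort $A/\phi(A)$, the quotient map $\pi_\phi:A\to A/\phi(A)$, and the map $\rho_\phi:B\to A/\phi(A)$ which is $0$ outside $\phi(B)+\iota(A)$ and on $\phi(B)+\iota(A)$ is the homomorphism $\phi(B)+\iota(A)\to(\phi(B)+\iota(A))/\phi(B)\simeq A/\phi(A)$. $A^*$ is an arbitrary expansion of $A$ together with the sorts $A/\phi(A)$ and maps $\pi_\phi$, in a language $\mathcal{L}_A$;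 $C^*$ is an arbitrary expansion of $C$, in a language $\mathcal{L}_C$; $\mathcal{L}_B$ is the language of $B$. $M$ is the resulting expansion of the sequence. For $D\subseteq M^{eq}$, $A^*(D),B(D),C^*(D)$ are the sets of elements of $D$ in the sorts of $A^*,B,C^*$. A tuple $u$ is written $u_Au_Bu_C$ according to sorts, and similarly for variables. A $C$-formula over $D$ is a formula $\psi_C(\nu(x_B),x_C,\gamma)$ with $\psi_C\in\mathcal{L}_C$ parameter-free, $\gamma\in C^*(D)$; an $A$-formula over $D$ is a formula $\psi_A(\alpha,x_A,(\rho_{\phi_i}(t_i(x_B)-\beta_i))_i)$ with $\psi_A\in\mathcal{L}_A$ parameter-free, finitely many $\phi_i\in\Phi$, $t_i$ (tuples of) parameter-free $\mathcal{L}_B$-terms, $\alpha\in A^*(D)$, $\beta_i\in B(D)$. $\mathrm{tp}_A(u/D)$ (resp. $\mathrm{tp}_C(u/D)$) is the set of $A$-formulas (resp. $C$-formulas) over $D$ satisfied by $u$. Let $\mathcal{T}$ be the set of (tuples of) parameter-free $\mathcal{L}_B$-terms, $E_0^+=\{(\phi,t)\in\Phi\times\mathcal{T}:\nu(t(u_B))+\phi(C)\in\Gamma\}$ (the coset viewed as an element of the sort $C/\phi(C)$ of $M^{eq}$), $E_0^-=(\Phi\times\mathcal{T})\smallsetminus E_0^+$, and $$p_0(x_A,x_B,x_C)=\{\nu(t(x_B-u_B))\in\phi(C):(\phi,t)\in E_0^+\}\cup\{\nu(t(x_B))+\phi(C)\ne X:(\phi,t)\in E_0^-,\ X\in (C/\phi(C))(\Gamma)\},$$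 which is equivalent to a partial type over $\Gamma$, realized by $u$. Forking: a formula divides over $\Gamma$ if for some $\Gamma$-indiscernible sequence of conjugates of its parameters, starting with the original, the corresponding formulas are jointly inconsistent; it forks over $\Gamma$ if it implies a finite disjunction of formulas dividing over $\Gamma$; a partial type forks over $\Gamma$ if it implies a formula that does. *)

(* Defs.v *)
From Stdlib Require Import RelationClasses.
From mathcomp Require Import all_boot all_algebra.
From mathcomp Require Import mathcomp_extra boolp classical_sets functions.
From mathcomp Require Import cardinality.

Set Implicit Arguments.
Unset Strict Implicit.
Unset Printing Implicit Defensive.

Import GRing.Theory.
Local Open Scope classical_set_scope.
Local Open Scope card_scope.

(* Codes for finite index sets.  There are only countably many codes: a sort of
   M^eq for every context over an arbitrary finite type would make M^eq, and
   the cardinals derived from it, too large. *)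
Inductive shape : Set :=
| sh_ord (n : nat) | sh_sum (a b : shape) | sh_prod (a b : shape).

Fixpoint index (a : shape) : Type :=
  match a with
  | sh_ord n => 'I_n
  | sh_sum a b => (index a + index b)%type
  | sh_prod a b => (index a * index b)%type
  end.
Coercion index : shape >-> Sortclass.

(* A finite family of variables [i], each with a sort [srt i].  Contexts are
   functions rather than lists so that renaming the sorts ([cmap]) leaves the
   type of assignments unchanged up to conversion. *)
Record ctx (S : Type) := Ctx { idx :> shape; srt : idx -> S }.

Definition cmap S T (f : S -> T) (G : ctx S) : ctx T :=
  Ctx (fun i : G => f (srt i)).

Definition cconst S (n : nat) (s : S) : ctx S := @Ctx S (sh_ord n) (fun _ => s).

Definition csum S (G H : ctx S) : ctx S :=
  @Ctx S (sh_sum G H)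
    (fun x => match x with inl i => srt i | inr j => srt j end).

Definition cext S (G : ctx S) (s : S) : ctx S := csum G (cconst 1 s).

Definition crep S (k : nat) (G : ctx S) : ctx S :=
  @Ctx S (sh_prod (sh_ord k) G) (fun x => srt x.2).

Definition env S (M : S -> Type) (G : ctx S) : Type := forall i : G, M (srt i).

Definition env_cat S (M : S -> Type) (G H : ctx S) (e : env M G)
    (h : env M H) : env M (csum G H) :=
  fun x => match x return M (srt (c := csum G H) x) with
           | inl i => e i | inr j => h j end.

Definition env_ext S (M : S -> Type) (G : ctx S) s (e : env M G) (a : M s) :
    env M (cext G s) := env_cat e ((fun _ => a) : env M (cconst 1 s)).

Record language := Language {
  lsort : Type;
  lfunc : Type;
  fdom : lfunc -> ctx lsort;
  fcod : lfunc -> lsort;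
  lrel : Type;
  rdom : lrel -> ctx lsort }.

Record structure (L : language) := Structure {
  carrier :> lsort L -> Type;
  fint : forall f : lfunc L, env carrier (fdom f) -> carrier (fcod f);
  rint : forall r : lrel L, env carrier (rdom r) -> Prop }.

Inductive term (L : language) (G : ctx (lsort L)) : lsort L -> Type :=
| tvar (i : G) : term G (srt i)
| tapp (f : lfunc L) :
    (forall i : fdom f, term G (srt i)) -> term G (fcod f).

Inductive formula (L : language) (G : ctx (lsort L)) : Type :=
| ftrue
| feq (s : lsort L) (t1 t2 : term G s)
| frel (r : lrel L) (ts : forall i : rdom r, term G (srt i))
| fnot (phi : formula G)
| fand (phi psi : formula G)
| fex (s : lsort L) (phi : formula (cext G s)).

Section Semantics.
Context {L : language} (M : structure L).

Fixpoint eval (G : ctx (lsort L)) (e : env M G) s (t : term G s) : M s :=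
  match t in term _ s return M s with
  | tvar i => e i
  | tapp f ts => fint (fun i => eval e (ts i))
  end.

Fixpoint sat (G : ctx (lsort L)) (phi : formula G) : env M G -> Prop :=
  match phi with
  | ftrue => fun _ => True
  | feq _ t1 t2 => fun e => eval e t1 = eval e t2
  | frel _ ts => fun e => rint (fun i => eval e (ts i))
  | fnot phi => fun e => ~ sat phi e
  | fand phi psi => fun e => sat phi e /\ sat psi e
  | fex _ phi => fun e => exists a, sat phi (env_ext e a)
  end.

End Semantics.

(* Positive primitive formulas; [ftrue] is the empty conjunction. *)
Fixpoint is_pp L (G : ctx (lsort L)) (phi : formula G) : Prop :=
  match phi with
  | ftrue => True
  | feq _ _ _ => True
  | frel _ _ => True
  | fnot _ => False
  | fand phi psi => is_pp phi /\ is_pp psi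
  | fex _ phi => is_pp phi
  end.

Definition homomorphism L (M N : structure L) (h : forall s, M s -> N s) :=
  (forall (f : lfunc L) (e : env M (fdom f)),
     h _ (fint e) = fint (fun i => h _ (e i))) /\
  (forall (r : lrel L) (e : env M (rdom r)),
     rint e -> rint (fun i => h _ (e i))).

Definition embedding L (M N : structure L) (h : forall s, M s -> N s) :=
  homomorphism h /\ (forall s, injective (h s)) /\
  (forall (r : lrel L) (e : env M (rdom r)),
     rint (fun i => h _ (e i)) -> rint e).

Definition automorphism L (M : structure L) (h : forall s, M s -> M s) :=
  embedding h /\ forall s, bijective (h s).

Definition elt L (M : structure L) : Type := {s : lsort L & M s}.
Definition in_elt L (M : structure L) s (a : M s) : elt M := existT _ s a.

Definition params_in L (M : structure L) (D : set (elt M))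
    (G : ctx (lsort L)) (e : env M G) : Prop := forall i, D (in_elt (e i)).

Record pformula L (M : structure L) (G : ctx (lsort L)) := PFormula {
  pctx : ctx (lsort L);
  pform : formula (csum G pctx);
  pval : env M pctx }.

Section ModelTheory.
Context {L : language} (M : structure L).

Definition solutions (G : ctx (lsort L)) (theta : pformula M G) :
    set (env M G) :=
  [set x | sat (pform theta) (env_cat x (@pval _ _ _ theta))].

Definition over (D : set (elt M)) (G : ctx (lsort L)) (theta : pformula M G) :=
  params_in D (@pval _ _ _ theta).

Definition fibre (G : ctx (lsort L)) s (phi : formula (cext G s))
    (e : env M G) : set (M s) := [set a | sat phi (env_ext e a)].

Definition dcl (D : set (elt M)) : set (elt M) :=
  [set x | exists (G : ctx (lsort L)) (phi : formula (cext G (projT1 x)))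
             (e : env M G),
           params_in D e /\ fibre phi e = [set projT2 x]].

Definition acl (D : set (elt M)) : set (elt M) :=
  [set x | exists (G : ctx (lsort L)) (phi : formula (cext G (projT1 x)))
             (e : env M G),
           [/\ params_in D e, finite_set (fibre phi e)
             & fibre phi e (projT2 x)]].

(* |K|^+-saturation: "smaller than |K|^+" means "of cardinality at most
   |K|". *)
Definition succ_saturated T (K : set T) : Prop :=
  forall (D : set (elt M)), D #<= K ->
  forall (G : ctx (lsort L)) (p : set (pformula M G)),
    (forall theta, p theta -> over D theta) ->
    (forall n (theta : 'I_n -> pformula M G), (forall i, p (theta i)) ->
       exists x, forall i, solutions (theta i) x) ->
    exists x, forall theta, p theta -> solutions theta x.

Definition partial_elementary (D : set (elt M)) (f : forall s, M s -> M s) :=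
  forall (G : ctx (lsort L)) (phi : formula G) (e : env M G),
    params_in D e -> (sat phi e <-> sat phi (fun i => f _ (e i))).

Definition succ_strongly_homogeneous T (K : set T) : Prop :=
  forall (D : set (elt M)), D #<= K ->
  forall f : forall s, M s -> M s, partial_elementary D f ->
  exists h, automorphism h /\
    forall s (a : M s), D (in_elt a) -> h s a = f s a.

Definition indiscernible (D : set (elt M)) (P : ctx (lsort L))
    (b : nat -> env M P) : Prop :=
  forall (k : nat) (Q : ctx (lsort L)) (phi : formula (csum (crep k P) Q))
    (c : env M Q) (i j : 'I_k -> nat),
    params_in D c ->
    {homo i : x y / (x < y)%N} -> {homo j : x y / (x < y)%N} ->
    let at_ (l : 'I_k -> nat) : env M (crep k P) := fun x => b (l x.1) x.2 in
    sat phi (env_cat (at_ i) c) <-> sat phi (env_cat (at_ j) c).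

(* The terms of an indiscernible sequence are conjugate over [D].
   Inconsistency is that of a finite subset, as compactness allows, so that it
   does not depend on the saturation of [M]; likewise in [entails]. *)
Definition divides (D : set (elt M)) (G : ctx (lsort L))
    (theta : pformula M G) : Prop :=
  exists b : nat -> env M (pctx theta),
    [/\ b 0%N = @pval _ _ _ theta,
        indiscernible D b
      & exists n, ~ exists x : env M G, forall i, (i < n)%N ->
          sat (pform theta) (env_cat x (b i))].

Definition forks (D : set (elt M)) (G : ctx (lsort L))
    (theta : pformula M G) : Prop :=
  exists n (eta : 'I_n -> pformula M G),
    (forall i, divides D (eta i)) /\
    solutions theta `<=` [set x | exists i, solutions (eta i) x].

(* A partial type is given by the sets of solutions of its formulas: entailment,
   hence forking, depends on nothing else. *)
Definition ptype (G : ctx (lsort L)) : Type := set (set (env M G)).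

Definition entails (G : ctx (lsort L)) (p : ptype G) (X : set (env M G)) :=
  exists n (Y : 'I_n -> set (env M G)),
    (forall i, p (Y i)) /\ [set x | forall i, Y i x] `<=` X.

Definition ptype_forks (D : set (elt M)) (G : ctx (lsort L)) (p : ptype G) :=
  exists theta : pformula M G, entails p (solutions theta) /\ forks D theta.

Definition tp (G : ctx (lsort L)) (u : env M G) (D : set (elt M)) : ptype G :=
  [set X | exists theta : pformula M G,
           [/\ over D theta, X = solutions theta & X u]].

End ModelTheory.

Definition quot T (E : T -> T -> Prop) : Type :=
  {X : set T | exists a, X = [set b | E a b]}.

Definition qclass T (E : T -> T -> Prop) (a : T) : quot E :=
  exist _ [set b | E a b] (ex_intro _ a erefl).

Record def_equiv L (M : structure L) := DefEquiv {
  eq_ctx : ctx (lsort L);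
  eq_rel : env M eq_ctx -> env M eq_ctx -> Prop;
  eq_definable : exists phi : formula (csum eq_ctx eq_ctx),
    forall a b, eq_rel a b <-> sat phi (env_cat a b);
  eq_equivalence : Equivalence eq_rel }.

Section Meq.
Context {L : language} (M : structure L).

(* The home sorts are kept apart from the sorts of the equality relations. *)
Inductive eq_sort := home (s : lsort L) | imag (E : def_equiv M).
Inductive eq_func := efunc (f : lfunc L) | eproj (E : def_equiv M).

Definition eq_language : language := {|
  lsort := eq_sort;
  lfunc := eq_func;
  fdom f := match f with
            | efunc f => cmap home (fdom f)
            | eproj E => cmap home (eq_ctx E)
            end;
  fcod f := match f with
            | efunc f => home (fcod f)
            | eproj E => imag E
            end;
  lrel := lrel L;
  rdom r := cmap home (rdom r) |}.

Definition eq_carrier (s : eq_sort) : Type :=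
  match s with home s => M s | imag E => quot (@eq_rel _ _ E) end.

Definition Meq : structure eq_language :=
  @Structure eq_language eq_carrier
    (fun f => match f return env eq_carrier (fdom (l := eq_language) f) ->
                             eq_carrier (fcod (l := eq_language) f) with
              | efunc f => fun e => @fint _ M f e
              | eproj E => fun e => @qclass _ (@eq_rel _ _ E) e
              end)
    (fun r e => @rint _ M r e).

Definition home_elt s (a : M s) : elt Meq := @in_elt _ Meq (home s) a.
Definition imag_elt (E : def_equiv M) (X : quot (@eq_rel _ _ E)) : elt Meq :=
  @in_elt _ Meq (imag E) X.

End Meq.

(* New sorts are allowed besides new function and relation symbols. *)
Record expansion (L : language) := Expansion {
  xsort : Type;
  xfunc : Type;
  xdom : xfunc -> ctx (lsort L + xsort);
  xcod : xfunc -> lsort L + xsort;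
  xrel : Type;
  xrdom : xrel -> ctx (lsort L + xsort) }.

Definition xlanguage L (X : expansion L) : language := {|
  lsort := lsort L + xsort X;
  lfunc := lfunc L + xfunc X;
  fdom f := match f with inl f => cmap inl (fdom f) | inr f => xdom f end;
  fcod f := match f with inl f => inl (fcod f) | inr f => xcod f end;
  lrel := lrel L + xrel X;
  rdom r := match r with inl r => cmap inl (rdom r) | inr r => xrdom r end |}.

Definition xcarrier_all L (X : expansion L) (M : structure L)
    (N : xsort X -> Type) (s : lsort L + xsort X) : Type :=
  match s with inl s => M s | inr s => N s end.

Record expander L (X : expansion L) (M : structure L) := Expander {
  xcarrier : xsort X -> Type;
  xfint : forall f : xfunc X, env (xcarrier_all M xcarrier) (xdom f) ->
                              xcarrier_all M xcarrier (xcod f);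
  xrint : forall r : xrel X, env (xcarrier_all M xcarrier) (xrdom r) -> Prop }.

Definition expand L (X : expansion L) (M : structure L) (N : expander X M) :
    structure (xlanguage X) :=
  let car := xcarrier_all M (@xcarrier _ _ _ N) in
  @Structure (xlanguage X) car
    (fun f => match f return env car (fdom (l := xlanguage X) f) ->
                             car (fcod (l := xlanguage X) f) with
              | inl f => fun e => @fint _ M f e
              | inr f => fun e => @xfint _ _ _ N f e
              end)
    (fun r => match r return env car (rdom (l := xlanguage X) r) -> Prop with
              | inl r => fun e => @rint _ M r e
              | inr r => fun e => @xrint _ _ _ N r e
              end).

Inductive group_func (L : language) :=
| gadd (s : lsort L) | gopp (s : lsort L) | gzero (s : lsort L)
| gfunc (f : lfunc L).

Definition glanguage (L : language) : language := {|
  lsort := lsort L;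
  lfunc := group_func L;
  fdom f := match f with
            | gadd s => cconst 2 s
            | gopp s => cconst 1 s
            | gzero s => cconst 0 s
            | gfunc f => fdom f
            end;
  fcod f := match f with
            | gadd s => s | gopp s => s | gzero s => s | gfunc f => fcod f
            end;
  lrel := lrel L;
  rdom r := rdom r |}.

Record group_structure (L : language) := GroupStructure {
  gcarrier : lsort L -> zmodType;
  gfint : forall f : lfunc L, env gcarrier (fdom f) -> gcarrier (fcod f);
  grint : forall r : lrel L, env gcarrier (rdom r) -> Prop }.

Definition structure_of_group L (A : group_structure L) :
    structure (glanguage L) :=
  let car s : Type := gcarrier A s in
  @Structure (glanguage L) car
    (fun f => match f return env car (fdom (l := glanguage L) f) ->
                             car (fcod (l := glanguage L) f) with
              | gadd s => fun e => (e ord0 + e ord_max)%R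
              | gopp s => fun e => (- e ord0)%R
              | gzero s => fun _ => 0%R
              | gfunc f => fun e => @gfint _ A f e
              end)
    (fun r e => @grint _ A r e).
Coercion structure_of_group : group_structure >-> structure.

Section Abelian.
Context {L : language} (A : group_structure L).
Implicit Type G : ctx (lsort (glanguage L)).

Definition env_add G (a b : env A G) : env A G :=
  fun i => ((a i : gcarrier A (srt i)) + b i)%R.
Definition env_sub G (a b : env A G) : env A G :=
  fun i => ((a i : gcarrier A (srt i)) - b i)%R.
Definition env_zero G : env A G := fun i => (0 : gcarrier A (srt i))%R.

Definition is_subgroup G (X : set (env A G)) : Prop :=
  X (@env_zero G) /\ forall a b, X a -> X b -> X (env_sub a b).

Definition abelian : Prop :=
  (forall G s (t : term G s) (a b : env A G),
     eval (env_add a b) t = (eval a t + eval b t :> gcarrier A s)%R) /\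
  (forall G (phi : formula G), is_pp phi -> is_subgroup [set a | sat phi a]).

End Abelian.

Record pp_family (L : language) := PPFamily {
  pp_idx :> Type;
  pp_ctx : pp_idx -> ctx (lsort (glanguage L));
  pp_form : forall phi : pp_idx, formula (pp_ctx phi);
  pp_formP : forall phi, is_pp (pp_form phi) }.

Definition term_tuple L (Phi : pp_family L) (phi : Phi)
    (G : ctx (lsort (glanguage L))) : Type :=
  forall j : pp_ctx phi, term G (srt j).

Definition eval_tuple L (Phi : pp_family L) (phi : Phi)
    (M : structure (glanguage L)) (G : ctx (lsort (glanguage L)))
    (t : term_tuple phi G) (e : env M G) : env M (pp_ctx phi) :=
  fun j => eval e (t j).

Definition fundamental_system L (Phi : pp_family L)
    (B : structure (glanguage L)) : Prop :=
  forall (G : ctx (lsort (glanguage L))) (psi : formula G), is_pp psi ->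
  exists n (c : 'I_n -> {phi : Phi & term_tuple phi G}),
  forall b : env B G,
    sat psi b <->
    forall i, sat (pp_form (projT1 (c i))) (eval_tuple (projT2 (c i)) b).

Definition same_coset L (A : group_structure L) (Phi : pp_family L)
    (phi : Phi) (a b : env A (pp_ctx phi)) : Prop :=
  sat (pp_form phi) (env_sub b a).

Definition quot_expansion L (Phi : pp_family L) : expansion (glanguage L) :=
  @Expansion (glanguage L) Phi Phi
    (fun phi => cmap inl (pp_ctx phi)) (fun phi => inr phi)
    void (fun r => match r with end).

Definition quot_expander L (Phi : pp_family L) (A : group_structure L) :
    expander (quot_expansion Phi) A :=
  @Expander _ (quot_expansion Phi) A
    (fun phi => quot (@same_coset L A Phi phi))
    (fun phi e => @qclass _ (@same_coset L A Phi phi) e)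
    (fun r => match r with end).

Definition qlanguage L (Phi : pp_family L) : language :=
  xlanguage (quot_expansion Phi).

Definition with_quotients L (Phi : pp_family L) (A : group_structure L) :
    structure (qlanguage Phi) := expand (quot_expander Phi A).

Record pure_sequence (L : language) (Phi : pp_family L) := PureSequence {
  grA : group_structure L;
  grB : group_structure L;
  grC : group_structure L;
  abelianA : abelian grA;
  abelianB : abelian grB;
  abelianC : abelian grC;
  iota : forall s, grA s -> grB s;
  nu : forall s, grB s -> grC s;
  iota_embedding : embedding iota;
  iota_pure : forall (G : ctx (lsort (glanguage L))) (phi : formula G),
    is_pp phi ->
    forall a : env grA G, sat phi (fun i => iota (a i)) <-> sat phi a;
  nu_homomorphism : homomorphism nu;
  nu_surjective : forall s (c : grC s), exists b, nu b = c;
  exactB : forall s (b : grB s),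
    (exists a, b = iota a) <-> nu b = (0 : gcarrier grC s)%R;
  nu_pure : forall (G : ctx (lsort (glanguage L))) (phi : formula G),
    is_pp phi ->
    forall b : env grB G,
      sat phi (fun i => nu (b i)) <->
      exists (b' : env grB G) (a : env grA G),
        sat phi b' /\ b = env_add b' (fun i => iota (a i));
  expA : expansion (qlanguage Phi);
  expC : expansion (glanguage L);
  strA : expander expA (with_quotients Phi grA);
  strC : expander expC grC }.

Section Sequence.
Context {L : language} {Phi : pp_family L} (S : pure_sequence Phi).

Definition langA : language := xlanguage (expA S).
Definition langB : language := glanguage L.
Definition langC : language := xlanguage (expC S).

Definition Astar : structure langA := expand (strA S).
Definition Bstr : structure langB := grB S.
Definition Cstar : structure langC := expand (strC S).

Definition sortA (s : lsort L) : lsort langA := inl (inl s).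
Definition sortQ (phi : Phi) : lsort langA := inl (inr phi).
Definition sortC (s : lsort L) : lsort langC := inl s.

(* [rho b] is the class of [a] when [b] = [b'] + [iota a] with [b'] in phi(B),
   and 0 outside phi(B) + iota(A). *)
Definition rho (phi : Phi) (b : env Bstr (pp_ctx phi)) : Astar (sortQ phi) :=
  @qclass _ (@same_coset L (grA S) Phi phi)
    match pselect (exists a : env (grA S) (pp_ctx phi),
                     sat (pp_form phi)
                       (env_sub b ((fun i => iota (a i)) : env (grB S) _))) with
    | left h => projT1 (cid h)
    | right _ => @env_zero L (grA S) (pp_ctx phi)
    end.

Inductive seq_sort :=
| inA (s : lsort langA) | inB (s : lsort langB) | inC (s : lsort langC).

Inductive seq_func :=
| funA (f : lfunc langA) | funB (f : lfunc langB) | funC (f : lfunc langC)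
| fun_iota (s : lsort L) | fun_nu (s : lsort L) | fun_rho (phi : Phi).

Inductive seq_rel :=
| relA (r : lrel langA) | relB (r : lrel langB) | relC (r : lrel langC).

Definition langM : language := {|
  lsort := seq_sort;
  lfunc := seq_func;
  fdom f := match f with
            | funA f => cmap inA (fdom f)
            | funB f => cmap inB (fdom f)
            | funC f => cmap inC (fdom f)
            | fun_iota s => cconst 1 (inA (sortA s))
            | fun_nu s => cconst 1 (inB s)
            | fun_rho phi => cmap inB (pp_ctx phi)
            end;
  fcod f := match f with
            | funA f => inA (fcod f)
            | funB f => inB (fcod f)
            | funC f => inC (fcod f)
            | fun_iota s => inB s
            | fun_nu s => inC (sortC s)
            | fun_rho phi => inA (sortQ phi)
            end;
  lrel := seq_rel;
  rdom r := match r with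
            | relA r => cmap inA (rdom r)
            | relB r => cmap inB (rdom r)
            | relC r => cmap inC (rdom r)
            end |}.

Definition seq_carrier (s : seq_sort) : Type :=
  match s with inA s => Astar s | inB s => Bstr s | inC s => Cstar s end.

Definition seqM : structure langM :=
  @Structure langM seq_carrier
    (fun f => match f return env seq_carrier (fdom (l := langM) f) ->
                             seq_carrier (fcod (l := langM) f) with
              | funA f => fun e => @fint _ Astar f e
              | funB f => fun e => @fint _ Bstr f e
              | funC f => fun e => @fint _ Cstar f e
              | fun_iota s => fun e => @iota _ _ S s (e ord0)
              | fun_nu s => fun e => @nu _ _ S s (e ord0)
              | fun_rho phi => fun e => @rho phi e
              end)
    (fun r => match r return env seq_carrier (rdom (l := langM) r) -> Prop with
              | relA r => fun e => @rint _ Astar r e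
              | relB r => fun e => @rint _ Bstr r e
              | relC r => fun e => @rint _ Cstar r e
              end).

Fixpoint transC_term (H : ctx (lsort langM)) (G : ctx (lsort (glanguage L)))
    (sg : forall i : G, term H (inC (sortC (srt i)))) s (t : term G s) :
    term H (inC (sortC s)) :=
  match t in term _ s return term H (inC (sortC s)) with
  | tvar i => sg i
  | tapp f ts => @tapp langM H (funC (inl f)) (fun i => transC_term sg (ts i))
  end.

Lemma eval_transC (H : ctx (lsort langM)) (G : ctx (lsort (glanguage L)))
    (sg : forall i : G, term H (inC (sortC (srt i)))) s (t : term G s)
    (h : env seqM H) :
  eval h (transC_term sg t) =
  eval (M := grC S) (fun i => eval h (sg i) : grC S (srt i)) t.
Proof.
elim: t => [i|f ts IH] //=; apply: (congr1 (@fint _ (grC S) f)).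
by apply: functional_extensionality_dep => i; exact: IH.
Qed.

Fixpoint weaken (L0 : language) (G : ctx (lsort L0)) s0 s (t : term G s) :
    term (cext G s0) s :=
  match t in term _ s return term (cext G s0) s with
  | tvar i => @tvar L0 (cext G s0) (inl i)
  | tapp f ts => tapp (fun i => weaken s0 (ts i))
  end.

Lemma eval_weaken (L0 : language) (M : structure L0) (G : ctx (lsort L0)) s0 s
    (t : term G s) (e : env M G) (a : M s0) :
  eval (env_ext e a) (weaken s0 t) = eval e t.
Proof.
elim: t => [i|f ts IH] //=; congr fint.
by apply: functional_extensionality_dep => i; exact: IH.
Qed.

Lemma transC_formula (G : ctx (lsort (glanguage L))) (phi : formula G) :
  forall (H : ctx (lsort langM))
    (sg : forall i : G, term H (inC (sortC (srt i)))),
  exists psi : formula H, forall h : env seqM H,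
    sat psi h <->
    sat (M := grC S) phi (fun i => eval h (sg i) : grC S (srt i)).
Proof.
elim: phi => {G}.
- by move=> G H sg; exists (ftrue H).
- move=> G s t1 t2 H sg.
  by exists (feq (transC_term sg t1) (transC_term sg t2)) => h /=;
    rewrite !eval_transC.
- move=> G r ts H sg.
  exists (@frel langM H (relC (inl r)) (fun i => transC_term sg (ts i))).
  move=> h /=; set e1 := (fun i => _); set e2 := (X in _ <-> grint X).
  suff -> : e1 = e2 by [].
  by apply: functional_extensionality_dep => i; rewrite /e1 eval_transC.
- move=> G phi IH H sg; have [psi psiP] := IH H sg.
  by exists (fnot psi) => h /=; rewrite psiP.
- move=> G phi1 IH1 phi2 IH2 H sg.
  have [psi1 psi1P] := IH1 H sg; have [psi2 psi2P] := IH2 H sg.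
  by exists (fand psi1 psi2) => h /=; rewrite psi1P psi2P.
move=> G s phi IH H sg.
pose s' : lsort langM := inC (sortC s).
pose sg' (o : cext G s) : term (cext H s') (inC (sortC (srt o))) :=
  match o return term (cext H s') (inC (sortC (srt (c := cext G s) o))) with
  | inl i => weaken s' (sg i)
  | inr j => @tvar langM (cext H s') (inr j)
  end.
have [psi psiP] := IH (cext H s') sg'.
exists (fex psi) => h /=.
have eqenv (a : grC S s) :
    (fun o => eval (M := seqM) (env_ext h (a : seqM s')) (sg' o)
       : grC S (srt o)) =
    env_ext (M := grC S) (fun i => eval h (sg i) : grC S (srt i)) a.
  apply: functional_extensionality_dep => -[i|] //=.
  exact: (@eval_weaken _ seqM _ s' _ (sg i) h a).
by split=> -[a Ha]; exists a; move: Ha; rewrite psiP eqenv.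
Qed.

Definition coset_ctx (phi : Phi) : ctx (lsort langM) :=
  cmap (fun s => inC (sortC s)) (pp_ctx phi).

Definition coset_rel (phi : Phi) (a b : env seqM (coset_ctx phi)) : Prop :=
  @same_coset L (grC S) Phi phi a b.

Lemma coset_definable (phi : Phi) :
  exists psi : formula (csum (coset_ctx phi) (coset_ctx phi)),
    forall a b, @coset_rel phi a b <-> sat psi (env_cat a b).
Proof.
pose H : ctx (lsort langM) := csum (coset_ctx phi) (coset_ctx phi).
pose minus (j : pp_ctx phi) : term H (inC (sortC (srt j))) :=
  @tapp langM H (funC (inl (@gadd L (srt j))))
    (fun x : 'I_2 => if x == ord0 then @tvar langM H (inr j)
     else @tapp langM H (funC (inl (@gopp L (srt j))))
            (fun _ => @tvar langM H (inl j))).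
have [psi psiP] := transC_formula (pp_form phi) minus.
by exists psi => a b; rewrite psiP.
Qed.

Lemma coset_equivalence (phi : Phi) : Equivalence (@coset_rel phi).
Proof.
have [_ /(_ _ _ (pp_formP phi))[sub0 subB]] := abelianC S.
pose X : set (env (grC S) (pp_ctx phi)) := [set a | sat (pp_form phi) a].
have env_eq (a b : env (grC S) (pp_ctx phi)) :
    (forall i, a i = b i) -> X a -> X b.
  by move=> ab; rewrite (functional_extensionality_dep ab).
split.
- by move=> a; apply: env_eq sub0 => i; rewrite /env_zero /env_sub subrr.
- move=> a b ab; apply: env_eq (subB _ _ sub0 ab) => i.
  by rewrite /env_sub /env_zero sub0r opprB.
move=> a b c ab bc.
apply: env_eq (subB _ _ bc (subB _ _ sub0 ab)) => i.
by rewrite /env_sub /env_zero sub0r opprK addrA subrK.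
Qed.

Definition coset_equiv (phi : Phi) : def_equiv seqM :=
  @DefEquiv _ _ (coset_ctx phi) (@coset_rel phi)
    (coset_definable phi) (coset_equivalence phi).

Definition coset (phi : Phi) (c : env (grC S) (pp_ctx phi)) :
    quot (@eq_rel _ _ (coset_equiv phi)) :=
  @qclass _ (@eq_rel _ _ (coset_equiv phi)) c.

Definition partA (D : set (elt (Meq seqM))) : set (elt (Meq seqM)) :=
  [set x | D x /\ exists s (a : Astar s), x = home_elt (a : seqM (inA s))].
Definition partB (D : set (elt (Meq seqM))) : set (elt (Meq seqM)) :=
  [set x | D x /\ exists s (b : Bstr s), x = home_elt (b : seqM (inB s))].
Definition partC (D : set (elt (Meq seqM))) : set (elt (Meq seqM)) :=
  [set x | D x /\ exists s (c : Cstar s), x = home_elt (c : seqM (inC s))].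

Section Variables.
Variables (GA : ctx (lsort langA)) (GB : ctx (lsort langB)).
Variable (GC : ctx (lsort langC)).

Definition vars : ctx (lsort (eq_language seqM)) :=
  cmap (@home _ seqM) (csum (csum (cmap inA GA) (cmap inB GB)) (cmap inC GC)).

Definition seq_tuple (uA : env Astar GA) (uB : env Bstr GB)
    (uC : env Cstar GC) : env (Meq seqM) vars :=
  @env_cat _ seqM (csum (cmap inA GA) (cmap inB GB)) (cmap inC GC)
    (@env_cat _ seqM (cmap inA GA) (cmap inB GB) uA uB) uC.

Definition xA (x : env (Meq seqM) vars) : env Astar GA :=
  fun i => x (inl (inl i)).
Definition xB (x : env (Meq seqM) vars) : env Bstr GB :=
  fun i => x (inl (inr i)).
Definition xC (x : env (Meq seqM) vars) : env Cstar GC := fun i => x (inr i).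

Definition nu_env (G : ctx (lsort langB)) (b : env Bstr G) : env (grC S) G :=
  fun i => nu (b i).

Definition C_formula (D : set (elt (Meq seqM))) : ptype (Meq seqM) vars :=
  [set X | exists (Q : ctx (lsort langC))
             (psi : formula (csum (csum (cmap sortC GB) GC) Q))
             (gamma : env Cstar Q),
     (forall j, partC D (home_elt (gamma j : seqM (inC (srt j))))) /\
     X = [set x | sat (M := Cstar) psi
            (env_cat (env_cat ((nu_env (xB x)) : env Cstar (cmap sortC GB))
                              (xC x)) gamma)]].

Definition quot_ctx n (phi : 'I_n -> Phi) : ctx (lsort langA) :=
  @Ctx _ (sh_ord n) (fun i => sortQ (phi i)).

Definition A_formula (D : set (elt (Meq seqM))) : ptype (Meq seqM) vars :=
  [set X | exists (P : ctx (lsort langA)) (alpha : env Astar P)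
             (n : nat) (phi : 'I_n -> Phi)
             (t : forall i, term_tuple (phi i) GB)
             (beta : forall i, env Bstr (pp_ctx (phi i)))
             (psi : formula (csum (csum P GA) (quot_ctx phi))),
     [/\ forall j, partA D (home_elt (alpha j : seqM (inA (srt j)))),
         forall i j, partB D (home_elt (beta i j : seqM (inB (srt j))))
       & X = [set x | sat (M := Astar) psi
                (env_cat (env_cat alpha (xA x))
                   ((fun i => @rho (phi i)
                       (@env_sub L (grB S) _ (eval_tuple (t i) (xB x))
                          (beta i)))
                    : env Astar (quot_ctx phi)))]]].

Definition tp_A (u : env (Meq seqM) vars) (D : set (elt (Meq seqM))) :
    ptype (Meq seqM) vars := [set X | A_formula D X /\ X u].
Definition tp_C (u : env (Meq seqM) vars) (D : set (elt (Meq seqM))) :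
    ptype (Meq seqM) vars := [set X | C_formula D X /\ X u].

Definition E0plus (u : env (Meq seqM) vars) (D : set (elt (Meq seqM)))
    (phi : Phi) (t : term_tuple phi GB) : Prop :=
  D (imag_elt (coset (nu_env (G := pp_ctx phi) (eval_tuple t (xB u))))).

(* The formulas of the first part have x_B(u) as parameters, but each of them is
   equivalent to a formula over [D]. *)
Definition p0 (u : env (Meq seqM) vars) (D : set (elt (Meq seqM))) :
    ptype (Meq seqM) vars :=
  [set X | exists (phi : Phi) (t : term_tuple phi GB),
     E0plus u D t /\
     X = [set x | sat (M := grC S) (pp_form phi)
            (nu_env (G := pp_ctx phi)
               (eval_tuple t (@env_sub L (grB S) GB (xB x) (xB u))))]] `|`
  [set X | exists (phi : Phi) (t : term_tuple phi GB)
             (c : quot (@eq_rel _ _ (coset_equiv phi))),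
     [/\ ~ E0plus u D t, D (imag_elt c)
       & X = [set x | coset (nu_env (G := pp_ctx phi)
                               (eval_tuple t (xB x))) <> c]]].

End Variables.
End Sequence.

(* Main.v *)
(* Quantifier elimination: every definable set of M is a finite union of intersections of
   an A-set and a C-set.  To eliminate a quantifier over B, guess for which i the coset
   nu(t_i(x, y)) + phi_i(C) is trivial; purity and the fundamental system then turn the
   remaining condition into one on nu(x) and one on the maps rho.

   For the theorem, suppose that finitely many dividing formulas eta(x, d) cover
   tp(u/Delta).  Represent the d by a tuple e of elements of M, split the eta(x, e) into
   A-sets and C-sets, and let (phi_l, t_l) be the pairs that occur in the A-sets.
   Non-forking of tp_C and of p0 + tp_A yields u' and u'' whose atoms over e (in the
   finite algebra generated by these sets and by the conditions on the cosets
   nu(t_l(x, e)) + phi_l(C)) do not divide.  By (H1), a coset outside Gamma is not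
   algebraic over Gamma, so naming it would divide: hence u' and u'' agree on the coset
   conditions.  Purity then gives w with the C-part of u' and the A-part of u''; w lies in
   some eta(x, d).  Along an indiscernible sequence witnessing that this eta divides, the
   same recombination is possible, a contradiction. *)
From Stdlib Require Import RelationClasses.
From Stdlib Require List.
From mathcomp Require Import all_boot all_algebra.
From mathcomp Require Import mathcomp_extra boolp classical_sets functions.
From mathcomp Require Import cardinality filter.

Require Import Defs.

Set Implicit Arguments.
Unset Strict Implicit.
Unset Printing Implicit Defensive.

Import GRing.Theory.
Local Open Scope classical_set_scope.

(** * Definable sets *)

(** The delicate point is that one tuple has to be recombined against many members of an
    indiscernible sequence at once. It can be, because terms are additive: t(x, y) = t1(x) - t2(y),
    so a coset condition says that t1(x) and t2(y) lie in one coset of phi(C). If v' and v'' both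
    satisfy it for the same y, then t1(v' - v'') lies in phi(C), a condition free of y; finitely
    many pp-formulas thus handle arbitrarily many y. Splitting concerns tuples of M, whereas
    formulas of M^eq have imaginary parameters. (H2) moves parameters in [Delta] to home elements of
    [Delta]. Those of the dividing formulas are arbitrary and are replaced by representatives that
    may lie outside [Delta]; hence the witness of dividing must be lifted along a definable map to
    an indiscernible sequence with prescribed first term. Such sequences are extracted as iterated
    limits along an ultrafilter: the type of each initial segment is known beforehand and saturation
    adds one term at a time. The implication from (i) to (ii) holds because both partial types are
    contained in tp(u/Delta), up to equivalence of formulas. *)

Lemma depfun_choice (I : Type) (T : I -> Type) (P : forall i, T i -> Prop) :
  (forall i, exists x, P i x) -> exists f, forall i, P i (f i).
Proof. by move=> H; exists (fun i => projT1 (cid (H i))) => i; case: cid. Qed.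

(** Finiteness as a covering list, repetitions allowed: the index types come from dependent sums and
    from choices and carry no decidable equality, and finite conjunctions need only the list. *)
Definition listable (I : Type) : Prop :=
  exists l : seq I, forall i, List.In i l.

Lemma list_In_mem (I : eqType) (l : seq I) i : i \in l -> List.In i l.
Proof.
by elim: l => //= j l IH; rewrite inE => /orP[/eqP ->|/IH]; [left|right].
Qed.

Lemma listable_finite (I : finType) : listable I.
Proof. by exists (enum I) => i; apply: list_In_mem; rewrite mem_enum. Qed.

Lemma listable_sigma (I : Type) (T : I -> Type) :
  listable I -> (forall i, listable (T i)) -> listable {i : I & T i}.
Proof.
move=> [l lP] /depfun_choice[m mP].
exists (List.flat_map
  (fun i => List.map (fun x => existT T i x) (m i)) l) => -[i x].
apply/List.in_flat_map; exists i; split=> //.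
by apply/List.in_map_iff; exists x.
Qed.

Lemma listable_sum (I J : Type) : listable I -> listable J -> listable (I + J)%type.
Proof.
move=> [l lP] [m mP].
exists (List.map inl l ++ List.map inr m) => -[i|j]; apply/List.in_or_app.
  by left; exact: List.in_map.
by right; exact: List.in_map.
Qed.

Lemma listable_option (I : Type) : listable I -> listable (option I).
Proof.
move=> [l lP]; exists (None :: List.map Some l) => -[i|]; last by left.
by right; exact: List.in_map.
Qed.

Lemma listable_shape (a : shape) : listable a.
Proof.
elim: a => [n|a la b lb|a [l lP] b [m mP]].
- exact: (@listable_finite 'I_n).
- exact: listable_sum.
exists (List.list_prod l m) => -[i j]; exact/List.in_prod.
Qed.

Lemma list_In_nth (I : Type) (i0 i : I) (l : seq I) :
  List.In i l -> exists2 k, (k < size l)%N & nth i0 l k = i.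
Proof.
elim: l => [//|j l IH] /= [ji|/IH[k lk kP]]; first by exists 0.
by exists k.+1.
Qed.

Lemma listable_surj (I : Type) :
  listable I -> exists n (h : 'I_n -> I), forall i, exists k, h k = i.
Proof.
move=> [l lP]; case: l lP => [|i0 l] lP.
  by exists 0, (fun k : 'I_0 => False_rect I (notF (ltn_ord k))) => i; case: (lP i).
exists (size l).+1, (fun k => nth i0 (i0 :: l) k) => i.
by have [k lk kP] := list_In_nth i0 (lP i); exists (Ordinal lk).
Qed.

Lemma listable_image (I J : Type) (f : I -> J) :
  listable I -> (forall j, exists i, f i = j) -> listable J.
Proof.
move=> [l lP] fP; exists (List.map f l) => j; apply/List.in_map_iff.
by have [i <-] := fP j; exists i.
Qed.

Lemma listable_bool_fun (I : Type) : listable I -> listable (I -> bool).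
Proof.
move=> /listable_surj[n [h hP]].
have /depfun_choice[k kP] := hP.
apply: (@listable_image {ffun 'I_n -> bool} _ (fun g i => g (k i))).
  exact: listable_finite.
move=> f; exists [ffun x => f (h x)]; apply: funext => i.
by rewrite ffunE kP.
Qed.

Lemma closed_forall (T I : Type) (K : set (set T)) :
  K setT -> (forall X Y, K X -> K Y -> K (X `&` Y)) -> listable I ->
  forall X : I -> set T, (forall i, K (X i)) -> K [set x | forall i, X i x].
Proof.
move=> KT KI [l lP] X KX.
have -> : [set x | forall i, X i x] = [set x | forall i, List.In i l -> X i x].
  by apply/seteqP; split=> x /= H i; [move=> _; exact: H|exact/H/lP].
elim: l {lP} => [|i l IH].
  by rewrite (_ : [set _ | _] = setT) //; apply/seteqP; split=> // x _ i [].
rewrite (_ : [set _ | _] =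
  X i `&` [set x | forall i0, List.In i0 l -> X i0 x]); first exact: KI.
apply/seteqP; split=> x /=.
  by move=> H; split=> [|j jl]; apply: H; [left|right].
by move=> [Xi Xl] j [<-|/Xl].
Qed.

(** * Substitution and blocks of existential quantifiers *)

Section Terms.
Context {L : language}.
Implicit Types G H : ctx (lsort L).

Fixpoint tsubst G H (sg : forall i : G, term H (srt i)) s (t : term G s) :
    term H s :=
  match t in term _ s return term H s with
  | tvar i => sg i
  | tapp f ts => tapp (fun i => tsubst sg (ts i))
  end.

Lemma eval_tsubst (M : structure L) G H (sg : forall i : G, term H (srt i)) s
    (t : term G s) (h : env M H) :
  eval h (tsubst sg t) = eval (fun i => eval h (sg i)) t.
Proof.
elim: t => [i|f ts IH] //=; congr fint.
by apply: functional_extensionality_dep => i; exact: IH.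
Qed.

Definition lift_subst G H s0 (sg : forall i : G, term H (srt i)) :
    forall o : cext G s0, term (cext H s0) (srt o) :=
  fun o => match o return term (cext H s0) (srt (c := cext G s0) o) with
           | inl i => weaken s0 (sg i)
           | inr j => @tvar L (cext H s0) (inr j)
           end.

Fixpoint fsubst G (phi : formula G) :
    forall H, (forall i : G, term H (srt i)) -> formula H :=
  match phi with
  | ftrue => fun H _ => ftrue H
  | feq _ t1 t2 => fun H sg => feq (tsubst sg t1) (tsubst sg t2)
  | frel r ts => fun H sg => frel (fun i => tsubst sg (ts i))
  | fnot phi => fun H sg => fnot (fsubst phi sg)
  | fand phi psi => fun H sg => fand (fsubst phi sg) (fsubst psi sg)
  | fex s phi => fun H sg => fex (fsubst phi (lift_subst sg))
  end.

Lemma fsubst_pp G (phi : formula G) H (sg : forall i : G, term H (srt i)) :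
  is_pp phi -> is_pp (fsubst phi sg).
Proof.
elim: phi H sg => {G} //= [G phi IH1 psi IH2|G s phi IH] H sg.
  by move=> [/IH1 ? /IH2].
exact: IH.
Qed.

Lemma eval_lift_subst (M : structure L) G H s0
    (sg : forall i : G, term H (srt i)) (h : env M H) (a : M s0) :
  (fun o => eval (env_ext h a) (lift_subst sg o)) =
  env_ext (fun i => eval h (sg i)) a.
Proof.
apply: functional_extensionality_dep => -[i|j] //=.
exact: eval_weaken.
Qed.

Lemma sat_fsubst (M : structure L) G (phi : formula G) H
    (sg : forall i : G, term H (srt i)) (h : env M H) :
  sat (fsubst phi sg) h <-> sat phi (fun i => eval h (sg i)).
Proof.
elim: phi H sg h => {G} //=.
- by move=> G s t1 t2 H sg h; rewrite !eval_tsubst.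
- move=> G r ts H sg h.
  rewrite (_ : (fun i => eval h (tsubst sg (ts i))) =
    fun i => eval (fun j => eval h (sg j)) (ts i)) //.
  by apply: functional_extensionality_dep => i; rewrite eval_tsubst.
- by move=> G phi IH H sg h; rewrite IH.
- by move=> G phi IH1 psi IH2 H sg h; rewrite IH1 IH2.
move=> G s phi IH H sg h; split=> -[a Ha]; exists a; move: Ha.
  by rewrite IH eval_lift_subst.
by rewrite IH eval_lift_subst.
Qed.

Lemma env_catK (M : lsort L -> Type) G H (e : env M (csum G H)) :
  env_cat (fun i : G => e (inl i) : M (srt i))
          (fun j : H => e (inr j) : M (srt j)) = e.
Proof. by apply: functional_extensionality_dep => -[]. Qed.

(** [fex] binds a single variable, while projections here concern whole contexts. The formula is
    chosen before the structure, because [Kset_exB_AC] reads the same pp-formula in B and in C. *)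
Lemma fex_block G H (phi : formula (csum G H)) :
  exists psi : formula G, (is_pp phi -> is_pp psi) /\
    forall (M : structure L) g,
      sat (M := M) psi g <-> exists h : env M H, sat phi (env_cat g h).
Proof.
have [l lP] := listable_shape H.
(* The variables of [H] in the list [m] remain to be quantified; the others have been
   replaced by the terms [B]. *)
have gen (m : seq H) : forall G' (A : forall i : G, term G' (srt i))
    (B : forall j : H, ~ List.In j m -> term G' (srt j)),
    exists psi : formula G', (is_pp phi -> is_pp psi) /\
      forall (M : structure L) g, sat (M := M) psi g <->
        exists h : env M H, (forall j n, h j = eval g (B j n)) /\
          sat phi (env_cat (fun i => eval g (A i)) h).
  elim: m => [|j0 m IH] G' A B.
    have n0 (j : H) : ~ List.In j [::] by [].
    pose K (x : csum G H) : term G' (srt x) :=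
      match x return term G' (srt (c := csum G H) x) with
      | inl i => A i | inr j => B j (n0 j) end.
    exists (fsubst phi K); split=> [|M g]; first exact: fsubst_pp.
    rewrite sat_fsubst (_ : (fun i => eval g (K i)) =
      env_cat (fun i => eval g (A i)) (fun j => eval g (B j (n0 j)))); last first.
      by apply: functional_extensionality_dep => -[].
    split=> [Xg|[h [hB]]].
      by eexists; split; [|exact: Xg] => j n; rewrite (Prop_irrelevance n (n0 j)).
    by rewrite (_ : h = fun j => eval g (B j (n0 j))) //;
      apply: functional_extensionality_dep.
  pose G'' := cext G' (srt j0).
  (* The variable [j0] is now the one bound last, and matching on [E] moves it to the sort of [j];
     any other variable keeps its earlier term, weakened. *)
  pose B' (j : H) (n : ~ List.In j m) : term G'' (srt j) :=
    match pselect (j0 = j) with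
    | left E => match E in _ = j return term G'' (srt j) with
                | erefl => @tvar L G'' (inr ord0) end
    | right N => weaken (srt j0) (B j (fun h => match h with
        | or_introl E => N E | or_intror k => n k end))
    end.
  have [psi [ppsi psiP]] := IH G'' (fun i => weaken (srt j0) (A i)) B'.
  exists (fex psi); split=> // M g /=.
  have eqA a : (fun i => eval (env_ext g a) (weaken (srt j0) (A i))) =
               (fun i => eval (M := M) g (A i)).
    by apply: functional_extensionality_dep => i; rewrite eval_weaken.
  split.
    move=> [a /psiP[h []]]; rewrite eqA => hB Xh; exists h; split=> // j n.
    have nm : ~ List.In j m by move=> jm; apply: n; right.
    rewrite (hB j nm) /B'; case: pselect => [E|N].
      by case: n; left.
    by rewrite eval_weaken; congr (eval g (B j _)); exact: Prop_irrelevance.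
  move=> [h [hB Xh]]; exists (h j0); apply/psiP; exists h; rewrite eqA.
  split=> // j n; rewrite /B'; case: pselect => [E|N]; first by case: _ / E.
  by rewrite eval_weaken; exact: hB.
have B0 (j : H) (n : ~ List.In j l) : False := n (lP j).
have [psi [ppsi psiP]] := gen l G (fun i => @tvar L G i)
  (fun j n => False_rect _ (B0 j n)).
exists psi; split=> // M g; rewrite psiP /=.
split=> [[h [_ Xh]]|[h Xh]]; first by exists h.
by exists h; split=> // j n; case: (n (lP j)).
Qed.

(** [J] depends neither on the structure nor on the point, so it is decided while the formula is
    built; one pp-formula then serves both B and C. *)
Lemma fand_all G (I : Type) (J : I -> Prop) (f : I -> formula G) :
  listable I -> (forall i, is_pp (f i)) ->
  exists psi : formula G, is_pp psi /\
    forall (M : structure L) (g : env M G),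
      sat psi g <-> forall i, J i -> sat (f i) g.
Proof.
move=> [l lP] pf.
suff [psi [ppsi psiP]] : exists psi : formula G, is_pp psi /\
    forall (M : structure L) (g : env M G),
      sat psi g <-> forall i, List.In i l -> J i -> sat (f i) g.
  exists psi; split=> // M g; rewrite psiP; split=> H i; last by move=> _; exact: H.
  exact/H/lP.
elim: l {lP} => [|i l [psi [ppsi psiP]]]; first by exists (ftrue G); split.
have [Ji|nJi] := pselect (J i); last first.
  exists psi; split=> // M g; rewrite psiP; split=> H j; last by move=> jl; apply: H; right.
  by case=> [<- /nJi //|/H].
exists (fand (f i) psi); split=> // M g /=; rewrite psiP; split=> [[fi H] j|H].
  by case=> [<-|/H].
by split=> [|j jl]; apply: H => //; [left|right].
Qed.

End Terms.

Section Definable.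
Context {L : language} (M : structure L).
Implicit Types G H : ctx (lsort L).

(** Definable sets and term functions ([tmf]) are handled through closure lemmas, so that later
    arguments write sets of assignments instead of formulas with bound variables. *)
Definition dfn G (X : set (env M G)) : Prop :=
  exists phi : formula G, forall e, sat phi e <-> X e.

Definition tmf G s (F : env M G -> M s) : Prop :=
  exists t : term G s, forall e, F e = eval e t.

Lemma dfn_iff G (X Y : set (env M G)) :
  (forall e, X e <-> Y e) -> dfn X -> dfn Y.
Proof. by move=> XY [phi phiP]; exists phi => e; rewrite phiP XY. Qed.

Lemma dfnT G : dfn (@setT (env M G)).
Proof. by exists (ftrue G) => e; split. Qed.

Lemma dfnC G (X : set (env M G)) : dfn X -> dfn (~` X).
Proof. by move=> [phi phiP]; exists (fnot phi) => e /=; rewrite phiP. Qed.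

Lemma dfnI G (X Y : set (env M G)) : dfn X -> dfn Y -> dfn (X `&` Y).
Proof.
by move=> [phi P1] [psi P2]; exists (fand phi psi) => e /=; rewrite P1 P2.
Qed.

Lemma dfn_forall G (I : Type) (X : I -> set (env M G)) :
  listable I -> (forall i, dfn (X i)) -> dfn [set e | forall i, X i e].
Proof. by move=> lI; apply: closed_forall => //; [exact: dfnT|exact: dfnI]. Qed.

Lemma dfn_exists G (I : Type) (X : I -> set (env M G)) :
  listable I -> (forall i, dfn (X i)) -> dfn [set e | exists i, X i e].
Proof.
move=> lI dX; have := dfnC (dfn_forall lI (fun i => dfnC (dX i))).
apply: dfn_iff => e; split=> [/existsNP[i /contrapT Xi]|[i Xi]]; first by exists i.
by move=> /(_ i).
Qed.

Lemma tmf_var G (i : G) : tmf (fun e : env M G => e i).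
Proof. by exists (tvar i). Qed.

Lemma tmf_subst G H s (F : env M G -> M s)
    (K : forall i : G, env M H -> M (srt i)) :
  tmf F -> (forall i, tmf (K i)) -> tmf (fun h => F (fun i => K i h)).
Proof.
move=> [t tP] /depfun_choice[sg sgP]; exists (tsubst sg t) => h.
rewrite eval_tsubst tP; congr (eval _ t).
by apply: functional_extensionality_dep => i; rewrite sgP.
Qed.

Lemma tmf_app H (f : lfunc L) (K : forall i : fdom f, env M H -> M (srt i)) :
  (forall i, tmf (K i)) -> tmf (fun h => fint (fun i => K i h)).
Proof.
move=> /depfun_choice[ts tsP]; exists (tapp ts) => h /=; congr fint.
by apply: functional_extensionality_dep => i; rewrite tsP.
Qed.

Lemma tmf_inl G H s (F : env M G -> M s) :
  tmf F -> tmf (fun e : env M (csum G H) => F (fun i => e (inl i))).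
Proof.
move=> dF; apply: (@tmf_subst G (csum G H) s F (fun i e => e (inl i))) => // i.
exact: (@tmf_var (csum G H) (inl i)).
Qed.

Lemma tmf_inr G H s (F : env M H -> M s) :
  tmf F -> tmf (fun e : env M (csum G H) => F (fun i => e (inr i))).
Proof.
move=> dF; apply: (@tmf_subst H (csum G H) s F (fun i e => e (inr i))) => // i.
exact: (@tmf_var (csum G H) (inr i)).
Qed.

Lemma dfn_subst G H (X : set (env M G))
    (K : forall i : G, env M H -> M (srt i)) :
  dfn X -> (forall i, tmf (K i)) -> dfn [set h | X (fun i => K i h)].
Proof.
move=> [phi phiP] /depfun_choice[sg sgP]; exists (fsubst phi sg) => h.
rewrite sat_fsubst phiP /= (_ : (fun i => _) = fun i => K i h) //.
by apply: functional_extensionality_dep => i; rewrite sgP.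
Qed.

Lemma dfn_inl G H (X : set (env M G)) :
  dfn X -> dfn [set e : env M (csum G H) | X (fun i => e (inl i))].
Proof.
move=> dX; apply: (@dfn_subst G (csum G H) X (fun i e => e (inl i))) => // i.
exact: (@tmf_var (csum G H) (inl i)).
Qed.

Lemma dfn_inr G H (X : set (env M H)) :
  dfn X -> dfn [set e : env M (csum G H) | X (fun i => e (inr i))].
Proof.
move=> dX; apply: (@dfn_subst H (csum G H) X (fun i e => e (inr i))) => // i.
exact: (@tmf_var (csum G H) (inr i)).
Qed.

Lemma dfn_eq G s (F K : env M G -> M s) :
  tmf F -> tmf K -> dfn [set e | F e = K e].
Proof. by move=> [t tP] [r rP]; exists (feq t r) => e /=; rewrite tP rP. Qed.

Lemma dfn_rel H (r : lrel L) (K : forall i : rdom r, env M H -> M (srt i)) :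
  (forall i, tmf (K i)) -> dfn [set h | rint (fun i => K i h)].
Proof.
move=> /depfun_choice[ts tsP]; exists (frel ts) => h /=.
rewrite (_ : (fun i => eval h (ts i)) = fun i => K i h) //.
by apply: functional_extensionality_dep => i; rewrite tsP.
Qed.

Lemma dfn_ex G H (X : set (env M (csum G H))) :
  dfn X -> dfn [set g | exists h : env M H, X (env_cat g h)].
Proof.
move=> [phi phiP]; have [psi [_ psiP]] := fex_block phi; exists psi => g.
by rewrite psiP /=; split=> -[h Xh]; exists h; apply/phiP.
Qed.

End Definable.

(** [itm H s F] says that [F] is an admissible way to name an element of sort [s] of [N] from a
    tuple of [M]. By the last hypothesis on [itm] the sort [s] is covered by tuples of a context
    [K], so that a quantifier over [s] becomes a block of quantifiers of [M]. Instances are the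
    passages from M to M^eq and back, from C to its expansion, and from the expansions of A and C to
    M. *)
Lemma interpretation (L1 L2 : language) (N : structure L1) (M : structure L2)
    (itm : forall (H : ctx (lsort L2)) (s : lsort L1),
      (env M H -> N s) -> Prop) :
  (forall H (f : lfunc L1) (F : forall i : fdom f, env M H -> N (srt i)),
     (forall i, itm H _ (F i)) -> itm H _ (fun h => fint (fun i => F i h))) ->
  (forall H s (F K : env M H -> N s),
     itm H s F -> itm H s K -> dfn [set h | F h = K h]) ->
  (forall H (r : lrel L1) (F : forall i : rdom r, env M H -> N (srt i)),
     (forall i, itm H _ (F i)) -> dfn [set h | rint (fun i => F i h)]) ->
  (forall H s, exists (K : ctx (lsort L2)) (v : env M K -> N s),
     [/\ forall x, exists k, v k = x,
         itm (csum H K) s (fun e => v (fun j => e (inr j)))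
       & forall s' (F : env M H -> N s'), itm H s' F ->
           itm (csum H K) s' (fun e => F (fun i => e (inl i)))]) ->
  forall (G : ctx (lsort L1)) (phi : formula G) (H : ctx (lsort L2))
    (F : forall i : G, env M H -> N (srt i)),
    (forall i, itm H _ (F i)) -> dfn [set h | sat phi (fun i => F i h)].
Proof.
move=> Hfun Heq Hrel Hex G phi H.
have term_itm G' s (t : term G' s) H' (F : forall i : G', env M H' -> N (srt i)) :
    (forall i, itm H' _ (F i)) -> itm H' s (fun h => eval (fun i => F i h) t).
  by move=> HF; elim: t => [i|f ts IH] //=; exact: Hfun.
elim: phi H => {G} /=.
- by move=> G H F HF; exact: dfnT.
- by move=> G s t1 t2 H F HF; apply: Heq; exact: term_itm.
- by move=> G r ts H F HF; apply: Hrel => i; exact: term_itm.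
- by move=> G phi IH H F HF; exact/dfnC/IH.
- by move=> G phi IH1 psi IH2 H F HF; apply: dfnI; [exact: IH1|exact: IH2].
move=> G s phi IH H F HF.
have [K [v [vsurj dv dinl]]] := Hex H s.
pose F' (o : cext G s) : env M (csum H K) -> N (srt o) :=
  match o return env M (csum H K) -> N (srt (c := cext G s) o) with
  | inl i => fun e => F i (fun i => e (inl i))
  | inr j => fun e => v (fun j => e (inr j))
  end.
have dF' o : itm (csum H K) _ (F' o) by case: o => [i|j] //=; exact: dinl.
have eqF h k : (fun o => F' o (env_cat h k)) = env_ext (fun i => F i h) (v k).
  by apply: functional_extensionality_dep => -[].
have := dfn_ex (IH _ _ dF'); apply: dfn_iff => h /=; split=> [[k]|[a]].
  by rewrite eqF; exists (v k).
by have [k <-] := vsurj a; rewrite -eqF; exists k.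
Qed.

Section Definability.
Context {L : language} (M : structure L).
Implicit Types (G H : ctx (lsort L)) (D : set (elt M)).

Definition defover D G (X : set (env M G)) : Prop :=
  exists theta : pformula M G, over D theta /\ X = solutions theta.

Lemma defoverP D G (X : set (env M G)) :
  defover D X <-> exists H (Y : set (env M (csum G H))) (h : env M H),
    [/\ params_in D h, dfn Y & forall g, X g <-> Y (env_cat g h)].
Proof.
split=> [[[H phi h] [Dh ->]]|[H [Y [h [Dh [phi phiP] XY]]]]].
  by exists H, [set e | sat phi e], h; split=> //; exists phi.
exists (PFormula phi h); split=> //.
by apply/seteqP; split=> g; [move/XY/phiP|move/phiP/XY].
Qed.

Lemma defoverS D D' G (X : set (env M G)) :
  D `<=` D' -> defover D X -> defover D' X.
Proof.
by move=> DD' [theta [Dtheta ->]]; exists theta; split=> // i; exact: DD'.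
Qed.

Lemma defover_iff D G (X Y : set (env M G)) :
  (forall e, X e <-> Y e) -> defover D X -> defover D Y.
Proof. by move=> XY; rewrite (_ : X = Y) //; apply/seteqP; split=> e /XY. Qed.

Definition cempty : ctx (lsort L) :=
  @Ctx _ (sh_ord 0) (fun i : 'I_0 => False_rect _ (notF (ltn_ord i))).
Definition env_empty : env M cempty :=
  fun i : 'I_0 => False_rect _ (notF (ltn_ord i)).

Lemma dfn_defover D G (X : set (env M G)) : dfn X -> defover D X.
Proof.
move=> dX; apply/defoverP.
exists cempty, [set e | X (fun i => e (inl i))], env_empty.
by split=> //; [case|exact: dfn_inl].
Qed.

Lemma defover_subst D G H (X : set (env M G))
    (K : forall i : G, env M H -> M (srt i)) :
  defover D X -> (forall i, tmf (K i)) -> defover D [set h | X (fun i => K i h)].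
Proof.
move=> /defoverP[Q [Y [q [Dq dY XY]]]] dK; apply/defoverP.
pose K' (x : csum G Q) : env M (csum H Q) -> M (srt x) :=
  match x return env M (csum H Q) -> M (srt (c := csum G Q) x) with
  | inl i => fun e => K i (fun i => e (inl i))
  | inr j => fun e => e (inr j)
  end.
exists Q, [set e | Y (fun x => K' x e)], q; split=> //.
  apply: dfn_subst => // -[i|j]; first exact: (tmf_inl Q (dK i)).
  exact: (@tmf_var _ _ (csum H Q) (inr j)).
move=> h /=; rewrite XY (_ : env_cat _ q = fun x => K' x (env_cat h q)) //.
by apply: functional_extensionality_dep => -[].
Qed.

Lemma defover_inl D G H (X : set (env M G)) : defover D X ->
  defover D [set e : env M (csum G H) | X (fun i => e (inl i))].
Proof.
move=> DX; apply: (@defover_subst D G (csum G H) X (fun i e => e (inl i))) => // i.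
exact: (@tmf_var _ _ (csum G H) (inl i)).
Qed.

Lemma defover_inr D G H (X : set (env M H)) : defover D X ->
  defover D [set e : env M (csum G H) | X (fun i => e (inr i))].
Proof.
move=> DX; apply: (@defover_subst D H (csum G H) X (fun i e => e (inr i))) => // i.
exact: (@tmf_var _ _ (csum G H) (inr i)).
Qed.

Lemma defoverC D G (X : set (env M G)) : defover D X -> defover D (~` X).
Proof.
move=> /defoverP[H [Y [h [Dh dY XY]]]]; apply/defoverP.
by exists H, (~` Y), h; split=> //; [exact: dfnC|move=> g /=; rewrite XY].
Qed.

Lemma defoverI D G (X Y : set (env M G)) :
  defover D X -> defover D Y -> defover D (X `&` Y).
Proof.
move=> /defoverP[H [X' [h [Dh dX XX]]]] /defoverP[H' [Y' [h' [Dh' dY YY]]]].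
pose T := csum G (csum H H').
pose K1 (x : csum G H) : env M T -> M (srt x) :=
  match x return env M T -> M (srt (c := csum G H) x) with
  | inl i => fun e => e (inl i) | inr j => fun e => e (inr (inl j)) end.
pose K2 (x : csum G H') : env M T -> M (srt x) :=
  match x return env M T -> M (srt (c := csum G H') x) with
  | inl i => fun e => e (inl i) | inr j => fun e => e (inr (inr j)) end.
have dK1 x : tmf (K1 x).
  case: x => [i|j]; first exact: (@tmf_var _ _ T (inl i)).
  exact: (@tmf_var _ _ T (inr (inl j))).
have dK2 x : tmf (K2 x).
  case: x => [i|j]; first exact: (@tmf_var _ _ T (inl i)).
  exact: (@tmf_var _ _ T (inr (inr j))).
apply/defoverP; exists (csum H H'), ([set e | X' (fun x => K1 x e)] `&`
  [set e | Y' (fun x => K2 x e)]), (env_cat h h'); split.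
- by move=> [i|i]; [exact: Dh|exact: Dh'].
- by apply: dfnI; exact: dfn_subst.
move=> g; rewrite /= -[X g /\ Y g]/((X `&` Y) g) /setI /= XX YY.
rewrite (_ : env_cat g h = fun x => K1 x (env_cat g (env_cat h h'))); last first.
  by apply: functional_extensionality_dep => -[].
rewrite (_ : env_cat g h' = fun x => K2 x (env_cat g (env_cat h h'))) //.
by apply: functional_extensionality_dep => -[].
Qed.

Lemma defover_ex D G H (X : set (env M (csum G H))) :
  defover D X -> defover D [set g | exists h : env M H, X (env_cat g h)].
Proof.
move=> /defoverP[Q [Y [q [Dq dY XY]]]].
pose T := csum (csum G Q) H.
pose K (x : csum (csum G H) Q) : env M T -> M (srt x) :=
  match x return env M T -> M (srt (c := csum (csum G H) Q) x) with
  | inl (inl i) => fun e => e (inl (inl i))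
  | inl (inr j) => fun e => e (inr j)
  | inr k => fun e => e (inl (inr k)) end.
have dK x : tmf (K x).
  case: x => [[i|i]|i].
  - exact: (@tmf_var _ _ T (inl (inl i))).
  - exact: (@tmf_var _ _ T (inr i)).
  - exact: (@tmf_var _ _ T (inl (inr i))).
have eqK g h :
    (fun x => K x (env_cat (env_cat g q) h)) = env_cat (env_cat g h) q.
  by apply: functional_extensionality_dep => -[[]|].
apply/defoverP; exists Q; have := dfn_ex (dfn_subst dY dK).
set Z := (X in dfn X) => dZ; exists Z, q; split=> // g.
rewrite /Z /=; split=> -[h Xh]; exists h; move: Xh; rewrite XY.
  by rewrite eqK.
by rewrite eqK.
Qed.

Lemma defover_forall D G (I : Type) (X : I -> set (env M G)) :
  listable I -> (forall i, defover D (X i)) -> defover D [set e | forall i, X i e].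
Proof.
move=> lI; apply: closed_forall => //; [exact/dfn_defover/dfnT|exact: defoverI].
Qed.

Lemma defover_param D G H (X : set (env M (csum G H))) (h : env M H) :
  params_in D h -> defover D X -> defover D [set g | X (env_cat g h)].
Proof.
move=> Dh /defoverP[Q [Y [q [Dq dY XY]]]]; apply/defoverP.
pose T := csum G (csum H Q).
pose K (x : csum (csum G H) Q) : env M T -> M (srt x) :=
  match x return env M T -> M (srt (c := csum (csum G H) Q) x) with
  | inl (inl i) => fun e => e (inl i)
  | inl (inr j) => fun e => e (inr (inl j))
  | inr k => fun e => e (inr (inr k)) end.
have dK x : tmf (K x).
  case: x => [[i|i]|i].
  - exact: (@tmf_var _ _ T (inl i)).
  - exact: (@tmf_var _ _ T (inr (inl i))).
  - exact: (@tmf_var _ _ T (inr (inr i))).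
exists (csum H Q), [set e | Y (fun x => K x e)], (env_cat h q); split.
- by move=> [i|i]; [exact: Dh|exact: Dq].
- exact: dfn_subst.
move=> g /=; rewrite XY (_ : env_cat _ q = fun x => K x (env_cat g (env_cat h q))) //.
by apply: functional_extensionality_dep => -[[]|].
Qed.

Lemma defover_singletons D G (h : env M G) :
  (forall i, dcl D (in_elt (h i))) ->
  exists Q (Y : set (env M (csum G Q))) (q : env M Q),
    [/\ params_in D q, dfn Y & forall g, Y (env_cat g q) <-> g = h].
Proof.
move=> hD; suff /defoverP[Q [Y [q [Dq dY XY]]]] : defover D [set g | g = h].
  by exists Q, Y, q; split=> // g; rewrite -XY.
apply: (@defover_iff _ _ [set g : env M G | forall i, g i = h i]).
  move=> g /=; split=> [gh|-> //]; exact: functional_extensionality_dep.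
apply: defover_forall; first exact: listable_shape.
move=> i; have [Q [phi [q [Dq phiE]]]] := hD i.
apply/defoverP.
pose T := csum G Q.
pose K (x : cext Q (srt i)) : env M T -> M (srt x) :=
  match x return env M T -> M (srt (c := cext Q (srt i)) x) with
  | inl j => fun e => e (inr j) | inr _ => fun e => e (inl i) end.
have dK x : tmf (K x).
  case: x => [j|j]; first exact: (@tmf_var _ _ T (inr j)).
  by exists (@tvar L T (inl i)).
have dphi : dfn [set e : env M (cext Q (srt i)) | sat phi e] by exists phi.
exists Q, [set e | sat phi (fun x => K x e)], q; split=> //.
  exact: (dfn_subst dphi dK).
move=> g /=; rewrite (_ : (fun x => K x _) = env_ext q (g i)); last first.
  by apply: functional_extensionality_dep => -[].
by rewrite -[sat _ _]/(fibre phi q (g i)) phiE.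
Qed.

(** The parameters can be quantified away, since a formula over [D] has them as its only
    solution. *)
Lemma defover_dcl D G (X : set (env M G)) : defover (dcl D) X -> defover D X.
Proof.
move=> /defoverP[H [Y [h [Dh dY XY]]]].
have [Q [Z [q [Dq dZ ZE]]]] := defover_singletons Dh.
pose T := csum (csum G Q) H.
pose K1 (x : csum G H) : env M T -> M (srt x) :=
  match x return env M T -> M (srt (c := csum G H) x) with
  | inl i => fun e => e (inl (inl i)) | inr j => fun e => e (inr j) end.
pose K2 (x : csum H Q) : env M T -> M (srt x) :=
  match x return env M T -> M (srt (c := csum H Q) x) with
  | inl i => fun e => e (inr i) | inr j => fun e => e (inl (inr j)) end.
have dK1 x : tmf (K1 x).
  case: x => [i|j]; first exact: (@tmf_var _ _ T (inl (inl i))).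
  exact: (@tmf_var _ _ T (inr j)).
have dK2 x : tmf (K2 x).
  case: x => [i|j]; first exact: (@tmf_var _ _ T (inr i)).
  exact: (@tmf_var _ _ T (inl (inr j))).
have eq1 g k : (fun x => K1 x (env_cat (env_cat g q) k)) = env_cat g k.
  by apply: functional_extensionality_dep => -[].
have eq2 g k : (fun x => K2 x (env_cat (env_cat g q) k)) = env_cat k q.
  by apply: functional_extensionality_dep => -[].
apply/defoverP; exists Q.
have := dfn_ex (dfnI (dfn_subst dY dK1) (dfn_subst dZ dK2)).
set W := (X in dfn X) => dW; exists W, q; split=> // g; rewrite /W /= XY.
split=> [Yg|[k []]]; last by rewrite eq1 eq2 ZE => Yg <-.
by exists h; rewrite /= eq1 eq2 ZE.
Qed.

Definition env1 s (a : M s) : env M (cconst 1 s) := fun _ => a.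

Lemma dcl_def D s (a : M s) (X : set (env M (cconst 1 s))) :
  defover D X -> (forall b, X (env1 b) <-> b = a) -> dcl D (in_elt a).
Proof.
move=> /defoverP[H [Y [h [Dh dY XY]]]] XE.
pose K (x : csum (cconst 1 s) H) : env M (cext H s) -> M (srt x) :=
  match x return env M (cext H s) -> M (srt (c := csum (cconst 1 s) H) x) with
  | inl i => fun e => e (inr ord0) | inr j => fun e => e (inl j) end.
have dK x : tmf (K x).
  case: x => [i|j]; first by exists (@tvar L (cext H s) (inr ord0)).
  exact: (@tmf_var _ _ (cext H s) (inl j)).
have [phi phiP] := dfn_subst dY dK.
exists H, phi, h; split=> //; apply/seteqP.
have eqK b : (fun x => K x (env_ext h b)) = env_cat (env1 b) h.
  by apply: functional_extensionality_dep => -[].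
by split=> b; rewrite /fibre /= phiP /= eqK -XY XE.
Qed.

Lemma acl_def D s (a : M s) (X : set (env M (cconst 1 s))) :
  defover D X -> X (env1 a) -> finite_set [set b : M s | X (env1 b)] ->
  acl D (in_elt a).
Proof.
move=> /defoverP[H [Y [h [Dh dY XY]]]] Xa finX.
pose K (x : csum (cconst 1 s) H) : env M (cext H s) -> M (srt x) :=
  match x return env M (cext H s) -> M (srt (c := csum (cconst 1 s) H) x) with
  | inl i => fun e => e (inr ord0) | inr j => fun e => e (inl j) end.
have dK x : tmf (K x).
  case: x => [i|j]; first by exists (@tvar L (cext H s) (inr ord0)).
  exact: (@tmf_var _ _ (cext H s) (inl j)).
have [phi phiP] := dfn_subst dY dK.
have eqK b : (fun x => K x (env_ext h b)) = env_cat (env1 b) h.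
  by apply: functional_extensionality_dep => -[].
exists H, phi, h; have fibE : fibre phi h = [set b : M s | X (env1 b)].
  by apply/seteqP; split=> b; rewrite /fibre /= phiP /= eqK -XY.
by split; rewrite //= ?fibE.
Qed.

End Definability.

(** * Indiscernible sequences from ultrafilters *)

Section IteratedLimits.
Context (U : set_system nat) {UU : UltraFilter U} (UN : \oo `<=` U).

(* [UQ k V]: for U-many i_1, for U-many i_2, ..., V [:: i_1; ...; i_k]. *)
Fixpoint UQ k (V : seq nat -> Prop) : Prop :=
  if k is k'.+1 then U [set i | UQ k' (fun s => V (i :: s))] else V [::].

Lemma UQ_imp k (V W : seq nat -> Prop) :
  (forall s, size s = k -> V s -> W s) -> UQ k V -> UQ k W.
Proof.
elim: k V W => [|k IH] V W VW /=; first exact: VW.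
by apply: filterS => i; apply: IH => s sk; apply: VW; rewrite /= sk.
Qed.

Lemma UQ_and k (V W : seq nat -> Prop) :
  UQ k V -> UQ k W -> UQ k (fun s => V s /\ W s).
Proof.
elim: k V W => [|k IH] V W //= UV UW.
by apply: filterS (filterI UV UW) => i [Vi Wi]; exact: IH.
Qed.

Lemma UQ_not k (V : seq nat -> Prop) : UQ k (fun s => ~ V s) <-> ~ UQ k V.
Proof.
elim: k V => [//|k IH] V /=.
rewrite (_ : [set i | _] = ~` [set i | UQ k (fun s => V (i :: s))]); last first.
  by apply/seteqP; split=> i /IH.
split=> [UnV UV|nUV].
  by have [i []] := filter_ex (filterI UV UnV).
by have [//|//] := in_ultra_setVsetC [set i | UQ k (fun s => V (i :: s))] UU.
Qed.

Lemma UQ_true k (V : seq nat -> Prop) : (forall s, V s) -> UQ k V.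
Proof.
by elim: k V => [|k IH] V VT //=; apply: filterS filterT => i _; exact: IH.
Qed.

Lemma UQ_all k n (V : 'I_n -> seq nat -> Prop) :
  (forall j, UQ k (V j)) -> UQ k (fun s => forall j, V j s).
Proof.
have [l lP] := listable_finite 'I_n => UV.
have : UQ k (fun s => forall j, List.In j l -> V j s).
  elim: l {lP} => [|j l IH]; first exact: UQ_true.
  apply: UQ_imp (UQ_and (UV j) IH) => s _ [Vj Vl] i [<-//|]; exact: Vl.
by apply: UQ_imp => s _ Vs j; exact/Vs/lP.
Qed.

(** A dropped coordinate is the limit of a constant. Hence a subtuple with increasing indices has
    the same limit type as an initial segment, which is the source of indiscernibility. *)
Lemma UQ_mask (b : bitseq) (V : seq nat -> Prop) :
  UQ (size b) (fun s => V (mask b s)) <-> UQ (count id b) V.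
Proof.
elim: b V => [//|[] b IH] V /=.
  rewrite (_ : [set i | UQ (size b) _] =
    [set i | UQ (count id b) (fun s => V (i :: s))]) //.
  by apply/seteqP; split=> i; rewrite /= (IH (fun s => V (i :: s))).
rewrite -IH; split=> [/filter_ex[]//|H].
by apply: filterS filterT.
Qed.

Lemma UQ_rcons k (V : seq nat -> Prop) :
  UQ k.+1 V -> UQ k (fun s => exists i, V (rcons s i)).
Proof.
elim: k V => [|k IH] V; first by move=> /= /filter_ex[i Vi]; exists i.
by move=> /= UV; apply: filterS UV => i /(IH (fun s => V (i :: s))).
Qed.

(** Final segments of nat belong to [U], so each index may be taken larger than the preceding
    ones. *)
Lemma UQ_sorted k : UQ k (fun s => sorted ltn s).
Proof.
have path_UQ m j : UQ j (fun s => path ltn m s).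
  elim: j m => [//|j IH] m /=.
  apply: filterS (UN (_ : _ [set i | (m < i)%N])) => [i mi|].
    by apply: UQ_imp (IH i) => s _; rewrite /= mi.
  by exists m.+1.
by case: k => [//|k] /=; apply: filterS filterT => i _; exact: path_UQ.
Qed.

(** Puts an increasing choice of indices into the form of a mask, to which [UQ_mask] applies. *)
Lemma increasing_mask k m (i : 'I_k -> nat) :
  {homo i : x y / (x < y)%N} -> (forall x, (i x < m)%N) ->
  exists b : bitseq, [/\ size b = m, count id b = k
    & forall s, size s = m -> forall x : 'I_k, nth 0 (mask b s) x = nth 0 s (i x)].
Proof.
move=> ih im; pose c := [seq i x | x <- enum 'I_k].
have sc : sorted ltn c.
  rewrite sorted_map; apply: (@sub_sorted _ (relpre val ltn)); first exact: ih.
  by rewrite -sorted_map val_enum_ord iota_ltn_sorted.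
have cE : [seq x <- seq.iota 0 m | x \in c] = c.
  apply: (irr_sorted_eq ltn_trans ltnn) => //.
    exact/(sorted_filter ltn_trans)/iota_ltn_sorted.
  move=> x; rewrite mem_filter mem_iota add0n /=.
  by apply: andb_idr => /mapP[y _ ->].
exists [seq x \in c | x <- seq.iota 0 m]; split.
- by rewrite size_map size_iota.
- by rewrite count_map -size_filter (eq_filter (a2 := mem c)) // cE size_map size_enum_ord.
move=> s sm x; rewrite -{1}[s](mkseq_nth 0) sm /mkseq -map_mask.
rewrite -filter_mask cE (nth_map 0) ?size_map ?size_enum_ord //.
by rewrite (nth_map x) ?size_enum_ord // nth_ord_enum.
by rewrite -enumT size_enum_ord.
Qed.

Context {L : language} (N : structure L) (D : set (elt N)).

(** Saturation over [D] and one further finite tuple [c]. Restricting the contexts allows its use in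
    M^eq, where it will be proved for tuples of home sorts. *)
Definition realizes (H Q : ctx (lsort L)) : Prop :=
  forall (c : env N Q) (p : set (set (env N (csum H Q)))),
    (forall V, p V -> defover D V) ->
    (forall n (V : 'I_n -> set (env N (csum H Q))), (forall i, p (V i)) ->
       exists y, forall i, V i (env_cat y c)) ->
    exists y, forall V, p V -> V (env_cat y c).

Definition block k (P : ctx (lsort L)) (b : nat -> env N P) : env N (crep k P) :=
  fun x => b x.1 x.2.

(** The types over [D] of (f i_1, ..., f i_k), in the iterated limit along [U], form a coherent
    sequence of complete types, which [b] realizes one term after the other. The first one is the
    type of [e], because every [f i] realizes it; this is what allows [e] as the first term. *)
Lemma extraction (P : ctx (lsort L)) (e : env N P) (f : nat -> env N P) :
  (forall k, realizes P (crep k P)) ->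
  (forall i Z, defover D Z -> Z e -> Z (f i)) ->
  exists b : nat -> env N P,
    [/\ b 0%N = e, indiscernible D b
      & forall m (W : set (env N (crep m P))), defover D W ->
          (forall i : nat -> nat, {homo i : x y / (x < y)%N} -> W (block (f \o i))) ->
          W (block b)].
Proof.
move=> real fe.
pose fs (s : seq nat) : nat -> env N P := fun i => f (nth 0 s i).
pose Inv k (b : nat -> env N P) := forall W : set (env N (crep k P)),
  defover D W -> (W (block b) <-> UQ k (fun s => W (block (fs s)))).
(* The limit type is complete: one implication, applied to [W] and to its complement, gives both. *)
have Inv_half k b : (forall W : set (env N (crep k P)), defover D W ->
    UQ k (fun s => W (block (fs s))) -> W (block b)) -> Inv k b.
  move=> half W DW; split; last exact: half.
  by apply: contraPP => /UQ_not UW; exact: (half (~` W) (defoverC DW)).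
have Inv1 : Inv 1 (fun _ => e).
  apply: Inv_half => W DW; apply: contraPP => nWe.
  pose Z : set (env N P) := [set y | W (block (fun _ => y))].
  have DZ : defover D Z.
    apply: (@defover_subst _ _ D (crep 1 P) P W (fun x y => y x.2)) => // x.
    exact: tmf_var.
  suff /UQ_not : UQ 1 (fun s => ~ W (block (fs s))) by [].
  rewrite /=; apply: filterS filterT => i _ /=.
  rewrite (_ : block _ = block (fun _ => f i)).
    exact: (fe i _ (defoverC DZ) nWe).
  by apply: functional_extensionality_dep => -[x y]; rewrite /block /fs /= ord1.
pose ext k (b : nat -> env N P) y := fun i => if (i < k)%N then b i else y.
have step k b : Inv k b -> exists y, Inv k.+1 (ext k b y).
  move=> Ib.
  pose T := csum P (crep k P).
  pose K (x : crep k.+1 P) : env N T -> N (srt x) :=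
    fun e => if (insub (x.1 : nat) : option 'I_k) is Some i then e (inr (i, x.2))
             else e (inl x.2).
  have dK x : tmf (K x).
    rewrite /K; case: insub => [i|]; last by exists (@tvar L T (inl x.2)).
    by exists (@tvar L T (inr (i, x.2))).
  have eqK b' y : (fun x => K x (env_cat y (block b'))) = block (ext k b' y).
    apply: functional_extensionality_dep => x; rewrite /K /block /ext.
    by case: insubP => [i -> /= ->|/negbTE ->].
  pose pull (W : set (env N (crep k.+1 P))) : set (env N T) :=
    [set e | W (fun x => K x e)].
  have [] := real k (block b) [set V | exists W, [/\ defover D W,
      UQ k.+1 (fun s => W (block (fs s))) & V = pull W]].
  - by move=> _ [W [DW _ ->]]; exact: defover_subst.
  - move=> n V /depfun_choice[W HW].
    pose X : set (env N T) := [set e | forall i, pull (W i) e].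
    have DX : defover D X.
      have DpW i : defover D (pull (W i)).
        by have [DW _ _] := HW i; exact: defover_subst.
      exact: (defover_forall (@listable_finite 'I_n) DpW).
    pose X' : set (env N (crep k P)) := [set c | exists y, X (env_cat y c)].
    have DX' : defover D X'.
      pose T' := csum (crep k P) P.
      pose S (x : csum P (crep k P)) : env N T' -> N (srt x) :=
        match x return env N T' -> N (srt (c := csum P (crep k P)) x) with
        | inl i => fun e => e (inr i) | inr i => fun e => e (inl i) end.
      have dS x : tmf (S x).
        case: x => i; first exact: (@tmf_var _ _ T' (inr i)).
        exact: (@tmf_var _ _ T' (inl i)).
      have := defover_ex (defover_subst DX dS); apply: defover_iff => c /=.
      have eqS y : (fun x => S x (env_cat c y)) = env_cat y c.
        by apply: functional_extensionality_dep => -[].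
      split=> -[y Xy]; exists y; move: Xy.
        by rewrite eqS.
      by rewrite eqS.
    (* A set in the ultrafilter is nonempty, so the innermost limit provides an index j, and [f j]
       is a witness for the finite conjunction. *)
    have : UQ k (fun s => X' (block (fs s))).
      have /UQ_rcons : UQ k.+1 (fun s => forall i, W i (block (fs s))).
        by apply: UQ_all => i; have [] := HW i.
      apply: UQ_imp => s sk [j Wj]; exists (f j) => i; rewrite /pull /= eqK.
      rewrite (_ : block _ = block (fs (rcons s j))) //.
      apply: functional_extensionality_dep => -[x y].
      rewrite /block /ext /fs /= nth_rcons sk; case: ltnP => // kx.
      by rewrite (_ : x == k :> nat) // eqn_leq kx -ltnS ltn_ord.
    move=> /(Ib _ DX')[y Xy]; exists y => i; have [_ _ ->] := HW i; exact: Xy.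
  move=> y yP; exists y; apply: Inv_half => W DW UW.
  by have := yP (pull W); rewrite /pull /= eqK; apply; exists W.
pose st k := {b : nat -> env N P | Inv k.+1 b}.
pose next k (b : st k) : st k.+1 :=
  exist _ (ext k.+1 (projT1 b) (projT1 (cid (step _ _ (projT2 b)))))
          (projT2 (cid (step _ _ (projT2 b)))).
pose fix B k : st k := if k is k'.+1 then next _ (B k') else exist _ _ Inv1.
pose b i := projT1 (B i) i.
have Bb n i : (i <= n)%N -> projT1 (B n) i = b i.
  elim: n => [|n IH]; first by rewrite leqn0 => /eqP ->.
  rewrite leq_eqVlt => /orP[/eqP -> //|]; rewrite ltnS => lin.
  by rewrite -IH // /= /ext ltnS lin.
have Ib k : Inv k b.
  case: k => [|k] W DW.
    rewrite /= (_ : block b = block (fs [::])) //.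
    by apply: functional_extensionality_dep => -[[]].
  rewrite -(projT2 (B k) W DW) (_ : block b = block (projT1 (B k))) //.
  apply: functional_extensionality_dep => -[x y].
  have E : projT1 (B k) x = b x by apply: Bb; rewrite -ltnS ltn_ord.
  exact: (congr1 (fun g : env N P => g y) (esym E)).
exists b; split=> //.
- move=> k Q phi c i j Dc ih jh at_.
  pose W : set (env N (crep k P)) := [set z | sat phi (env_cat z c)].
  have DW : defover D W by exists (PFormula phi c).
  (* The right-hand side does not mention [l], so all increasing choices of indices agree. The bound
     [m] makes the chosen terms a subtuple of the first m ones. *)
  have inv (l : 'I_k -> nat) : {homo l : x y / (x < y)%N} ->
      W (at_ l) <-> UQ k (fun s => W (block (fs s))).
    move=> lh; pose m := (\max_(x : 'I_k) l x).+1.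
    have lm x : (l x < m)%N by rewrite ltnS (leq_bigmax x).
    have [B' [sB cB mB]] := increasing_mask lh lm.
    pose K (x : crep k P) : env N (crep m P) -> N (srt x) :=
      fun e => e (Ordinal (lm x.1), x.2).
    have dK x : tmf (K x) by exists (@tvar L (crep m P) (Ordinal (lm x.1), x.2)).
    have DK := defover_subst DW dK.
    rewrite -[W (at_ l)]/([set z | W (fun x => K x z)] (block b)) (Ib m _ DK).
    have := UQ_mask B' (fun s => W (block (fs s))); rewrite sB cB => <-.
    split; apply: UQ_imp => s sm; rewrite /=.
      rewrite (_ : (fun x => _) = block (fs (mask B' s))) //.
      by apply: functional_extensionality_dep => -[x y];
        rewrite /K /block /fs /= mB.
    rewrite (_ : block (fs (mask B' s)) = fun x => K x (block (fs s))) //.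
    by apply: functional_extensionality_dep => -[x y];
      rewrite /K /block /fs /= mB.
  by rewrite -[sat _ _]/(W (at_ i)) -[X in _ <-> X]/(W (at_ j)) !inv.
move=> m W DW Wf; apply/(Ib m _ DW); apply: UQ_imp (UQ_sorted m) => s sm ss.
(* [Wf] expects an increasing map on all of nat; after the m entries of [s] it continues by adding x
   to the last entry. *)
pose i x := if (x < m)%N then nth 0 s x else (nth 0 s m.-1 + x)%N.
have ssl x y : (x < y)%N -> (y < m)%N -> (nth 0 s x < nth 0 s y)%N.
  move=> xy ym; apply: (sorted_ltn_nth ltn_trans 0 ss) => //; rewrite inE sm //.
  exact: ltn_trans ym.
rewrite (_ : block (fs s) = block (f \o i)); last first.
  by apply: functional_extensionality_dep => -[x y]; rewrite /block /fs /i /= ltn_ord.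
apply: Wf => x y xy; rewrite /i; case: (ltnP y m) => ym.
  by rewrite (ltn_trans xy ym); exact: ssl.
case: (ltnP x m) => xm; last by rewrite ltn_add2l.
have xm1 : (x <= m.-1)%N by rewrite -ltnS prednK // (leq_ltn_trans _ xm).
apply: (@leq_ltn_trans (nth 0 s m.-1)).
  move: xm1; rewrite leq_eqVlt => /orP[/eqP -> //|xm1].
  by apply/ltnW/ssl => //; rewrite prednK // (leq_ltn_trans _ xm).
by rewrite -[X in (X < _)%N]addn0 ltn_add2l (leq_ltn_trans _ xy).
Qed.

End IteratedLimits.

(** * Definability in M^eq *)

Lemma qclass_eq T (E : T -> T -> Prop) (a b : T) :
  Equivalence E -> qclass E a = qclass E b <-> E a b.
Proof.
move=> [Er Es Et]; split=> [[]/(congr1 (@^~ b))/= ->|Eab]; first exact: Er.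
apply: eq_exist; apply/seteqP; split=> c /= Ec; last exact: Et Ec.
exact: Et (Es _ _ Eab) Ec.
Qed.

Lemma qclass_surj T (E : T -> T -> Prop) (X : quot E) : exists a, qclass E a = X.
Proof. by case: X => X [a Xa]; exists a; apply: eq_exist. Qed.

Section MeqDefinable.
Context {L : language} (M : structure L).
Implicit Types G H : ctx (lsort L).

Lemma tmf_meq G s (F : env M G -> M s) :
  tmf F -> @tmf _ (Meq M) (cmap (@home _ M) G) (home M s) F.
Proof.
move=> [t tP]; suff : @tmf _ (Meq M) (cmap (@home _ M) G) (home M s)
    (fun e : env M G => eval e t).
  by move=> [r rP]; exists r => e; rewrite tP rP.
elim: t {tP F} => [i|f ts IH] /=.
  exact: (@tmf_var _ (Meq M) (cmap (@home _ M) G) i).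
exact: (@tmf_app _ (Meq M) _ (efunc M f)).
Qed.

Lemma dfn_meq G (X : set (env M G)) :
  dfn X -> @dfn _ (Meq M) (cmap (@home _ M) G) X.
Proof.
move=> [phi phiP].
apply: (@dfn_iff _ (Meq M) (cmap (@home _ M) G) [set e : env M G | sat phi (fun i => e i)] X) => //.
apply: (@interpretation _ _ M (Meq M) (fun (H : ctx (lsort (eq_language M))) s F =>
    @tmf _ (Meq M) H (home M s) F)
  _ _ _ _ _ phi (cmap (@home _ M) G) (fun i e => e i)).
- by move=> H f F; exact: (@tmf_app _ (Meq M) H (efunc M f)).
- by move=> H s F K; exact: dfn_eq.
- by move=> H r F; exact: (@dfn_rel _ (Meq M) H r).
- move=> H s; exists (cconst 1 (home M s)), (fun e => e ord0); split.
  + by move=> x; exists (fun _ => x).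
  + exact: (@tmf_var _ (Meq M) (csum H (cconst 1 (home M s))) (inr ord0)).
  + by move=> s' F; exact: tmf_inl.
- by move=> i; exact: (@tmf_var _ (Meq M) (cmap (@home _ M) G) i).
Qed.

(** M^eq induces no new structure on the home sorts. A function into an imaginary sort is admissible
    when it is the class of a tuple of terms, and equality of two classes is the definable relation
    of that sort. *)
Lemma dfn_home G (X : set (env M G)) :
  @dfn _ (Meq M) (cmap (@home _ M) G) X -> dfn X.
Proof.
move=> [phi phiP].
pose itm H (s : eq_sort M) : (env M H -> Meq M s) -> Prop :=
  match s return (env M H -> Meq M s) -> Prop with
  | home s => fun F => @tmf _ M H s F
  | imag E => fun F => exists R : forall j : eq_ctx E, env M H -> M (srt j),
      (forall j, tmf (R j)) /\
      forall h, F h = qclass (@eq_rel _ _ E) (fun j => R j h)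
  end.
apply: (@dfn_iff _ M G [set e : env M G | sat (M := Meq M) phi (fun i => e i)] X) => //.
apply: (@interpretation _ _ (Meq M) M itm _ _ _ _ _ phi G (fun i e => e i)).
- move=> H [f|E] F HF /=; first exact: (@tmf_app _ M H f).
  by exists F.
- move=> H [s|E] F K /=; first exact: dfn_eq.
  move=> [R [dR RE]] [S [dS SE]].
  have [rel relP] := eq_definable E.
  have dE : dfn [set e : env M (csum (eq_ctx E) (eq_ctx E)) | sat rel e] by exists rel.
  pose RS (x : csum (eq_ctx E) (eq_ctx E)) : env M H -> M (srt x) :=
    match x return env M H -> M (srt (c := csum (eq_ctx E) (eq_ctx E)) x) with
    | inl i => R i | inr j => S j end.
  have dRS x : tmf (RS x) by case: x => [i|j]; [exact: dR|exact: dS].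
  have := dfn_subst dE dRS; apply: dfn_iff => h /=.
  rewrite RE SE (qclass_eq _ _ (eq_equivalence E)) relP /=.
  rewrite (_ : (fun i => _) = env_cat (fun j => R j h) (fun j => S j h)) //.
  by apply: functional_extensionality_dep => -[].
- by move=> H r F; exact: (@dfn_rel _ M H r).
- move=> H [s|E].
    exists (cconst 1 s), (fun e => e ord0); split.
    + by move=> x; exists (fun _ => x).
    + exact: (@tmf_var _ M (csum H (cconst 1 s)) (inr ord0)).
    + move=> [s'|E] F /=; first exact: tmf_inl.
      move=> [R [dR RE]]; exists (fun j e => R j (fun i => e (inl i))).
      by split=> // j; exact: tmf_inl.
  exists (eq_ctx E), (fun e => qclass (@eq_rel _ _ E) e); split.
  + exact: qclass_surj.
  + exists (fun j e => e (inr j)); split=> // j.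
    exact: (@tmf_var _ M (csum H (eq_ctx E)) (inr j)).
  + move=> [s'|E'] F /=; first exact: tmf_inl.
    move=> [R [dR RE]]; exists (fun j e => R j (fun i => e (inl i))).
    by split=> // j; exact: tmf_inl.
- by move=> i; exact: tmf_var.
Qed.

End MeqDefinable.

(** * Abelian structures and pure sequences *)

Lemma hom_eval L (M N : structure L) (h : forall s, M s -> N s) :
  homomorphism h -> forall (G : ctx (lsort L)) s (t : term G s) (e : env M G),
  h _ (eval e t) = eval (fun i => h _ (e i)) t.
Proof.
move=> [hf _] G s t e; elim: t => [//|f ts IH] /=; rewrite hf; congr fint.
by apply: functional_extensionality_dep => i; exact: IH.
Qed.

Definition tzero L (G : ctx (lsort (glanguage L))) (s : lsort L) : term G s :=
  @tapp (glanguage L) G (@gzero L s)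
    (fun i : 'I_0 => False_rect _ (notF (ltn_ord i))).

Section GroupStructure.
Context {L : language} (A : group_structure L) (HA : abelian A).
Implicit Type G : ctx (lsort (glanguage L)).

Lemma eval_add G s (t : term G s) (a b : env A G) :
  eval (env_add a b) t = (eval a t + eval b t :> gcarrier A s)%R.
Proof. by have [+ _] := HA; apply. Qed.

Lemma env_subK G (a b : env A G) : env_add (env_sub a b) b = a.
Proof.
by apply: functional_extensionality_dep => i; rewrite /env_add /env_sub subrK.
Qed.

Lemma env_subr0 G (a : env A G) : env_sub a (@env_zero _ A G) = a.
Proof.
by apply: functional_extensionality_dep => i; rewrite /env_zero /env_sub subr0.
Qed.

Lemma env_subrr G (a : env A G) : env_sub a a = @env_zero _ A G.
Proof.
by apply: functional_extensionality_dep => i; rewrite /env_zero /env_sub subrr.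
Qed.

Lemma env_sub_sub G (a b c : env A G) :
  env_sub (env_sub a b) (env_sub c b) = env_sub a c.
Proof.
apply: functional_extensionality_dep => i; rewrite /env_sub.
by rewrite opprB addrA subrK.
Qed.

Lemma eval_sub G s (t : term G s) (a b : env A G) :
  eval (env_sub a b) t = (eval a t - eval b t :> gcarrier A s)%R.
Proof. by rewrite -{2}(env_subK a b) eval_add addrK. Qed.

Lemma eval_zero G s (t : term G s) :
  eval (@env_zero _ A G) t = (0 :> gcarrier A s)%R.
Proof. by rewrite -(env_subrr (@env_zero _ A G)) eval_sub subrr. Qed.

Section Positive.
Context G (phi : formula G) (pphi : is_pp phi).

Lemma pp_zero : sat phi (@env_zero _ A G).
Proof. by have [_ /(_ _ _ pphi)[]] := HA. Qed.

Lemma pp_sub (a b : env A G) : sat phi a -> sat phi b -> sat phi (env_sub a b).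
Proof. by have [_ /(_ _ _ pphi)[_]] := HA; apply. Qed.

Lemma pp_subC (a b : env A G) : sat phi (env_sub a b) -> sat phi (env_sub b a).
Proof.
move=> Hab; have := pp_sub pp_zero Hab; congr sat.
by apply: functional_extensionality_dep => i;
  rewrite /env_sub /env_zero sub0r opprB.
Qed.

Lemma pp_sub_trans (b a c : env A G) :
  sat phi (env_sub a b) -> sat phi (env_sub b c) -> sat phi (env_sub a c).
Proof. by move=> Hab /pp_subC Hcb; rewrite -(env_sub_sub a b c); exact: pp_sub. Qed.

Lemma pp_addE (a b : env A G) : sat phi (env_sub a b) -> sat phi a <-> sat phi b.
Proof.
move=> Hab; split=> [Ha|Hb].
  have := pp_sub_trans (pp_subC Hab) (_ : sat phi (env_sub a (@env_zero _ A G))).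
  by rewrite !env_subr0; apply.
have := pp_sub_trans Hab (_ : sat phi (env_sub b (@env_zero _ A G))).
by rewrite !env_subr0; apply.
Qed.

End Positive.

Lemma same_coset_equivalence (Phi : pp_family L) (phi : Phi) :
  Equivalence (@same_coset L A Phi phi).
Proof.
have P := pp_formP phi; split.
- by move=> a; rewrite /same_coset env_subrr; exact: pp_zero.
- by move=> a b; exact: pp_subC.
- by move=> a b c ab bc; exact: (pp_sub_trans P bc ab).
Qed.

Lemma eval_tuple_sub (Phi : pp_family L) (phi : Phi) G (t : term_tuple phi G)
    (a b : env A G) :
  eval_tuple t (env_sub a b) = env_sub (eval_tuple t a) (eval_tuple t b).
Proof. by apply: functional_extensionality_dep => i; exact: eval_sub. Qed.

End GroupStructure.

Section GroupHom.
Context {L : language} (A B : group_structure L) (h : forall s, A s -> B s).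
Hypothesis (Hh : homomorphism h).

Lemma hom_sub s (x y : gcarrier A s) : h (x - y)%R = (h x - h y :> gcarrier B s)%R.
Proof.
have [hf _] := Hh.
have hD (a b : gcarrier A s) : h (a + b)%R = (h a + h b :> gcarrier B s)%R.
  exact: (hf (gadd s) (fun i : 'I_2 => if i == ord0 then a else b)).
have hN (a : gcarrier A s) : h (- a)%R = (- h a :> gcarrier B s)%R.
  exact: (hf (gopp s) (fun i : 'I_1 => a)).
by rewrite hD hN.
Qed.

Lemma hom_env_sub (G : ctx (lsort (glanguage L))) (a b : env A G) :
  (fun i => h (env_sub a b i)) = env_sub (fun i => h (a i)) (fun i => h (b i)).
Proof. by apply: functional_extensionality_dep => i; exact: hom_sub. Qed.

Lemma hom_eval_tuple (Phi : pp_family L) (phi : Phi)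
    (G : ctx (lsort (glanguage L))) (t : term_tuple phi G) (a : env A G) :
  (fun i => h (eval_tuple t a i)) = eval_tuple t (fun i => h (a i)).
Proof.
by apply: functional_extensionality_dep => i; exact: (hom_eval Hh).
Qed.

End GroupHom.

Section SequenceAlgebra.
Context {L : language} {Phi : pp_family L} (S : pure_sequence Phi).
Implicit Type G : ctx (lsort (glanguage L)).

Definition iota_env G (a : env (grA S) G) : env (grB S) G := fun i => iota (a i).

Lemma iota_env_sub G (a b : env (grA S) G) :
  iota_env (env_sub a b) = env_sub (iota_env a) (iota_env b).
Proof. by have [H _] := iota_embedding S; exact: hom_env_sub. Qed.

Lemma iota_eval_tuple (phi : Phi) G (t : term_tuple phi G) (a : env (grA S) G) :
  iota_env (eval_tuple t a) = eval_tuple t (iota_env a).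
Proof. by have [H _] := iota_embedding S; exact: hom_eval_tuple. Qed.

Lemma nu_env_sub G (a b : env (grB S) G) :
  nu_env (env_sub a b) = env_sub (nu_env a) (nu_env b).
Proof. exact: (hom_env_sub (nu_homomorphism S)). Qed.

Lemma nu_eval_tuple (phi : Phi) G (t : term_tuple phi G) (b : env (grB S) G) :
  nu_env (eval_tuple t b) = eval_tuple t (nu_env b).
Proof. exact: (hom_eval_tuple (nu_homomorphism S)). Qed.

Lemma nu_env_iota G (b : env (grB S) G) (a : env (grA S) G) :
  nu_env (env_sub b (iota_env a)) = nu_env b.
Proof.
rewrite nu_env_sub; apply: functional_extensionality_dep => i.
rewrite /env_sub /nu_env /iota_env.
have /exactB -> : exists a', iota (a i) = iota a' by exists (a i).
exact: subr0.
Qed.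

Lemma nu_env_surj G (c : env (grC S) G) : exists b, nu_env b = c.
Proof.
have /depfun_choice[b bP] i : exists b, nu b = c i := nu_surjective (c i).
by exists b; apply: functional_extensionality_dep => i; exact: bP.
Qed.

Lemma iota_pp G (phi : formula G) (a : env (grA S) G) :
  is_pp phi -> sat phi (iota_env a) <-> sat phi a.
Proof. by move=> pphi; exact: iota_pure. Qed.

Lemma nu_pp G (phi : formula G) (b : env (grB S) G) : is_pp phi ->
  sat phi (nu_env b) <-> exists a, sat phi (env_sub b (iota_env a)).
Proof.
move=> pphi; rewrite (nu_pure (p := S) pphi b).
split=> [[b' [a [Hb' ->]]]|[a Ha]].
  exists a; move: Hb'; congr sat; apply: functional_extensionality_dep => i.
  by rewrite /env_sub /env_add addrK.
by exists (env_sub b (iota_env a)), a; split=> //; rewrite env_subK.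
Qed.

Lemma nu_pp_imp G (phi : formula G) (b : env (grB S) G) : is_pp phi ->
  sat phi b -> sat phi (nu_env b).
Proof.
move=> pphi Hb; apply/(nu_pp _ pphi); exists (@env_zero _ (grA S) G).
rewrite (_ : iota_env _ = @env_zero _ (grB S) G) ?env_subr0 //.
rewrite -(env_subrr (@env_zero _ (grA S) G)) iota_env_sub.
exact: env_subrr.
Qed.

(** Purity of iota: the a with b - iota(a) in phi(B) form one coset of phi(A). This is why [rho]
    does not depend on the choice made in its definition. *)
Lemma pp_iota_sub G (phi : formula G) (b : env (grB S) G) a a' : is_pp phi ->
  sat phi (env_sub b (iota_env a)) ->
  sat phi (env_sub b (iota_env a')) <-> sat phi (env_sub a' a).
Proof.
move=> pphi Ha; have HB := abelianB S.
rewrite -(iota_pp _ pphi) iota_env_sub; split=> H.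
  exact: (pp_sub_trans HB pphi (pp_subC HB pphi H)).
exact: (pp_sub_trans HB pphi Ha (pp_subC HB pphi H)).
Qed.

Lemma rho_class (phi : Phi) (b : env (Bstr S) (pp_ctx phi))
    (a : env (grA S) (pp_ctx phi)) :
  sat (M := grC S) (pp_form phi) (nu_env b) ->
  rho b = qclass (@same_coset L (grA S) Phi phi) a <->
  sat (pp_form phi) (env_sub b (iota_env a)).
Proof.
have P := pp_formP phi => /(nu_pp _ P) Hex; rewrite /rho.
rewrite (qclass_eq _ _ (same_coset_equivalence (abelianA S) phi)) /same_coset.
case: pselect => // h; case: cid => a' Ha' /=.
by rewrite (pp_iota_sub a P Ha').
Qed.

Lemma rho_out (phi : Phi) (b : env (Bstr S) (pp_ctx phi)) :
  ~ sat (M := grC S) (pp_form phi) (nu_env b) ->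
  rho b = qclass (@same_coset L (grA S) Phi phi) (@env_zero L (grA S) (pp_ctx phi)).
Proof.
have P := pp_formP phi => Hn; rewrite /rho; case: pselect => // h.
by case: Hn; apply/(nu_pp _ P).
Qed.

Lemma rho_congr (phi : Phi) (b b' : env (Bstr S) (pp_ctx phi)) :
  sat (M := grB S) (pp_form phi) (env_sub b b') -> rho b = rho b'.
Proof.
have P := pp_formP phi => Hbb'.
have := nu_pp_imp P Hbb'; rewrite nu_env_sub => HC.
have E := pp_addE (abelianC S) P HC.
have [Hb'|Hb'] := pselect (sat (M := grC S) (pp_form phi) (nu_env b')); last first.
  by rewrite !rho_out // E.
have [a Ha] := (nu_pp b' P).1 Hb'; have Hb := E.2 Hb'.
have -> : rho b' = qclass (@same_coset L (grA S) Phi phi) a by apply/rho_class.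
by apply/rho_class => //; exact: (pp_sub_trans (abelianB S) P Hbb' Ha).
Qed.

End SequenceAlgebra.

(** * Splitting definable sets of M into A-sets and C-sets *)

Section Splitting.
Context {L : language} {Phi : pp_family L} (S : pure_sequence Phi).

Notation GL := (glanguage L).
Notation piA phi := (qclass (@same_coset L (grA S) Phi phi)).

Definition qctx (I : shape) (phi : I -> Phi) : ctx (lsort (langA S)) :=
  @Ctx _ I (fun i => sortQ S (phi i)).

Definition rhos (I : shape) (phi : I -> Phi) (GB : ctx (lsort (@langB L)))
    (t : forall i, term_tuple (phi i) GB) (b : env (Bstr S) GB) :
    env (Astar S) (qctx phi) := fun i => rho (eval_tuple (t i) b).

(** Parameter-free counterpart of [A_formula]. Parameters will enter as further variables y, and the
    differences t(x) - beta of an A-formula arise from t(x, y) by additivity. *)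
Definition Aset GA GB (X : env (Astar S) GA -> env (Bstr S) GB -> Prop) : Prop :=
  exists (I : shape) (phi : I -> Phi) (t : forall i, term_tuple (phi i) GB)
    (Y : set (env (Astar S) (csum GA (qctx phi)))),
    dfn Y /\ forall a b, X a b <-> Y (env_cat a (rhos t b)).

Definition Cset (GB : ctx (lsort (@langB L))) GC
    (X : env (Cstar S) (cmap (sortC S) GB) -> env (Cstar S) GC -> Prop) : Prop :=
  dfn (fun e : env (Cstar S) (csum (cmap (sortC S) GB) GC) =>
         X (fun i => e (inl i)) (fun j => e (inr j))).

Lemma tmf_A (G : ctx (lsort GL)) s (t : term G s) :
  @tmf _ (Astar S) (cmap (sortA S) G) (sortA S s)
    (fun e => eval (M := grA S) e t).
Proof.
elim: t => [i|f ts IH] /=.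
  exact: (@tmf_var _ (Astar S) (cmap (sortA S) G) i).
exact: (@tmf_app _ (Astar S) (cmap (sortA S) G) (inl (inl f))).
Qed.

Lemma tmf_C (G : ctx (lsort GL)) s (t : term G s) :
  @tmf _ (Cstar S) (cmap (sortC S) G) (sortC S s)
    (fun e => eval (M := grC S) e t).
Proof.
elim: t => [i|f ts IH] /=.
  exact: (@tmf_var _ (Cstar S) (cmap (sortC S) G) i).
exact: (@tmf_app _ (Cstar S) (cmap (sortC S) G) (inl f)).
Qed.

Lemma dfn_C (G : ctx (lsort GL)) (phi : formula G) :
  @dfn _ (Cstar S) (cmap (sortC S) G) (fun e => sat (M := grC S) phi e).
Proof.
apply: (@interpretation _ _ (grC S) (Cstar S) (fun H s F =>
  @tmf _ (Cstar S) H (sortC S s) F) _ _ _ _ _ phi (cmap (sortC S) G)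
  (fun i e => e i)).
- by move=> H f F; exact: (@tmf_app _ (Cstar S) H (inl f)).
- by move=> H s F K; exact: dfn_eq.
- by move=> H r F; exact: (@dfn_rel _ (Cstar S) H (inl r)).
- move=> H s; exists (cconst 1 (sortC S s)), (fun e => e ord0); split.
  + by move=> x; exists (fun _ => x).
  + exact: (@tmf_var _ (Cstar S) (csum H (cconst 1 (sortC S s))) (inr ord0)).
  + by move=> s' F; exact: tmf_inl.
- by move=> i; exact: (@tmf_var _ (Cstar S) (cmap (sortC S) G) i).
Qed.

Lemma tmf_pi (phi : Phi) :
  @tmf _ (Astar S) (cmap (sortA S) (pp_ctx phi)) (sortQ S phi) (fun e => piA phi e).
Proof.
apply: (@tmf_app _ (Astar S) (cmap (sortA S) (pp_ctx phi)) (inl (inr phi))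
  (fun i e => e i)) => i.
exact: (@tmf_var _ (Astar S) (cmap (sortA S) (pp_ctx phi)) i).
Qed.

Lemma tmf_pi_subst (G : ctx (lsort (langA S))) (phi : Phi)
    (K : forall j : pp_ctx phi, env (Astar S) G -> Astar S (sortA S (srt j))) :
  (forall j, tmf (K j)) ->
  @tmf _ (Astar S) G (sortQ S phi) (fun e => piA phi (fun j => K j e)).
Proof. exact: (tmf_subst (tmf_pi phi)). Qed.

Lemma tmf_zeroA (G : ctx (lsort (langA S))) (s : lsort L) :
  @tmf _ (Astar S) G (sortA S s) (fun _ => 0%R : gcarrier (grA S) s).
Proof.
exact: (@tmf_app _ (Astar S) G (inl (inl (@gzero L s)))
  (fun (k : 'I_0) _ => False_rect _ (notF (ltn_ord k)))
  (fun k => False_rect _ (notF (ltn_ord k)))).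
Qed.

Section Asets.
Variables (GA : ctx (lsort (langA S))) (GB : ctx (lsort (@langB L))).
Implicit Types X Z : env (Astar S) GA -> env (Bstr S) GB -> Prop.

Lemma Aset_iff X Z : (forall a b, X a b <-> Z a b) -> Aset X -> Aset Z.
Proof.
move=> XZ [I [phi [t [Y [dY XY]]]]]; exists I, phi, t, Y; split=> // a b.
by rewrite -XZ.
Qed.

Lemma Aset_dfn (Y : set (env (Astar S) GA)) : dfn Y -> Aset (fun a (_ : env _ GB) => Y a).
Proof.
move=> dY; exists (sh_ord 0), (fun i : 'I_0 => False_rect _ (notF (ltn_ord i))).
exists (fun i : 'I_0 => False_rect _ (notF (ltn_ord i))).
by eexists; split; [exact: dfn_inl dY|].
Qed.

Lemma Aset_not X : Aset X -> Aset (fun a b => ~ X a b).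
Proof.
move=> [I [phi [t [Y [dY XY]]]]]; exists I, phi, t, (~` Y); split=> [|a b].
  exact: dfnC.
by rewrite XY.
Qed.

Lemma Aset_and X Z : Aset X -> Aset Z -> Aset (fun a b => X a b /\ Z a b).
Proof.
move=> [I [phi [t [Y [dY XY]]]]] [J [psi [r [W [dW ZW]]]]].
pose chi (x : sh_sum I J) := match x with inl i => phi i | inr j => psi j end.
pose q (x : sh_sum I J) : term_tuple (chi x) GB :=
  match x return term_tuple (chi x) GB with inl i => t i | inr j => r j end.
pose T := csum GA (@qctx (sh_sum I J) chi).
pose K1 (x : csum GA (qctx phi)) : env (Astar S) T -> Astar S (srt x) :=
  match x return env (Astar S) T -> Astar S (srt (c := csum GA (qctx phi)) x) with
  | inl i => fun e => e (inl i) | inr j => fun e => e (inr (inl j)) end.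
pose K2 (x : csum GA (qctx psi)) : env (Astar S) T -> Astar S (srt x) :=
  match x return env (Astar S) T -> Astar S (srt (c := csum GA (qctx psi)) x) with
  | inl i => fun e => e (inl i) | inr j => fun e => e (inr (inr j)) end.
have dK1 x : tmf (K1 x).
  case: x => [i|j]; first exact: (@tmf_var _ _ T (inl i)).
  exact: (@tmf_var _ _ T (inr (inl j))).
have dK2 x : tmf (K2 x).
  case: x => [i|j]; first exact: (@tmf_var _ _ T (inl i)).
  exact: (@tmf_var _ _ T (inr (inr j))).
exists (sh_sum I J), chi, q; eexists; split.
  exact: (dfnI (dfn_subst dY dK1) (dfn_subst dW dK2)).
move=> a b; rewrite /setI /= XY ZW.
rewrite (_ : env_cat a (rhos t b) = fun x => K1 x (env_cat a (rhos q b))); last first.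
  by apply: functional_extensionality_dep => -[].
rewrite (_ : env_cat a (rhos r b) = fun x => K2 x (env_cat a (rhos q b))) //.
by apply: functional_extensionality_dep => -[].
Qed.

Lemma Aset_forall (I : Type) (X : I -> env (Astar S) GA -> env (Bstr S) GB -> Prop) :
  listable I -> (forall i, Aset (X i)) -> Aset (fun a b => forall i, X i a b).
Proof.
move=> lI AX.
have := @closed_forall (env (Astar S) GA * env (Bstr S) GB) I
  [set Z | Aset (fun a b => Z (a, b))] _ _ lI (fun i => [set x | X i x.1 x.2]).
apply=> //=; first exact/Aset_dfn/dfnT.
by move=> Z W AZ AW; exact: Aset_and.
Qed.

Lemma Aset_rho (phi : Phi) (t : term_tuple phi GB)
    (F : env (Astar S) GA -> Astar S (sortQ S phi)) :
  tmf F -> Aset (fun a b => rho (eval_tuple t b) = F a).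
Proof.
move=> dF; exists (sh_ord 1), (fun _ => phi), (fun _ => t).
pose T := csum GA (@qctx (sh_ord 1) (fun _ => phi)).
exists [set e : env (Astar S) T | e (inr ord0) = F (fun i => e (inl i))]; split=> //.
apply: (@dfn_eq _ _ T (sortQ S phi)); last exact: tmf_inl.
exact: (@tmf_var _ _ T (inr ord0)).
Qed.

Lemma Aset_exA (H : ctx (lsort (langA S)))
    (X : env (Astar S) (csum GA H) -> env (Bstr S) GB -> Prop) :
  Aset X -> Aset (fun a b => exists z : env (Astar S) H, X (env_cat a z) b).
Proof.
move=> [I [phi [t [Y [dY XY]]]]].
pose T := csum (csum GA (qctx phi)) H.
pose K (x : csum (csum GA H) (qctx phi)) : env (Astar S) T -> Astar S (srt x) :=
  match x return env (Astar S) T ->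
                 Astar S (srt (c := csum (csum GA H) (qctx phi)) x) with
  | inl (inl i) => fun e => e (inl (inl i))
  | inl (inr j) => fun e => e (inr j)
  | inr k => fun e => e (inl (inr k)) end.
have dK x : tmf (K x).
  case: x => [[i|i]|i].
  - exact: (@tmf_var _ _ T (inl (inl i))).
  - exact: (@tmf_var _ _ T (inr i)).
  - exact: (@tmf_var _ _ T (inl (inr i))).
have eqK g q h :
    (fun x => K x (env_cat (env_cat g q) h)) = env_cat (env_cat g h) q.
  by apply: functional_extensionality_dep => -[[]|].
exists I, phi, t; eexists; split; first exact: (dfn_ex (dfn_subst dY dK)).
move=> a b; split=> -[h Xh]; exists h; move: Xh; rewrite XY /= eqK //.
Qed.

Lemma Aset_subst (GA' : ctx (lsort (langA S))) (GB' : ctx (lsort (@langB L)))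
    (X : env (Astar S) GA' -> env (Bstr S) GB' -> Prop)
    (F : forall i : GA', env (Astar S) GA -> Astar S (srt i))
    (sg : forall i : GB', term GB (srt i)) :
  Aset X -> (forall i, tmf (F i)) ->
  Aset (fun a b => X (fun i => F i a) (fun i => eval b (sg i))).
Proof.
move=> [I [phi [t [Y [dY XY]]]]] dF.
pose T := csum GA (qctx phi).
pose K (x : csum GA' (qctx phi)) : env (Astar S) T -> Astar S (srt x) :=
  match x return env (Astar S) T -> Astar S (srt (c := csum GA' (qctx phi)) x) with
  | inl i => fun e => F i (fun j => e (inl j)) | inr k => fun e => e (inr k) end.
have dK x : tmf (K x).
  case: x => i; first exact: (tmf_inl (qctx phi) (dF i)).
  exact: (@tmf_var _ _ T (inr i)).
exists I, phi, (fun i j => tsubst sg (t i j)); eexists; split.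
  exact: (dfn_subst dY dK).
move=> a b /=; rewrite XY (_ : env_cat _ _ = fun x => K x (env_cat a
  (rhos (fun i j => tsubst sg (t i j)) b))) //.
apply: functional_extensionality_dep => -[i|i] //=.
rewrite /rhos; congr rho; apply: functional_extensionality_dep => j.
by rewrite /eval_tuple eval_tsubst.
Qed.

End Asets.

(** The candidates for all definable sets of M. A union is built in because eliminating a quantifier
    over B produces one piece for every guess. *)
Definition Kset GA GB GC
    (X : set (env (Astar S) GA * env (Bstr S) GB * env (Cstar S) GC)) : Prop :=
  exists (I : Type) (A : I -> env (Astar S) GA -> env (Bstr S) GB -> Prop)
    (C : I -> env (Cstar S) (cmap (sortC S) GB) -> env (Cstar S) GC -> Prop),
    [/\ listable I, forall i, Aset (A i), forall i, Cset (C i)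
      & forall a b c, X (a, b, c) <-> exists i, A i a b /\ C i (nu_env b) c].

Section Ksets.
Variables (GA : ctx (lsort (langA S))) (GB : ctx (lsort (@langB L))).
Variable (GC : ctx (lsort (langC S))).
Implicit Types X Z : set (env (Astar S) GA * env (Bstr S) GB * env (Cstar S) GC).

Lemma Kset_iff X Z : (forall a b c, X (a, b, c) <-> Z (a, b, c)) -> Kset X -> Kset Z.
Proof.
move=> XZ [I [A [C [lI AA CC XE]]]]; exists I, A, C; split=> // a b c.
by rewrite -XZ.
Qed.

Lemma Kset_AC A C : Aset A -> Cset C ->
  Kset [set x : env (Astar S) GA * env (Bstr S) GB * env (Cstar S) GC
       | A x.1.1 x.1.2 /\ C (nu_env x.1.2) x.2].
Proof.
move=> AA CC; exists unit, (fun _ => A), (fun _ => C); split=> //.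
  by exists [:: tt] => -[]; left.
by move=> a b c; split=> [|[]//]; exists tt.
Qed.

Lemma Kset_A A : Aset A ->
  Kset [set x : env (Astar S) GA * env (Bstr S) GB * env (Cstar S) GC
       | A x.1.1 x.1.2].
Proof.
move=> AA; have := Kset_AC AA
  (dfnT (Cstar S) (csum (cmap (sortC S) GB) GC) : Cset (fun _ _ => True)).
by apply: Kset_iff => a b c; split=> [[]|].
Qed.

Lemma Kset_C C : Cset C ->
  Kset [set x : env (Astar S) GA * env (Bstr S) GB * env (Cstar S) GC
       | C (nu_env x.1.2) x.2].
Proof.
move=> CC; have := Kset_AC (@Aset_dfn GA GB _ (dfnT _ _)) CC.
by apply: Kset_iff => a b c; split=> [[]|].
Qed.

Lemma Kset_T : Kset (@setT (env (Astar S) GA * env (Bstr S) GB * env (Cstar S) GC)).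
Proof. exact: (Kset_A (@Aset_dfn GA GB _ (dfnT _ _))). Qed.

Lemma Kset_and X Z : Kset X -> Kset Z -> Kset (X `&` Z).
Proof.
move=> [I [A [C [lI AA CC XE]]]] [J [A' [C' [lJ AA' CC' ZE]]]].
exists {_ : I & J}, (fun x a b => A (projT1 x) a b /\ A' (projT2 x) a b).
exists (fun x a b => C (projT1 x) a b /\ C' (projT2 x) a b); split.
- exact: listable_sigma.
- by move=> i; exact: Aset_and.
- by move=> i; exact: (dfnI (CC _) (CC' _)).
move=> a b c; rewrite /setI /= XE ZE; split.
  by move=> [[i [Ai Ci]] [j [Aj Cj]]]; exists (existT _ i j).
by move=> [[i j] /= [[Ai Aj] [Ci Cj]]]; split; [exists i|exists j].
Qed.

Lemma Kset_exists (J : Type)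
    (X : J -> set (env (Astar S) GA * env (Bstr S) GB * env (Cstar S) GC)) :
  listable J -> (forall j, Kset (X j)) -> Kset [set x | exists j, X j x].
Proof.
move=> lJ /depfun_choice[I] /depfun_choice[A] /depfun_choice[C] KX.
exists {j : J & I j}, (fun x => A (projT1 x) (projT2 x)).
exists (fun x => C (projT1 x) (projT2 x)); split.
- by apply: listable_sigma => // j; have [] := KX j.
- by move=> -[j i]; have [] := KX j.
- by move=> -[j i]; have [] := KX j.
move=> a b c; split=> [[j]|[[j i] ACi]].
  by have [_ _ _ ->] := KX j; move=> [i ACi]; exists (existT _ j i).
by exists j; have [_ _ _ ->] := KX j; exists i.
Qed.

Lemma Kset_forall (J : Type)
    (X : J -> set (env (Astar S) GA * env (Bstr S) GB * env (Cstar S) GC)) :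
  listable J -> (forall j, Kset (X j)) -> Kset [set x | forall j, X j x].
Proof. by move=> lJ; apply: closed_forall => //; [exact: Kset_T|exact: Kset_and]. Qed.

Lemma Kset_or X Z : Kset X -> Kset Z -> Kset (X `|` Z).
Proof.
move=> KX KZ; have := @Kset_exists bool (fun b => if b then X else Z) _ _.
move=> H; apply: Kset_iff (H (listable_finite _) _) => [a b c|[]//].
split=> [[[] ?]|[?|?]]; [by left|by right|by exists true|by exists false].
Qed.

Lemma Kset_not X : Kset X -> Kset (~` X).
Proof.
move=> [I [A [C [lI AA CC XE]]]].
have KAC i := Kset_or (@Kset_A _ (Aset_not (AA i)))
  (@Kset_C (fun b c => ~ C i b c) (dfnC (CC i))).
apply: Kset_iff (Kset_forall lI KAC) => a b c.
rewrite /setC /= XE; split=> [H' [i [Ai Ci]]|H' i]; first by case: (H' i).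
by apply/not_andP => -[Ai Ci]; apply: H'; exists i.
Qed.

(** A variable of an A-sort occurs in the A-factor only, so the quantifier stays inside it; dually
    for C. Only variables of B link the two factors. *)
Lemma Kset_exA (H : ctx (lsort (langA S)))
    (X : set (env (Astar S) (csum GA H) * env (Bstr S) GB * env (Cstar S) GC)) :
  Kset X -> Kset [set x | exists z : env (Astar S) H, X (env_cat x.1.1 z, x.1.2, x.2)].
Proof.
move=> [I [A [C [lI AA CC XE]]]].
exists I, (fun i a b => exists z : env (Astar S) H, A i (env_cat a z) b), C.
split=> // [i|a b c /=]; first exact: Aset_exA.
split=> [[z /XE[i [Ai Ci]]]|[i [[z Ai] Ci]]]; first by exists i; split=> //; exists z.
by exists z; apply/XE; exists i.
Qed.

Lemma Kset_exC (H : ctx (lsort (langC S)))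
    (X : set (env (Astar S) GA * env (Bstr S) GB * env (Cstar S) (csum GC H))) :
  Kset X -> Kset [set x | exists z : env (Cstar S) H, X (x.1.1, x.1.2, env_cat x.2 z)].
Proof.
move=> [I [A [C [lI AA CC XE]]]].
exists I, A, (fun i b c => exists z : env (Cstar S) H, C i b (env_cat c z)).
split=> // [i|a b c /=]; last first.
  split=> [[z /XE[i [Ai Ci]]]|[i [Ai [z Ci]]]]; first by exists i; split=> //; exists z.
  by exists z; apply/XE; exists i.
pose GN := cmap (sortC S) GB; pose T := csum (csum GN GC) H.
pose K (x : csum GN (csum GC H)) : env (Cstar S) T -> Cstar S (srt x) :=
  match x return env (Cstar S) T -> Cstar S (srt (c := csum GN (csum GC H)) x) with
  | inl i => fun e => e (inl (inl i))
  | inr (inl j) => fun e => e (inl (inr j))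
  | inr (inr k) => fun e => e (inr k) end.
have dK x : tmf (K x).
  case: x => [j|[j|j]].
  - exact: (@tmf_var _ _ T (inl (inl j))).
  - exact: (@tmf_var _ _ T (inl (inr j))).
  - exact: (@tmf_var _ _ T (inr j)).
have := dfn_ex (dfn_subst (CC i) dK); apply: dfn_iff => e /=.
have eqK z : (fun j : csum GC H => K (inr j) (env_cat e z)) =
    env_cat (fun j => e (inr j)) z by apply: functional_extensionality_dep => -[].
by split=> -[z Cz]; exists z; move: Cz; rewrite eqK.
Qed.

End Ksets.
End Splitting.

(** * Eliminating a quantifier over B *)

Section Elimination.
Context {L : language} {Phi : pp_family L} (S : pure_sequence Phi).
Hypothesis (HPhi : fundamental_system Phi (grB S)).

Notation GL := (glanguage L).
Notation piA phi := (qclass (@same_coset L (grA S) Phi phi)).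
Notation langB := (@langB L).

Lemma nu_env_cat (G H : ctx (lsort GL)) (b : env (grB S) G) (y : env (grB S) H) :
  nu_env (env_cat b y) = env_cat (M := grC S) (nu_env b) (nu_env y).
Proof. by apply: functional_extensionality_dep => -[]. Qed.

Lemma env_sub_cat (A : group_structure L) (G H : ctx (lsort GL))
    (a a' : env A G) (b b' : env A H) :
  env_sub (env_cat a b) (env_cat a' b') = env_cat (env_sub a a') (env_sub b b').
Proof. by apply: functional_extensionality_dep => -[]. Qed.

Lemma iota_env_cat (G H : ctx (lsort GL)) (a : env (grA S) G) (a' : env (grA S) H) :
  iota_env (env_cat a a') = env_cat (M := grB S) (iota_env a) (iota_env a').
Proof. by apply: functional_extensionality_dep => -[]. Qed.

Lemma sat_fsubst_tuple (M : structure GL) (phi : Phi) (G : ctx (lsort GL))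
    (t : term_tuple phi G) (e : env M G) :
  sat (fsubst (pp_form phi) t) e <-> sat (pp_form phi) (eval_tuple t e).
Proof. by rewrite sat_fsubst. Qed.

(** Subtracting the image of the second hypothesis from the first puts (0, nu(y' - y0)) in psi(C).
    Purity corrects y' - y0 by some iota(a3) so that (0, y' - y0 - iota(a3)) lies in psi(B), and
    this element is added to (b - iota(a0), y0). Shifting y' only by elements of iota(A) keeps its
    image under nu. *)
Lemma pp_combination (G H : ctx (lsort GL)) (psi : formula (csum G H))
    (b : env (grB S) G) (y' y0 : env (grB S) H) (a0 : env (grA S) G)
    (a1 : env (grA S) H) : is_pp psi ->
  sat (M := grC S) psi (env_cat (nu_env b) (nu_env y')) ->
  sat psi (env_cat (env_sub b (iota_env a0)) y0) ->
  exists y, nu_env y = nu_env y' /\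
    sat psi (env_sub (env_cat b y) (iota_env (env_cat a0 a1))).
Proof.
move=> ppsi HC HB.
pose sg (x : csum G H) : term H (srt x) :=
  match x return term H (srt (c := csum G H) x) with
  | inl i => tzero H (srt i) | inr j => tvar j end.
pose chi := fsubst psi sg.
have pchi : is_pp chi by exact: fsubst_pp.
have chiE (M : group_structure L) (z : env M H) :
    sat chi z <-> sat psi (env_cat (@env_zero _ M G) z).
  rewrite sat_fsubst (_ : (fun i => _) = env_cat (@env_zero _ M G) z) //.
  by apply: functional_extensionality_dep => -[].
have HC0 := nu_pp_imp ppsi HB; rewrite nu_env_cat nu_env_iota in HC0.
have /(nu_pp _ pchi)[a3 Ha3] : sat (M := grC S) chi (nu_env (env_sub y' y0)).
  apply/chiE; have := pp_sub (abelianC S) ppsi HC HC0.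
  by rewrite env_sub_cat env_subrr nu_env_sub.
exists (env_sub y' (iota_env (env_sub a3 a1))); split; first exact: nu_env_iota.
apply: (pp_addE (abelianB S) ppsi _).2 HB.
move/chiE: Ha3; congr sat.
rewrite iota_env_cat !env_sub_cat env_subrr; congr env_cat.
apply: functional_extensionality_dep => i.
rewrite iota_env_sub /env_sub /iota_env.
have zmodE (V : zmodType) (p q r s : V) : (p - q - r = p - (r - s) - s - q)%R.
  by rewrite opprB addrA (addrAC (p + s)%R) addrK addrAC.
exact: zmodE.
Qed.

Section ExB.
Variables (GA : ctx (lsort (langA S))) (GB H : ctx (lsort langB)).
Variable (GC : ctx (lsort (langC S))).

Section Guess.
Variables (I : shape) (phi : I -> Phi).
Implicit Types (t : forall i, term_tuple (phi i) (csum GB H)) (J : I -> bool).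

Definition guessC t J (C : env (Cstar S) (cmap (sortC S) (csum GB H)) ->
    env (Cstar S) GC -> Prop) (d : env (grC S) GB) (c : env (Cstar S) GC) : Prop :=
  exists c' : env (grC S) H, C (env_cat (M := grC S) d c') c /\
    forall i : I, J i = true <->
      sat (pp_form (phi i)) (eval_tuple (t i) (env_cat (M := grC S) d c')).

(** The values that rho(t_i(b, y)) takes when (b, y) - iota(a0, a1) satisfies phi_i(t_i) for all
    guessed i; for the other i it is the default value 0 of [rho]. *)
Definition guess_value t J (a0 : env (grA S) GB) (a1 : env (grA S) H) :
    env (Astar S) (qctx S phi) :=
  fun i => piA (phi i) (if J i then eval_tuple (t i) (env_cat (M := grA S) a0 a1)
                        else @env_zero _ (grA S) (pp_ctx (phi i))).

Lemma Cset_guessC t J C : Cset C -> @Cset _ _ S GB GC (guessC t J C).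
Proof.
move=> dC.
pose GN := cmap (sortC S) GB; pose HN := cmap (sortC S) H.
pose T := csum (csum GN GC) HN.
pose K1 (x : csum (cmap (sortC S) (csum GB H)) GC) :
    env (Cstar S) T -> Cstar S (srt x) :=
  match x return env (Cstar S) T ->
      Cstar S (srt (c := csum (cmap (sortC S) (csum GB H)) GC) x) with
  | inl (inl i) => fun e => e (inl (inl i))
  | inl (inr i) => fun e => e (inr i)
  | inr i => fun e => e (inl (inr i)) end.
have dK1 x : tmf (K1 x).
  case: x => [[i|i]|i].
  - exact: (@tmf_var _ _ T (inl (inl i))).
  - exact: (@tmf_var _ _ T (inr i)).
  - exact: (@tmf_var _ _ T (inl (inr i))).
pose K0 (x : cmap (sortC S) (csum GB H)) : env (Cstar S) T -> Cstar S (srt x) :=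
  K1 (inl x).
have dK0 x : tmf (K0 x) by exact: (dK1 (inl x)).
have dJ i : dfn [set e : env (Cstar S) T | J i = true <->
    sat (M := grC S) (pp_form (phi i)) (eval_tuple (t i) (fun x => K0 x e))].
  have := @dfn_subst _ (Cstar S) _ T _ K0
    (@dfn_C _ _ S _ (fsubst (pp_form (phi i)) (t i))) dK0.
  case: (J i) => [|/dfnC]; apply: dfn_iff => e /=; rewrite /setC /= sat_fsubst_tuple.
    by split=> [He|[He _]]; [split|exact: He].
  by split=> [nHe|[_ He] /He //]; split=> // /nHe.
have := dfn_ex (dfnI (dfn_subst dC dK1) (dfn_forall (listable_shape I) dJ)).
apply: dfn_iff => e; rewrite /guessC /setI /=.
have eqK c' : (fun x => K0 x (env_cat e c')) =
    env_cat (M := grC S) (fun i => e (inl i)) c'.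
  by apply: functional_extensionality_dep => -[].
split=> -[c' Hc']; exists c'; move: Hc'; rewrite eqK //.
Qed.

(** When nu(b) satisfies the projection along y of the guessed conjunction, the first clause states
    that b - iota(a0) does so in B, through the pp-formulas [r] that the fundamental system gives
    for that projection. *)
Definition guessA t J (Y : set (env (Astar S) (csum GA (qctx S phi))))
    n (r : 'I_n -> {psi : Phi & term_tuple psi GB}) (a : env (Astar S) GA)
    (b : env (Bstr S) GB) : Prop :=
  exists a0 : env (grA S) GB, exists a1 : env (grA S) H,
    (forall l, rho (S := S) (eval_tuple (projT2 (r l)) b) =
               piA (projT1 (r l)) (eval_tuple (projT2 (r l)) a0)) /\
    Y (env_cat (M := Astar S) a (guess_value t J a0 a1)).

Lemma Aset_guessA t J Y n r : dfn Y -> Aset (@guessA t J Y n r).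
Proof.
move=> dY.
pose T1 := csum GA (cmap (sortA S) GB); pose T := csum T1 (cmap (sortA S) H).
pose K0 (x : cmap (sortA S) GB) : env (Astar S) T -> Astar S (srt x) :=
  fun e => e (inl (inr x)).
have dK0 x : tmf (K0 x) by exact: (@tmf_var _ _ T (inl (inr x))).
pose K1 (x : cmap (sortA S) (csum GB H)) : env (Astar S) T -> Astar S (srt x) :=
  match x return env (Astar S) T -> Astar S (srt (c := cmap (sortA S) (csum GB H)) x)
  with inl i => fun e => e (inl (inr i)) | inr i => fun e => e (inr i) end.
have dK1 x : tmf (K1 x).
  case: x => x; first exact: (@tmf_var _ _ T (inl (inr x))).
  exact: (@tmf_var _ _ T (inr x)).
have dval i : @tmf _ (Astar S) T (sortQ S (phi i)) (fun e =>
    piA (phi i) (if J i then eval_tuple (M := grA S) (t i) (fun x => K1 x e)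
                 else @env_zero _ (grA S) (pp_ctx (phi i)))).
  case: (J i); apply: tmf_pi_subst => j.
    exact: (@tmf_subst _ (Astar S) _ T _ _ K1 (tmf_A S (t i j))).
  exact: tmf_zeroA.
pose KY (x : csum GA (qctx S phi)) : env (Astar S) T -> Astar S (srt x) :=
  match x return env (Astar S) T -> Astar S (srt (c := csum GA (qctx S phi)) x) with
  | inl i => fun e => e (inl (inl i))
  | inr i => fun e => piA (phi i) (if J i
      then eval_tuple (M := grA S) (t i) (fun x => K1 x e)
      else @env_zero _ (grA S) (pp_ctx (phi i))) end.
have dKY x : tmf (KY x).
  by case: x => [x|i]; [exact: (@tmf_var _ _ T (inl (inl x)))|exact: dval].
have dr l : @Aset _ _ S T GB (fun e b => rho (eval_tuple (projT2 (r l)) b) =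
    piA (projT1 (r l)) (eval_tuple (M := grA S) (projT2 (r l)) (fun x => K0 x e))).
  apply: Aset_rho; apply: tmf_pi_subst => j.
  exact: (@tmf_subst _ (Astar S) _ T _ _ K0 (tmf_A S (projT2 (r l) j))).
have := Aset_exA (Aset_exA (Aset_and (Aset_forall (@listable_finite 'I_n) dr)
  (Aset_dfn GB (dfn_subst dY dKY)))).
apply: Aset_iff => a b; split.
  move=> [a0 [a1 [Hr HY]]]; exists a0, a1; split; first exact: Hr.
  move: HY; rewrite /= (_ : (fun i => KY i _) =
    env_cat (M := Astar S) a (guess_value t J a0 a1)) //.
  apply: functional_extensionality_dep => -[i|i] //=.
  rewrite /guess_value (_ : (fun x => K1 x _) = env_cat (M := grA S) a0 a1) //.
  by apply: functional_extensionality_dep => -[].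
move=> [a0 [a1 [Hr HY]]]; exists a0, a1; split; first exact: Hr.
rewrite /= (_ : (fun i => KY i _) = env_cat (M := Astar S) a (guess_value t J a0 a1)) //.
apply: functional_extensionality_dep => -[i|i] //=.
rewrite /guess_value (_ : (fun x => K1 x _) = env_cat (M := grA S) a0 a1) //.
by apply: functional_extensionality_dep => -[].
Qed.

End Guess.
(** [J] records the i with nu(t_i(b, y)) in phi_i(C). For these i, purity gives a single iota(a0,
    a1) whose difference with (b, y) solves the conjunction [psi J], and this determines every
    rho(t_i(b, y)). Projecting along y turns [psi J] into a pp-formula [theta J] on b - iota(a0),
    which the fundamental system expresses through [rho] and nu of terms in b. [pp_combination]
    recovers y from these data. *)
Lemma Kset_exB_AC (A : env (Astar S) GA -> env (Bstr S) (csum GB H) -> Prop)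
    (C : env (Cstar S) (cmap (sortC S) (csum GB H)) -> env (Cstar S) GC -> Prop) :
  Aset A -> Cset C ->
  Kset [set x : env (Astar S) GA * env (Bstr S) GB * env (Cstar S) GC |
    exists y : env (Bstr S) H, A x.1.1 (env_cat x.1.2 y) /\
      C (nu_env (S := S) (env_cat (M := Bstr S) x.1.2 y)) x.2].
Proof.
move=> [I [phi [t [Y [dY AE]]]]] dC.
have lI := listable_shape I.
have pf i : is_pp (fsubst (pp_form (phi i)) (t i)) by exact/fsubst_pp/pp_formP.
have /depfun_choice[psi /all_and2[ppsi psiE]] (J : I -> bool) :=
  fand_all (fun i => J i = true) lI pf.
have /depfun_choice[theta /all_and2[ptheta thetaE]] J := fex_block (psi J).
have /depfun_choice[n /depfun_choice[r rE]] J := HPhi (ptheta J (ppsi J)).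
have psiP (M : structure GL) J (e : env M (csum GB H)) : sat (psi J) e <->
    forall i, J i = true -> sat (pp_form (phi i)) (eval_tuple (t i) e).
  by rewrite psiE; split=> He i Ji; have := He i Ji; rewrite sat_fsubst_tuple.
have KJ J := Kset_AC (Aset_guessA t J (r J) dY) (Cset_guessC t J dC).
apply: Kset_iff (Kset_exists (listable_bool_fun lI) KJ) => a b c /=; split.
  move=> [J [[a0 [a1 [Hr HY]]] [c' [HC HJ]]]].
  have [y' y'E] := nu_env_surj c'.
  have HCpsi : sat (M := grC S) (psi J) (env_cat (nu_env b) (nu_env y')).
    by apply/psiP => i /HJ; rewrite y'E.
  have HCtheta : sat (M := grC S) (theta J) (nu_env b).
    by apply/thetaE; exists (nu_env y').
  have HB : sat (theta J) (env_sub b (iota_env a0)).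
    apply/rE => l; rewrite (eval_tuple_sub (abelianB S)) -iota_eval_tuple.
    apply/rho_class => //.
    (* The list [r] is equivalent to [theta J] in B only, so that nu(r_l(b)) in phi_l(C) is deduced
       from some b - iota(a') in theta(B), which has the same image as b. *)
    have [a' /rE/(_ l)] := (nu_pp b (ptheta J (ppsi J))).1 HCtheta.
    move=> /(nu_pp_imp (pp_formP _)).
    by rewrite (eval_tuple_sub (abelianB S)) -iota_eval_tuple nu_env_iota.
  have [y0 Hy0] := (thetaE J (grB S) _).1 HB.
  have [y [yE Hy]] := pp_combination a1 (ppsi J) HCpsi Hy0.
  exists y; split; last by rewrite nu_env_cat yE y'E.
  apply/AE; move: HY; rewrite (_ : guess_value t J a0 a1 = rhos t (env_cat b y)) //.
  apply: functional_extensionality_dep => i; rewrite /guess_value /rhos.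
  case Ji: (J i).
    apply/esym/rho_class.
      by rewrite nu_eval_tuple nu_env_cat yE y'E; apply/HJ.
    rewrite iota_eval_tuple -(eval_tuple_sub (abelianB S)).
    exact: ((psiP _ J _).1 Hy i Ji).
  rewrite rho_out // nu_eval_tuple nu_env_cat yE y'E => /HJ.
  by rewrite Ji.
move=> [y [HA HC]]; move/AE: HA => HY.
pose J i := `[< sat (M := grC S) (pp_form (phi i))
                 (eval_tuple (t i) (env_cat (nu_env b) (nu_env y))) >].
have JP i : J i = true <-> sat (M := grC S) (pp_form (phi i))
                 (eval_tuple (t i) (env_cat (nu_env b) (nu_env y))).
  by split=> [/asboolP|?] //; exact/asboolP.
exists J; split; last by exists (nu_env y); split=> //; rewrite -nu_env_cat.
have /(nu_pp _ (ppsi J))[a01] : sat (M := grC S) (psi J) (nu_env (env_cat (M := grB S) b y)).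
  by apply/psiP => i /JP; rewrite nu_env_cat.
rewrite -(env_catK (M := grA S) a01).
set a0 := (fun i => a01 (inl i)); set a1 := (fun i => a01 (inr i)) => Hpsi.
exists a0, a1; split.
  move=> l; have HB : sat (theta J) (env_sub b (iota_env a0)).
    apply/thetaE; exists (env_sub y (iota_env a1)).
    by move: Hpsi; rewrite iota_env_cat env_sub_cat.
  have Hl := (rE J _).1 HB l.
  rewrite (eval_tuple_sub (abelianB S)) -iota_eval_tuple in Hl.
  apply/rho_class => //.
  by have := nu_pp_imp (pp_formP _) Hl; rewrite nu_env_iota.
move: HY; rewrite (_ : rhos t (env_cat b y) = guess_value t J a0 a1) //.
apply: functional_extensionality_dep => i; rewrite /guess_value /rhos.
case Ji: (J i).
  apply/rho_class; first by rewrite nu_eval_tuple nu_env_cat; exact/JP.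
  rewrite iota_eval_tuple -(eval_tuple_sub (abelianB S)).
  exact: ((psiP _ J _).1 Hpsi i Ji).
rewrite rho_out // nu_eval_tuple nu_env_cat => /JP.
by rewrite Ji.
Qed.

Lemma Kset_exB
    (X : set (env (Astar S) GA * env (Bstr S) (csum GB H) * env (Cstar S) GC)) :
  Kset X -> Kset [set x | exists y : env (Bstr S) H, X (x.1.1, env_cat x.1.2 y, x.2)].
Proof.
move=> [I [A [C [lI AA CC XE]]]].
apply: Kset_iff (Kset_exists lI (fun i => Kset_exB_AC (AA i) (CC i))) => a b c /=.
split=> [[i [y Hy]]|[y /XE[i Hy]]]; first by exists y; apply/XE; exists i.
by exists i, y.
Qed.

End ExB.
End Elimination.

(** * Quantifier elimination for all formulas of M *)

Section QuantifierElimination.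
Context {L : language} {Phi : pp_family L} (S : pure_sequence Phi).
Hypothesis (HPhi : fundamental_system Phi (grB S)).

Notation GL := (glanguage L).
Notation piA phi := (qclass (@same_coset L (grA S) Phi phi)).
Notation langB := (@langB L).
Notation world GA GB GC :=
  (env (Astar S) GA * env (Bstr S) GB * env (Cstar S) GC)%type.

(** Functions that stay within one family of variables. A general term of M does not, since iota, nu
    and [rho] change the family. *)
Definition basic GA GB GC (s : lsort (langM S)) :
    (world GA GB GC -> seqM S s) -> Prop :=
  match s return (world GA GB GC -> seqM S s) -> Prop with
  | inA s => fun F => exists f : env (Astar S) GA -> Astar S s,
                        tmf f /\ forall x, F x = f x.1.1
  | inB s => fun F => exists t : term GB s, forall x, F x = eval x.1.2 t
  | inC s => fun F => exists f : env (Cstar S) GC -> Cstar S s,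
                        tmf f /\ forall x, F x = f x.2
  end.

Section Atoms.
Variables (GA : ctx (lsort (langA S))) (GB : ctx (lsort langB)).
Variable (GC : ctx (lsort (langC S))).

Lemma Kset_dfnA (Y : set (env (Astar S) GA)) :
  dfn Y -> Kset [set x : world GA GB GC | Y x.1.1].
Proof. by move=> dY; exact: (Kset_A GC (Aset_dfn GB dY)). Qed.

Lemma Kset_dfnC (Y : set (env (Cstar S) GC)) :
  dfn Y -> Kset [set x : world GA GB GC | Y x.2].
Proof. by move=> dY; exact: (@Kset_C _ _ _ GA GB GC (fun _ => Y) (dfn_inr _ dY)). Qed.

Lemma Cset_coset (phi : Phi) (t : term_tuple phi GB) :
  @Cset _ _ S GB GC
    (fun b _ => sat (M := grC S) (pp_form phi) (eval_tuple (M := grC S) t b)).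
Proof.
have := dfn_C S (fsubst (pp_form phi) t) => /(@dfn_inl _ (Cstar S) _ GC).
by apply: dfn_iff => e /=; rewrite sat_fsubst_tuple.
Qed.

Lemma tmf_pi0 (phi : Phi) :
  @tmf _ (Astar S) GA (sortQ S phi) (fun _ => piA phi (@env_zero _ (grA S) _)).
Proof.
apply: tmf_pi_subst => j; exact: tmf_zeroA.
Qed.

(** With nu(b) in phi(C), the class [rho b] is trivial exactly when a = 0 is admissible in b -
    iota(a). This splits membership in phi(B) into a condition on A and one on C; the second is
    needed because [rho] also vanishes outside phi(B) + iota(A). *)
Lemma sat_nu_rho (phi : Phi) (b : env (grB S) (pp_ctx phi)) :
  sat (pp_form phi) b <->
  rho (S := S) b = piA phi (@env_zero _ (grA S) _) /\
  sat (M := grC S) (pp_form phi) (nu_env b).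
Proof.
have iota0 : iota_env (@env_zero _ (grA S) (pp_ctx phi)) = @env_zero _ (grB S) _.
  by rewrite -(env_subrr (@env_zero _ (grA S) _)) iota_env_sub env_subrr.
split=> [Hb|[Hr Hn]].
  have Hn := nu_pp_imp (pp_formP phi) Hb.
  by split=> //; apply/rho_class => //; rewrite iota0 env_subr0.
by move/(rho_class _ Hn): Hr; rewrite iota0 env_subr0.
Qed.

Lemma Kset_ppB (psi : formula GB) :
  is_pp psi -> Kset [set x : world GA GB GC | sat psi x.1.2].
Proof.
move=> /HPhi[n [r rE]].
have KAC i := Kset_AC (Aset_rho (projT2 (r i)) (tmf_pi0 (projT1 (r i))))
  (Cset_coset (projT2 (r i))).
apply: Kset_iff (Kset_forall (@listable_finite 'I_n) KAC) => a b c.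
rewrite /= rE; split=> H i; have := H i.
  by rewrite -nu_eval_tuple -sat_nu_rho.
by rewrite -nu_eval_tuple -sat_nu_rho.
Qed.

Lemma Kset_eq s (F K : world GA GB GC -> seqM S s) :
  basic F -> basic K -> Kset [set x | F x = K x].
Proof.
case: s F K => s F K.
- move=> [f [df fE]] [k [dk kE]].
  by apply: Kset_iff (Kset_dfnA (dfn_eq df dk)) => a b c; rewrite /= fE kE.
- move=> [t tE] [r rE].
  have := @Kset_ppB (feq t r) I; apply: Kset_iff => a b c.
  by rewrite /= tE rE.
move=> [f [df fE]] [k [dk kE]].
by apply: Kset_iff (Kset_dfnC (dfn_eq df dk)) => a b c; rewrite /= fE kE.
Qed.

Lemma iota_eq0 s (b : grB S s) (a : grA S s) :
  b = iota a <-> nu b = (0 : gcarrier (grC S) s)%R /\ (b - iota a = 0 :> gcarrier (grB S) s)%R.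
Proof.
split=> [->|[_ /subr0_eq //]]; split; last exact: subrr.
by apply/exactB; exists a.
Qed.

(** The equality means nu(K) = 0 and K - iota(F) = 0. The fundamental system, applied to the
    pp-formula x = 0, replaces the second condition by conditions phi_i(r_i(K - iota(F))), and given
    nu(K) = 0 these compare [rho] of terms in K with classes of terms in F. *)
Lemma Kset_iota s (F : world GA GB GC -> seqM S (inA (sortA S s)))
    (K : world GA GB GC -> seqM S (inB S s)) :
  basic F -> basic K -> Kset [set x | @iota _ _ S s (F x) = K x].
Proof.
move=> [f [df fE]] [t tE].
pose V1 : ctx (lsort GL) := cconst 1 s.
pose zero_form := @feq GL V1 s (@tvar GL V1 ord0) (tzero V1 s).
have [n [r rE]] := HPhi (I : is_pp zero_form).
pose r' i : term_tuple (projT1 (r i)) GB :=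
  fun j => tsubst (fun _ : V1 => t) (projT2 (r i) j).
have dF i : @tmf _ (Astar S) GA (sortQ S (projT1 (r i)))
    (fun a => piA (projT1 (r i)) (eval_tuple (M := grA S) (projT2 (r i)) (fun _ => f a))).
  apply: tmf_pi_subst => j.
  exact: (@tmf_subst _ (Astar S) (cmap (sortA S) V1) GA _ _ (fun _ => f)
    (tmf_A S (projT2 (r i) j)) (fun _ => df)).
have dC : @Cset _ _ S GB GC (fun b _ => eval (M := grC S) b t = (0 : gcarrier (grC S) s)%R).
  have := dfn_C S (feq t (tzero GB s)).
  by move=> /(@dfn_inl _ (Cstar S) _ GC); apply: dfn_iff.
have := Kset_AC (Aset_forall (@listable_finite 'I_n) (fun i => Aset_rho (r' i) (dF i))) dC.
apply: Kset_iff => a b c /=; rewrite fE tE /=.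
have E : (iota (f a) = eval b t <-> nu (eval b t) = (0 : gcarrier (grC S) s)%R /\
    (eval b t - iota (f a) = 0 :> gcarrier (grB S) s)%R).
  by rewrite -iota_eq0; split=> ->.
rewrite E -(hom_eval (nu_homomorphism S)).
suff : nu (eval b t) = (0 : gcarrier (grC S) s)%R ->
   ((eval b t - iota (f a) = 0 :> gcarrier (grB S) s)%R <->
    forall i, rho (S := S) (eval_tuple (r' i) b) =
      piA (projT1 (r i)) (eval_tuple (M := grA S) (projT2 (r i)) (fun _ => f a))).
  by move=> H; split=> -[H1 H2]; split=> //; apply/H.
move=> nu0; pose y : env (grB S) V1 := fun _ => eval b t.
pose z : env (grA S) V1 := fun _ => f a.
have -> : (eval b t - iota (f a) = 0 :> gcarrier (grB S) s)%R <->
    forall i, sat (pp_form (projT1 (r i))) (eval_tuple (projT2 (r i)) (env_sub y (iota_env z))).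
  by rewrite -rE.
have r'E i : eval_tuple (r' i) b = eval_tuple (projT2 (r i)) y.
  by apply: functional_extensionality_dep => j; rewrite /eval_tuple eval_tsubst.
have nuy i : sat (M := grC S) (pp_form (projT1 (r i))) (nu_env (eval_tuple (projT2 (r i)) y)).
  rewrite nu_eval_tuple (_ : nu_env y = @env_zero _ (grC S) V1); last first.
    by apply: functional_extensionality_dep => j; exact: nu0.
  rewrite (_ : eval_tuple _ _ = @env_zero _ (grC S) _).
    exact/pp_zero/pp_formP/abelianC.
  by apply: functional_extensionality_dep => j; exact: (eval_zero (abelianC S)).
split=> H i; have := H i.
  rewrite (eval_tuple_sub (abelianB S)) -iota_eval_tuple r'E => Hi.
  exact/(rho_class _ (nuy i)).
rewrite (eval_tuple_sub (abelianB S)) -iota_eval_tuple r'E.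
by move/(rho_class _ (nuy i)).
Qed.

End Atoms.
Definition prA GA H GB GC (x : world (csum GA H) GB GC) : world GA GB GC :=
  (fun i => x.1.1 (inl i), x.1.2, x.2).
Definition prB GA GB H GC (x : world GA (csum GB H) GC) : world GA GB GC :=
  (x.1.1, fun i => x.1.2 (inl i), x.2).
Definition prC GA GB GC H (x : world GA GB (csum GC H)) : world GA GB GC :=
  (x.1.1, x.1.2, fun i => x.2 (inl i)).

Lemma basic_prA GA H GB GC s (F : world GA GB GC -> seqM S s) :
  basic F -> basic (fun x => F (@prA GA H GB GC x)).
Proof.
case: s F => s F /=.
- move=> [f [df fE]]; exists (fun e => f (fun i => e (inl i))).
  by split=> [|x]; [exact: tmf_inl|rewrite fE].
- by move=> [t tE]; exists t => x; rewrite tE.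
by move=> [f [df fE]]; exists f; split=> // x; rewrite fE.
Qed.

Lemma basic_prB GA GB H GC s (F : world GA GB GC -> seqM S s) :
  basic F -> basic (fun x => F (@prB GA GB H GC x)).
Proof.
case: s F => s F /=.
- by move=> [f [df fE]]; exists f; split=> // x; rewrite fE.
- move=> [t tE]; exists (tsubst (fun i => @tvar GL (csum GB H) (inl i)) t) => x.
  by rewrite tE eval_tsubst.
by move=> [f [df fE]]; exists f; split=> // x; rewrite fE.
Qed.

Lemma basic_prC GA GB GC H s (F : world GA GB GC -> seqM S s) :
  basic F -> basic (fun x => F (@prC GA GB GC H x)).
Proof.
case: s F => s F /=.
- by move=> [f [df fE]]; exists f; split=> // x; rewrite fE.
- by move=> [t tE]; exists t => x; rewrite tE.
move=> [f [df fE]]; exists (fun e => f (fun i => e (inl i))).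
by split=> [|x]; [exact: tmf_inl|rewrite fE].
Qed.

Lemma basic_newA GA (H : ctx (lsort (langA S))) GB GC (i : H) :
  @basic (csum GA H) GB GC (inA (srt i)) (fun x => x.1.1 (inr i)).
Proof.
exists (fun e => e (inr i)); split=> //.
exact: (@tmf_var _ _ (csum GA H) (inr i)).
Qed.

Lemma basic_newB GA GB (H : ctx (lsort langB)) GC (i : H) :
  @basic GA (csum GB H) GC (inB S (srt i)) (fun x => x.1.2 (inr i)).
Proof. by exists (@tvar GL (csum GB H) (inr i)). Qed.

Lemma basic_newC GA GB GC (H : ctx (lsort (langC S))) (i : H) :
  @basic GA GB (csum GC H) (inC (srt i)) (fun x => x.2 (inr i)).
Proof.
exists (fun e => e (inr i)); split=> //.
exact: (@tmf_var _ _ (csum GC H) (inr i)).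
Qed.

(** Unnesting: since a term may pass through several families, the values of its immediate subterms
    are named by new variables, which are then quantified away. *)
Lemma Kset_graph (G : ctx (lsort (langM S))) s (t : term G s) :
  forall GA GB GC (F : forall i : G, world GA GB GC -> seqM S (srt i))
    (V : world GA GB GC -> seqM S s),
  (forall i, basic (F i)) -> basic V ->
  Kset [set x | eval (fun i => F i x) t = V x].
Proof.
elim: t => [i GA GB GC F V HF HV|f ts IH GA GB GC F V HF HV].
  exact: Kset_eq.
case: f ts IH V HV => [f|f|f|s0|s0|phi] ts IH V HV.
- pose H := fdom f.
  have Ki (i : H) := IH i (csum GA H) GB GC (fun i x => F i (prA x))
    (fun x => x.1.1 (inr i)) (fun j => basic_prA H (HF j)) (basic_newA GA GB GC i).
  have [v [dv vE]] := HV.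
  have df : @tmf _ (Astar S) (csum GA H) (fcod f) (fun e => fint (fun i : H => e (inr i))).
    apply: (@tmf_app _ (Astar S) (csum GA H) f (fun i e => e (inr i))) => i.
    exact: (@tmf_var _ (Astar S) (csum GA H) (inr i)).
  have K0 := Kset_dfnA GB GC (dfn_eq df (tmf_inl H dv)).
  apply: Kset_iff (Kset_exA (Kset_and (Kset_forall (listable_shape H) Ki) K0)).
  move=> a b c; rewrite /setI /= vE; split.
    move=> [z [Hz <-]]; congr (@fint _ (Astar S) f).
    by apply: functional_extensionality_dep => i; exact: Hz.
  move=> <-; exists (fun i => eval (fun i => F i (a, b, c)) (ts i)).
  by split.
- pose H := fdom (l := langB) f.
  have Ki (i : H) := IH i GA (csum GB H) GC (fun i x => F i (prB x))
    (fun x => x.1.2 (inr i)) (fun j => basic_prB H (HF j)) (basic_newB GA GB GC i).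
  have [v vE] := HV.
  have K0 := @Kset_ppB GA (csum GB H) GC (feq
    (@tapp GL (csum GB H) f (fun i => @tvar GL (csum GB H) (inr i)))
    (tsubst (fun i => @tvar GL (csum GB H) (inl i)) v)) I.
  apply: Kset_iff (Kset_exB HPhi (Kset_and (Kset_forall (listable_shape H) Ki) K0)).
  move=> a b c; rewrite /setI /= vE; split.
    move=> [z [Hz]]; rewrite eval_tsubst /= => <-; congr (@fint _ (Bstr S) f).
    by apply: functional_extensionality_dep => i; exact: Hz.
  move=> E; exists (fun i => eval (fun i => F i (a, b, c)) (ts i)).
  by split=> //; rewrite eval_tsubst.
- pose H := fdom f.
  have Ki (i : H) := IH i GA GB (csum GC H) (fun i x => F i (prC x))
    (fun x => x.2 (inr i)) (fun j => basic_prC H (HF j)) (basic_newC GA GB GC i).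
  have [v [dv vE]] := HV.
  have df : @tmf _ (Cstar S) (csum GC H) (fcod f) (fun e => fint (fun i : H => e (inr i))).
    apply: (@tmf_app _ (Cstar S) (csum GC H) f (fun i e => e (inr i))) => i.
    exact: (@tmf_var _ (Cstar S) (csum GC H) (inr i)).
  have K0 := Kset_dfnC GA GB (dfn_eq df (tmf_inl H dv)).
  apply: Kset_iff (Kset_exC (Kset_and (Kset_forall (listable_shape H) Ki) K0)).
  move=> a b c; rewrite /setI /= vE; split.
    move=> [z [Hz <-]]; congr (@fint _ (Cstar S) f).
    by apply: functional_extensionality_dep => i; exact: Hz.
  move=> <-; exists (fun i => eval (fun i => F i (a, b, c)) (ts i)).
  by split.
- pose H : ctx (lsort (langA S)) := cconst 1 (sortA S s0).
  have K1 := IH ord0 (csum GA H) GB GC (fun i x => F i (prA x))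
    (fun x => x.1.1 (inr ord0)) (fun j => basic_prA H (HF j)) (basic_newA GA GB GC (ord0 : H)).
  have K0 := @Kset_iota (csum GA H) GB GC s0 (fun x => x.1.1 (inr ord0))
    (fun x => V (prA x)) (basic_newA GA GB GC (ord0 : H)) (basic_prA H HV).
  apply: Kset_iff (Kset_exA (Kset_and K1 K0)) => a b c; rewrite /setI /=.
  split=> [[z [Hz <-]]|E]; first by rewrite Hz.
  by exists (fun _ => eval (fun i => F i (a, b, c)) (ts ord0)); split.
- pose H : ctx (lsort langB) := cconst 1 s0.
  have K1 := IH ord0 GA (csum GB H) GC (fun i x => F i (prB x))
    (fun x => x.1.2 (inr ord0)) (fun j => basic_prB H (HF j)) (basic_newB GA GB GC (ord0 : H)).
  have [v [dv vE]] := HV.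
  pose T := csum (cmap (sortC S) (csum GB H)) GC.
  have dC : @Cset _ _ S (csum GB H) GC (fun b c => b (inr ord0) = v c).
    apply: (@dfn_eq _ _ T (sortC S s0)); last exact: tmf_inr.
    exact: (@tmf_var _ _ T (inl (inr ord0))).
  have K0 := Kset_C GA dC.
  apply: Kset_iff (Kset_exB HPhi (Kset_and K1 K0)) => a b c; rewrite /setI /= vE.
  split=> [[z [Hz <-]]|E]; first by rewrite Hz.
  by exists (fun _ => eval (fun i => F i (a, b, c)) (ts ord0)); split.
pose H : ctx (lsort langB) := pp_ctx phi.
have Ki (i : H) := IH i GA (csum GB H) GC (fun i x => F i (prB x))
  (fun x => x.1.2 (inr i)) (fun j => basic_prB H (HF j)) (basic_newB GA GB GC i).
have [v [dv vE]] := HV.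
have K0 := Kset_A GC (Aset_rho (fun j : pp_ctx phi => @tvar GL (csum GB H) (inr j)) dv).
apply: Kset_iff (Kset_exB HPhi (Kset_and (Kset_forall (listable_shape H) Ki) K0)).
move=> a b c; rewrite /setI /= vE; split.
  move=> [z [Hz <-]]; congr rho.
  by apply: functional_extensionality_dep => i; exact: Hz.
move=> <-; exists (fun i => eval (fun i => F i (a, b, c)) (ts i)).
by split.
Qed.

(** Adds one variable to the family that the sort [s] belongs to, so that the quantifier step can be
    made without a case distinction. *)
Lemma basic_extend GA GB GC (s : lsort (langM S)) :
  exists GA' GB' GC' (pr : world GA' GB' GC' -> world GA GB GC)
    (v : world GA' GB' GC' -> seqM S s),
    [/\ forall s' (F : world GA GB GC -> seqM S s'), basic F -> basic (F \o pr),
        basic v, forall x y, exists z, pr z = x /\ v z = y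
      & forall X, Kset X -> Kset [set x | exists z, pr z = x /\ X z]].
Proof.
case: s => s.
- pose H : ctx (lsort (langA S)) := cconst 1 s.
  exists (csum GA H), GB, GC, (@prA GA H GB GC), (fun x => x.1.1 (inr ord0)); split.
  + by move=> s' F; exact: basic_prA.
  + exact: (basic_newA GA GB GC (ord0 : H)).
  + move=> [[a b] c] y.
    by exists (env_cat a ((fun _ => y) : env (Astar S) H), b, c).
  move=> X /Kset_exA; apply: Kset_iff => a b c; split=> [[z Xz]|[[[z b'] c'] [[<- <- <-] Xz]]].
    by exists (env_cat a z, b, c).
  by exists (fun i => z (inr i)); move: Xz; rewrite -{1}(env_catK (M := Astar S) z).
- pose H : ctx (lsort langB) := cconst 1 s.
  exists GA, (csum GB H), GC, (@prB GA GB H GC), (fun x => x.1.2 (inr ord0)); split.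
  + by move=> s' F; exact: basic_prB.
  + exact: (basic_newB GA GB GC (ord0 : H)).
  + move=> [[a b] c] y.
    by exists (a, env_cat b ((fun _ => y) : env (Bstr S) H), c).
  move=> X /(Kset_exB HPhi); apply: Kset_iff => a b c.
  split=> [[z Xz]|[[[a' z] c'] [[<- <- <-] Xz]]].
    by exists (a, env_cat b z, c).
  by exists (fun i => z (inr i)); move: Xz; rewrite -{1}(env_catK (M := Bstr S) z).
pose H : ctx (lsort (langC S)) := cconst 1 s.
exists GA, GB, (csum GC H), (@prC GA GB GC H), (fun x => x.2 (inr ord0)); split.
+ by move=> s' F; exact: basic_prC.
+ exact: (basic_newC GA GB GC (ord0 : H)).
+ move=> [[a b] c] y.
  by exists (a, b, env_cat c ((fun _ => y) : env (Cstar S) H)).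
move=> X /Kset_exC; apply: Kset_iff => a b c.
split=> [[z Xz]|[[[a' b'] z] [[<- <- <-] Xz]]].
  by exists (a, b, env_cat c z).
by exists (fun i => z (inr i)); move: Xz; rewrite -{1}(env_catK (M := Cstar S) z).
Qed.

Lemma Kset_formula (G : ctx (lsort (langM S))) (phi : formula G) :
  forall GA GB GC (F : forall i : G, world GA GB GC -> seqM S (srt i)),
  (forall i, basic (F i)) -> Kset [set x | sat phi (fun i => F i x)].
Proof.
elim: phi => {G}.
- by move=> G GA GB GC F HF; exact: Kset_T.
- move=> G s t1 t2 GA GB GC F HF.
  (* [Kset_graph] compares a term with a [basic] function only; equality of two terms is therefore
     expressed through a new variable [v] equal to both. *)
  have [GA' [GB' [GC' [pr [v [Hpr Hv surj Kex]]]]]] := basic_extend GA GB GC s.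
  have K1 := Kset_graph t1 (fun i => Hpr _ _ (HF i)) Hv.
  have K2 := Kset_graph t2 (fun i => Hpr _ _ (HF i)) Hv.
  apply: Kset_iff (Kex _ (Kset_and K1 K2)) => a b c /=.
  split=> [[z [<- [E1 E2]]]|E]; first by rewrite [LHS]E1 [RHS]E2.
  have [z [prz vz]] := surj (a, b, c) (eval (fun i => F i (a, b, c)) t1).
  by exists z; split=> //; split; rewrite /= prz vz.
- move=> G r ts GA GB GC F HF; case: r ts => r ts.
  + pose H := rdom r.
    have Ki (i : H) := @Kset_graph _ _ (ts i) (csum GA H) GB GC (fun i x => F i (prA x))
      (fun x => x.1.1 (inr i)) (fun j => basic_prA H (HF j)) (basic_newA GA GB GC i).
    have dr : dfn [set e : env (Astar S) (csum GA H) | rint (fun i : H => e (inr i))].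
      apply: (@dfn_rel _ (Astar S) (csum GA H) r (fun i e => e (inr i))) => i.
      exact: (@tmf_var _ (Astar S) (csum GA H) (inr i)).
    have K0 := Kset_dfnA GB GC dr.
    apply: Kset_iff (Kset_exA (Kset_and (Kset_forall (listable_shape H) Ki) K0)).
    move=> a b c; rewrite /setI /=; split.
      move=> [z [Hz]]; rewrite (_ : (fun i : H => z i) =
        fun i => eval (fun i => F i (a, b, c)) (ts i)) //.
      by apply: functional_extensionality_dep => i; exact/esym/Hz.
    by move=> Hr; exists (fun i => eval (fun i => F i (a, b, c)) (ts i)).
  + pose H := rdom (l := langB) r.
    have Ki (i : H) := @Kset_graph _ _ (ts i) GA (csum GB H) GC (fun i x => F i (prB x))
      (fun x => x.1.2 (inr i)) (fun j => basic_prB H (HF j)) (basic_newB GA GB GC i).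
    have K0 := @Kset_ppB GA (csum GB H) GC
      (@frel GL (csum GB H) r (fun i => @tvar GL (csum GB H) (inr i))) I.
    apply: Kset_iff (Kset_exB HPhi (Kset_and (Kset_forall (listable_shape H) Ki) K0)).
    move=> a b c; rewrite /setI /=; split.
      move=> [z [Hz]]; rewrite (_ : (fun i : H => z i) =
        fun i => eval (fun i => F i (a, b, c)) (ts i)) //.
      by apply: functional_extensionality_dep => i; exact/esym/Hz.
    by move=> Hr; exists (fun i => eval (fun i => F i (a, b, c)) (ts i)).
  pose H := rdom r.
  have Ki (i : H) := @Kset_graph _ _ (ts i) GA GB (csum GC H) (fun i x => F i (prC x))
    (fun x => x.2 (inr i)) (fun j => basic_prC H (HF j)) (basic_newC GA GB GC i).
  have dr : dfn [set e : env (Cstar S) (csum GC H) | rint (fun i : H => e (inr i))].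
    apply: (@dfn_rel _ (Cstar S) (csum GC H) r (fun i e => e (inr i))) => i.
    exact: (@tmf_var _ (Cstar S) (csum GC H) (inr i)).
  have K0 := Kset_dfnC GA GB dr.
  apply: Kset_iff (Kset_exC (Kset_and (Kset_forall (listable_shape H) Ki) K0)).
  move=> a b c; rewrite /setI /=; split.
    move=> [z [Hz]]; rewrite (_ : (fun i : H => z i) =
      fun i => eval (fun i => F i (a, b, c)) (ts i)) //.
    by apply: functional_extensionality_dep => i; exact/esym/Hz.
  by move=> Hr; exists (fun i => eval (fun i => F i (a, b, c)) (ts i)).
- by move=> G phi IH GA GB GC F HF; exact: (Kset_not (IH _ _ _ F HF)).
- move=> G phi IH1 psi IH2 GA GB GC F HF.
  exact: (Kset_and (IH1 _ _ _ F HF) (IH2 _ _ _ F HF)).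
move=> G s phi IH GA GB GC F HF.
have [GA' [GB' [GC' [pr [v [Hpr Hv surj Kex]]]]]] := basic_extend GA GB GC s.
pose F' (o : cext G s) : world GA' GB' GC' -> seqM S (srt o) :=
  match o return world GA' GB' GC' -> seqM S (srt (c := cext G s) o) with
  | inl i => F i \o pr | inr j => v end.
have HF' o : basic (F' o) by case: o => [i|j]; [exact: (Hpr _ _ (HF i))|exact: Hv].
have eqF z : (fun o => F' o z) = env_ext (fun i => F i (pr z)) (v z).
  by apply: functional_extensionality_dep => -[].
apply: Kset_iff (Kex _ (IH _ _ _ F' HF')) => a b c /=.
split=> [[z [prz]]|[y Hy]]; first by rewrite eqF prz; exists (v z).
have [z [prz vz]] := surj (a, b, c) y.
by exists z; split=> //; rewrite eqF prz vz.
Qed.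

End QuantifierElimination.

(** * Split tuples and representation of imaginaries *)

Section SplitContexts.
Context {L : language} {Phi : pp_family L} (S : pure_sequence Phi).

Notation GL := (glanguage L).
Notation langB := (@langB L).

(** Variables sorted into the three families. Concatenation ([scat], [jn]) works family by family,
    so that [Aset] and [Cset] apply directly to joined tuples. *)
Record split := Split {
  pA : ctx (lsort (langA S)); pB : ctx (lsort langB); pC : ctx (lsort (langC S)) }.

Definition sv (P : split) : ctx (lsort (langM S)) :=
  csum (csum (cmap (@inA _ _ S) (pA P)) (cmap (@inB _ _ S) (pB P)))
       (cmap (@inC _ _ S) (pC P)).

Definition scat (P Q : split) : split :=
  Split (csum (pA P) (pA Q)) (csum (pB P) (pB Q)) (csum (pC P) (pC Q)).

Definition wA P (x : env (seqM S) (sv P)) : env (Astar S) (pA P) :=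
  fun i => x (inl (inl i)).
Definition wB P (x : env (seqM S) (sv P)) : env (Bstr S) (pB P) :=
  fun i => x (inl (inr i)).
Definition wC P (x : env (seqM S) (sv P)) : env (Cstar S) (pC P) :=
  fun i => x (inr i).
Definition wtuple P (a : env (Astar S) (pA P)) (b : env (Bstr S) (pB P))
    (c : env (Cstar S) (pC P)) : env (seqM S) (sv P) :=
  fun z => match z return seqM S (srt (c := sv P) z) with
           | inl (inl i) => a i | inl (inr i) => b i | inr i => c i end.

Lemma wtupleK P (x : env (seqM S) (sv P)) : wtuple (wA x) (wB x) (wC x) = x.
Proof. by apply: functional_extensionality_dep => -[[]|]. Qed.

Definition jn P Q (x : env (seqM S) (sv P)) (y : env (seqM S) (sv Q)) :
    env (seqM S) (sv (scat P Q)) :=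
  @wtuple (scat P Q) (env_cat (wA x) (wA y)) (env_cat (wB x) (wB y))
    (env_cat (wC x) (wC y)).

Definition pr1 P Q (z : env (seqM S) (sv (scat P Q))) : env (seqM S) (sv P) :=
  @wtuple P (fun i => wA z (inl i)) (fun i => wB z (inl i)) (fun i => wC z (inl i)).
Definition pr2 P Q (z : env (seqM S) (sv (scat P Q))) : env (seqM S) (sv Q) :=
  @wtuple Q (fun i => wA z (inr i)) (fun i => wB z (inr i)) (fun i => wC z (inr i)).

Lemma pr1_jn P Q (x : env (seqM S) (sv P)) (y : env (seqM S) (sv Q)) : pr1 (jn x y) = x.
Proof. by apply: functional_extensionality_dep => -[[]|]. Qed.
Lemma pr2_jn P Q (x : env (seqM S) (sv P)) (y : env (seqM S) (sv Q)) : pr2 (jn x y) = y.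
Proof. by apply: functional_extensionality_dep => -[[]|]. Qed.
Lemma jn_pr P Q (z : env (seqM S) (sv (scat P Q))) : jn (pr1 z) (pr2 z) = z.
Proof. by apply: functional_extensionality_dep => -[[[]|[]]|[]]. Qed.

Lemma tmf_pr1 P Q i : tmf (fun z => @pr1 P Q z i).
Proof.
case: i => [[i|i]|i].
- exact: (@tmf_var _ (seqM S) (sv (scat P Q)) (inl (inl (inl i)))).
- exact: (@tmf_var _ (seqM S) (sv (scat P Q)) (inl (inr (inl i)))).
- exact: (@tmf_var _ (seqM S) (sv (scat P Q)) (inr (inl i))).
Qed.

Lemma tmf_pr2 P Q i : tmf (fun z => @pr2 P Q z i).
Proof.
case: i => [[i|i]|i].
- exact: (@tmf_var _ (seqM S) (sv (scat P Q)) (inl (inl (inr i)))).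
- exact: (@tmf_var _ (seqM S) (sv (scat P Q)) (inl (inr (inr i)))).
- exact: (@tmf_var _ (seqM S) (sv (scat P Q)) (inr (inr i))).
Qed.

Lemma dfn_A (G : ctx (lsort (langA S))) (X : set (env (Astar S) G)) :
  dfn X -> @dfn _ (seqM S) (cmap (@inA _ _ S) G) X.
Proof.
move=> [phi phiP].
apply: (@dfn_iff _ (seqM S) (cmap (@inA _ _ S) G)
  [set e : env (Astar S) G | sat phi (fun i => e i)] X) => //.
apply: (@interpretation _ _ (Astar S) (seqM S) (fun H s F =>
  @tmf _ (seqM S) H (inA s) F) _ _ _ _ _ phi (cmap (@inA _ _ S) G)
  (fun i e => e i)).
- by move=> H f F; exact: (@tmf_app _ (seqM S) H (funA f)).
- by move=> H s F K; exact: dfn_eq.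
- by move=> H r F; exact: (@dfn_rel _ (seqM S) H (relA r)).
- move=> H s; exists (cconst 1 (inA s)), (fun e => e ord0); split.
  + by move=> x; exists (fun _ => x).
  + exact: (@tmf_var _ (seqM S) (csum H (cconst 1 (inA s))) (inr ord0)).
  + by move=> s' F; exact: tmf_inl.
- by move=> i; exact: (@tmf_var _ (seqM S) (cmap (@inA _ _ S) G) i).
Qed.

Lemma dfn_Cstar (G : ctx (lsort (langC S))) (X : set (env (Cstar S) G)) :
  dfn X -> @dfn _ (seqM S) (cmap (@inC _ _ S) G) X.
Proof.
move=> [phi phiP].
apply: (@dfn_iff _ (seqM S) (cmap (@inC _ _ S) G)
  [set e : env (Cstar S) G | sat phi (fun i => e i)] X) => //.
apply: (@interpretation _ _ (Cstar S) (seqM S) (fun H s F =>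
  @tmf _ (seqM S) H (inC s) F) _ _ _ _ _ phi (cmap (@inC _ _ S) G)
  (fun i e => e i)).
- by move=> H f F; exact: (@tmf_app _ (seqM S) H (funC f)).
- by move=> H s F K; exact: dfn_eq.
- by move=> H r F; exact: (@dfn_rel _ (seqM S) H (relC r)).
- move=> H s; exists (cconst 1 (inC s)), (fun e => e ord0); split.
  + by move=> x; exists (fun _ => x).
  + exact: (@tmf_var _ (seqM S) (csum H (cconst 1 (inC s))) (inr ord0)).
  + by move=> s' F; exact: tmf_inl.
- by move=> i; exact: (@tmf_var _ (seqM S) (cmap (@inC _ _ S) G) i).
Qed.

Lemma tmf_B (H : ctx (lsort (langM S))) (G : ctx (lsort langB)) s (t : term G s)
    (F : forall i : G, env (seqM S) H -> Bstr S (srt i)) :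
  (forall i, @tmf _ (seqM S) H (inB S (srt i)) (F i)) ->
  @tmf _ (seqM S) H (inB S s) (fun e => eval (M := Bstr S) (fun i => F i e) t).
Proof.
move=> HF; elim: t => [//|f ts IH] /=.
exact: (@tmf_app _ (seqM S) H (@funB _ _ S f)).
Qed.

Lemma Aset_dfn_seq P A : Aset A -> dfn [set x : env (seqM S) (sv P) | A (wA x) (wB x)].
Proof.
move=> [I [phi [t [Y [dY AE]]]]].
pose T := csum (pA P) (qctx S phi).
pose K (x : cmap (@inA _ _ S) T) : env (seqM S) (sv P) -> seqM S (srt x) :=
  match x return env (seqM S) (sv P) -> seqM S (srt (c := cmap (@inA _ _ S) T) x) with
  | inl i => fun e => wA e i
  | inr i => fun e => rho (eval_tuple (t i) (wB e)) end.
have dK x : tmf (K x).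
  case: x => i; first exact: (@tmf_var _ (seqM S) (sv P) (inl (inl i))).
  apply: (@tmf_app _ (seqM S) (sv P) (@fun_rho _ _ S (phi i))
    (fun j e => eval_tuple (t i) (wB e) j)) => j.
  apply: (@tmf_B (sv P) _ _ (t i j) (fun k e => wB e k)) => k.
  exact: (@tmf_var _ (seqM S) (sv P) (inl (inr k))).
have := dfn_subst (dfn_A dY) dK; apply: dfn_iff => x /=; rewrite AE.
by rewrite (_ : (fun i => K i x) = env_cat (wA x) (rhos t (wB x))) //;
  apply: functional_extensionality_dep => -[].
Qed.

Lemma Cset_dfn_seq P
    (C : env (Cstar S) (cmap (sortC S) (pB P)) -> env (Cstar S) (pC P) -> Prop) :
  Cset C ->
  dfn [set x : env (seqM S) (sv P) | C (nu_env (wB x)) (wC x)].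
Proof.
move=> dC.
pose T := csum (cmap (sortC S) (pB P)) (pC P).
pose K (x : cmap (@inC _ _ S) T) : env (seqM S) (sv P) -> seqM S (srt x) :=
  match x return env (seqM S) (sv P) -> seqM S (srt (c := cmap (@inC _ _ S) T) x) with
  | inl i => fun e => nu (wB e i)
  | inr i => fun e => wC e i end.
have dK x : tmf (K x).
  case: x => i; last exact: (@tmf_var _ (seqM S) (sv P) (inr i)).
  apply: (@tmf_app _ (seqM S) (sv P) (@fun_nu _ _ S (srt (c := pB P) i))
    (fun j e => wB e i)) => j.
  exact: (@tmf_var _ (seqM S) (sv P) (inl (inr i))).
exact: (dfn_subst (dfn_Cstar dC) dK).
Qed.

Lemma splitting (HPhi : fundamental_system Phi (grB S)) P
    (X : set (env (seqM S) (sv P))) : dfn X ->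
  exists (I : Type) (A : I -> env (Astar S) (pA P) -> env (Bstr S) (pB P) -> Prop)
    (C : I -> env (Cstar S) (cmap (sortC S) (pB P)) -> env (Cstar S) (pC P) -> Prop),
    [/\ listable I, forall i, Aset (A i), forall i, Cset (C i)
      & forall x, X x <-> exists i, A i (wA x) (wB x) /\ C i (nu_env (wB x)) (wC x)].
Proof.
move=> [phi phiP].
have [] := @Kset_formula _ _ S HPhi _ phi (pA P) (pB P) (pC P)
  (fun i w => wtuple w.1.1 w.1.2 w.2 i) _.
  move=> [[i|i]|i] /=.
  - by exists (fun e => e i); split=> //; exact: tmf_var.
  - by exists (@tvar GL (pB P) i).
  - by exists (fun e => e i); split=> //; exact: tmf_var.
move=> I [A [C [lI AA CC XE]]]; exists I, A, C; split=> // x.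
by rewrite -XE /= -phiP -{1}(wtupleK x).
Qed.

End SplitContexts.

(** * Replacing imaginaries by tuples of M *)

Section Imaginaries.
Context {L : language} {Phi : pp_family L} (S : pure_sequence Phi).

Notation M := (seqM S).
Notation N := (Meq (seqM S)).

Definition hv (P : split S) : ctx (lsort (eq_language M)) := cmap (@home _ M) (sv P).

Definition is_home s (v : N s) : Prop := exists s' (a : M s'), in_elt v = home_elt a.

(** The last clause says that nothing new is chosen when all the [v j] are home elements; the tuple
    [e] then remains in any set that contains them. *)
Definition represented (J : Type) (s : J -> lsort (eq_language M))
    (v : forall j, N (s j)) (l : seq J) : Prop :=
  exists (P : split S) (e : env M (sv P)) (F : forall j, env N (hv P) -> N (s j)),
    (forall j, List.In j l -> tmf (F j) /\ F j e = v j) /\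
    ((forall j, is_home (v j)) -> forall i, exists j, home_elt (e i) = in_elt (v j)).

Lemma represented_cons J s (v : forall j : J, N (s j)) j0 l :
  @represented unit (fun _ => s j0) (fun _ => v j0) [:: tt] ->
  represented v l -> represented v (j0 :: l).
Proof.
move=> [P1 [e1 [F1 [HF1 Hh1]]]] [P [e [F [HF Hh]]]].
pose F' j : env N (hv (scat P P1)) -> N (s j) :=
  match pselect (j0 = j) with
  | left E => match E in _ = j return env N (hv (scat P P1)) -> N (s j) with
              | erefl => fun z => F1 tt (pr2 z) end
  | right _ => fun z => F j (pr1 z)
  end.
exists (scat P P1), (jn e e1), F'; split.
  move=> j Hj; rewrite /F'; case: pselect => [E|n].
    case: _ / E; have [] := HF1 tt; first by left.
    move=> dF1 F1E; split; last by rewrite pr2_jn.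
    apply: (@tmf_subst _ N (hv P1) (hv (scat P P1)) _ _ (fun i z => pr2 z i)) => // i.
    exact: (tmf_meq (@tmf_pr2 _ _ S P P1 i)).
  have [|dF FE] := HF j; first by case: Hj.
  split; last by rewrite pr1_jn.
  apply: (@tmf_subst _ N (hv P) (hv (scat P P1)) _ _ (fun i z => pr1 z i)) => // i.
  exact: (tmf_meq (@tmf_pr1 _ _ S P P1 i)).
move=> Hv; have {}Hh := Hh Hv; have {}Hh1 := Hh1 (fun _ => Hv j0).
have He1 i : exists j, home_elt (e1 i) = in_elt (v j).
  by have [_ Ei] := Hh1 i; exists j0.
move=> [[[i|i]|[i|i]]|[i|i]] /=.
- exact: (Hh (inl (inl i))).
- exact: (He1 (inl (inl i))).
- exact: (Hh (inl (inr i))).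
- exact: (He1 (inl (inr i))).
- exact: (Hh (inr i)).
- exact: (He1 (inr i)).
Qed.

Lemma represented_all J s (v : forall j : J, N (s j)) l :
  (forall j, @represented unit (fun _ => s j) (fun _ => v j) [:: tt]) ->
  represented v l.
Proof.
move=> H; elim: l => [|j l IH]; last exact: represented_cons.
exists (Split cempty cempty cempty).
exists (@wtuple _ _ S (Split cempty cempty cempty)
  (env_empty _) (env_empty _) (env_empty _)).
by exists (fun j _ => v j); split=> // _ [[[]|[]]|[]].
Qed.

Lemma represented_home s (a : M s) :
  @represented unit (fun _ => home M s) (fun _ => a) [:: tt].
Proof.
case: s a => s a.
- exists (Split (cconst 1 s) cempty cempty).
  exists (@wtuple _ _ S (Split (cconst 1 s) cempty cempty)
    (fun _ => a) (env_empty _) (env_empty _)).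
  exists (fun _ x => x (inl (inl ord0))); split.
    move=> j _; split=> //.
    exact: (@tmf_var _ N (hv (Split (cconst 1 s) cempty cempty)) (inl (inl ord0))).
  by move=> _ [[i|[]]|[]] //; exists tt.
- exists (Split cempty (cconst 1 s) cempty).
  exists (@wtuple _ _ S (Split cempty (cconst 1 s) cempty)
    (env_empty _) (fun _ => a) (env_empty _)).
  exists (fun _ x => x (inl (inr ord0))); split.
    move=> j _; split=> //.
    exact: (@tmf_var _ N (hv (Split cempty (cconst 1 s) cempty)) (inl (inr ord0))).
  by move=> _ [[[]|i]|[]] //; exists tt.
exists (Split cempty cempty (cconst 1 s)).
exists (@wtuple _ _ S (Split cempty cempty (cconst 1 s))
  (env_empty _) (env_empty _) (fun _ => a)).
exists (fun _ x => x (inr ord0)); split.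
  move=> j _; split=> //.
  exact: (@tmf_var _ N (hv (Split cempty cempty (cconst 1 s))) (inr ord0)).
by move=> _ [[[]|[]]|i] //; exists tt.
Qed.

Lemma represented_any J s (v : forall j : J, N (s j)) l : represented v l.
Proof.
apply: represented_all => j; case: (s j) (v j) => [s'|E] x.
  exact: represented_home.
have [m mE] := qclass_surj x.
have [l' l'P] := listable_shape (eq_ctx E).
have [P [e [F [HF _]]]] := @represented_all (eq_ctx E) (fun j => home M (srt j)) m l'
  (fun j => represented_home (m j)).
exists P, e, (fun _ h => qclass (@eq_rel _ _ E) (fun j => F j h)); split.
  move=> _ _; split.
    apply: (@tmf_app _ N (hv P) (eproj E) F) => i.
    by have [] := HF i (l'P i).
  rewrite -mE; congr qclass; apply: functional_extensionality_dep => i.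
  by have [] := HF i (l'P i).
by move=> /(_ tt)[s' [a]] /(congr1 (@projT1 _ _)).
Qed.

Lemma representation (J : Type) s (v : forall j : J, N (s j)) : listable J ->
  exists (P : split S) (e : env M (sv P)) (F : forall j, env N (hv P) -> N (s j)),
    [/\ forall j, tmf (F j), forall j, F j e = v j
      & (forall j, is_home (v j)) -> forall i, exists j, home_elt (e i) = in_elt (v j)].
Proof.
move=> [l lP]; have [P [e [F [HF Hh]]]] := represented_any v l.
by exists P, e, F; split=> // j; have [] := HF j (lP j).
Qed.

Definition homes (D : set (elt N)) : set (elt N) := partA D `|` partB D `|` partC D.

Lemma homesP D x : homes D x <-> D x /\ exists s (a : M s), x = home_elt a.
Proof.
split=> [[[]|] [Dx [s [a xE]]]|[Dx [[s|s|s] [a xE]]]].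
- by split=> //; exists (inA s), a.
- by split=> //; exists (inB S s), a.
- by split=> //; exists (inC s), a.
- by left; left; split=> //; exists s, a.
- by left; right; split=> //; exists s, a.
- by right; split=> //; exists s, a.
Qed.

(** [defover_dcl] already gives home parameters, but in arbitrary order. [representation] sorts them
    into the three families, and its last clause keeps the sorted tuple in [D]. *)
Lemma defover_homes D G (V : set (env N G)) : defover (dcl (homes D)) V ->
  exists (P : split S) (e : env M (sv P)) (W : set (env N (csum G (hv P)))),
    [/\ @params_in _ N D (hv P) e, dfn W
      & forall x, V x <-> W (env_cat (H := hv P) x e)].
Proof.
move=> /defover_dcl/defoverP[R [Y [r [Dr dY VE]]]].
have [P [e [F [dF FE Hh]]]] := representation r (listable_shape R).
have {}Hh : forall i, exists j, home_elt (e i) = in_elt (r j).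
  by apply: Hh => j; have /homesP[_] := Dr j.
pose T := csum G (hv P).
pose K (x : csum G R) : env N T -> N (srt x) :=
  match x return env N T -> N (srt (c := csum G R) x) with
  | inl i => fun z => z (inl i) | inr j => fun z => F j (fun k => z (inr k)) end.
have dK x : tmf (K x).
  case: x => i; first exact: (@tmf_var _ N T (inl i)).
  exact: (@tmf_inr _ N G (hv P) _ _ (dF i)).
exists P, e, [set z | Y (fun x => K x z)]; split.
- move=> i; have [j Ej] := Hh i; have /homesP[+ _] := Dr j.
  by rewrite -Ej.
- exact: dfn_subst.
move=> x; rewrite VE /= (_ : (fun y => K y _) = env_cat x r) //.
by apply: functional_extensionality_dep => -[i|j] //=; rewrite -FE.
Qed.

Lemma dfn_jn P Q (X : set (env M (sv (scat P Q)))) :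
  dfn X <-> @dfn _ N (csum (hv P) (hv Q))
    (fun e => X (jn (fun i : sv P => e (inl i)) (fun i : sv Q => e (inr i)))).
Proof.
split=> [dX|dX].
  apply: (@dfn_subst _ N (hv (scat P Q)) (csum (hv P) (hv Q)) X
    (fun i e => jn (fun i : sv P => e (inl i)) (fun i : sv Q => e (inr i)) i)).
    exact: dfn_meq.
  move=> [[[i|i]|[i|i]]|[i|i]].
  - exact: (@tmf_var _ N (csum (hv P) (hv Q)) (inl (inl (inl i)))).
  - exact: (@tmf_var _ N (csum (hv P) (hv Q)) (inr (inl (inl i)))).
  - exact: (@tmf_var _ N (csum (hv P) (hv Q)) (inl (inl (inr i)))).
  - exact: (@tmf_var _ N (csum (hv P) (hv Q)) (inr (inl (inr i)))).
  - exact: (@tmf_var _ N (csum (hv P) (hv Q)) (inl (inr i))).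
  - exact: (@tmf_var _ N (csum (hv P) (hv Q)) (inr (inr i))).
apply: dfn_home.
pose K (x : csum (hv P) (hv Q)) : env N (hv (scat P Q)) -> N (srt x) :=
  match x return env N (hv (scat P Q)) -> N (srt (c := csum (hv P) (hv Q)) x) with
  | inl i => fun z => pr1 z i | inr i => fun z => pr2 z i end.
have dK x : tmf (K x).
  case: x => i; first exact: (tmf_meq (@tmf_pr1 _ _ S P Q i)).
  exact: (tmf_meq (@tmf_pr2 _ _ S P Q i)).
by have := dfn_subst dX dK; apply: dfn_iff => z /=; rewrite jn_pr.
Qed.

End Imaginaries.

(** * Saturation over imaginary parameters *)

Section Saturation.
Context {L : language} {Phi : pp_family L} (S : pure_sequence Phi).

Notation M := (seqM S).
Notation N := (Meq (seqM S)).

Local Open Scope card_scope.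

(* Infinitely many sorts of M^eq come from empty contexts; the only element of such a
   sort is definable, which makes every dcl-closed set infinite. *)
Definition trivial_ctx (n : nat) : ctx (lsort (langM S)) :=
  @Ctx _ (sh_prod (sh_ord 0) (sh_ord n)) (fun x => False_rect _ (notF (ltn_ord x.1))).

Lemma trivial_definable n :
  exists phi : formula (csum (trivial_ctx n) (trivial_ctx n)),
    forall a b : env M (trivial_ctx n), True <-> sat phi (env_cat a b).
Proof. by exists (ftrue _). Qed.

Lemma trivial_equivalence n :
  Equivalence (fun _ _ : env M (trivial_ctx n) => True).
Proof. by []. Qed.

Definition trivial_equiv n : def_equiv M :=
  DefEquiv (trivial_definable n) (trivial_equivalence n).

Definition trivial_elt n : elt N :=
  imag_elt (E := trivial_equiv n) (qclass _ (fun x : 'I_0 * 'I_n =>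
    False_rect _ (notF (ltn_ord x.1)))).

Lemma dcl_trivial_elt D n : dcl D (trivial_elt n).
Proof.
apply: (@dcl_def _ N D _ _ setT); first exact/dfn_defover/dfnT.
move=> b; split=> // _; have [m <-] := qclass_surj b.
exact/(qclass_eq _ _ (trivial_equivalence n)).
Qed.

(** Reads n off the sort of [trivial_elt n], which shows that these elements are pairwise
    distinct. *)
Definition trivial_index (x : elt N) : nat :=
  match projT1 x with
  | home _ => 0
  | imag E => match idx (eq_ctx E) with sh_prod _ (sh_ord n) => n | _ => 0 end
  end.

Definition unhome (x : elt N) : option (elt M) :=
  match x with
  | existT s a => match s return N s -> option (elt M) with
                  | home s => fun a => Some (@in_elt _ M s a) | imag _ => fun _ => None end a
  end.

(** Home elements of [D] are sent to themselves and the finitely many others to distinct trivial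
    elements. Those lie in [D] and cannot collide with home elements, as their sorts are
    imaginary. *)
Lemma card_le_add_finite (D : set (elt N)) (Q : ctx (lsort (langM S))) (c : env M Q) :
  D = dcl D ->
  [set z : elt M | D (home_elt (projT2 z)) \/ exists i, z = in_elt (c i)] #<= D.
Proof.
move=> HD; set D0 := [set z | _].
have [n [h hP]] := listable_surj (listable_shape Q).
have /depfun_choice[k kP] (z : elt M) : exists k : nat,
    (exists i, z = in_elt (c i)) -> exists lk : (k < n)%N, z = in_elt (c (h (Ordinal lk))).
  have [[i zi]|nz] := pselect (exists i, z = in_elt (c i)); last by exists 0.
  have [[k lk] kP] := hP i; exists k => _; exists lk.
  by rewrite (_ : h _ = i) // -kP; congr h; apply: val_inj.
pose f (z : elt M) : elt N :=
  if pselect (D (home_elt (projT2 z))) then home_elt (projT2 z) else trivial_elt (k z).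
suff [g] : $|{injfun D0 >-> D}| by exact: inj_card_le g.
apply/injfunPex; exists f.
  move=> z _; rewrite /f; case: pselect => //= _.
  by rewrite HD; exact: dcl_trivial_elt.
move=> z z' /set_mem Dz /set_mem Dz'; rewrite /f.
case: pselect => nz; case: pselect => nz' /=.
- by case: z z' {Dz Dz' nz nz'} => s a [s' a'] /(congr1 unhome)[].
- by move=> /(congr1 unhome).
- by move=> /(congr1 unhome).
move=> /(congr1 trivial_index); rewrite /trivial_index /= => kk.
have [//|/kP[lk ->]] := Dz; have [//|/kP[lk' ->]] := Dz'.
congr (in_elt (c (h _))); exact: val_inj.
Qed.

(** Each formula is rewritten with home parameters of [Delta], and then as a formula of M because
    all its variables have home sorts. The type obtained is over the home elements of [Delta] and
    [c], a set that is no larger than [Delta]. *)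
Lemma meq_realizes (Gamma Delta : set (elt N)) (H Q : ctx (lsort (langM S))) :
  Delta = dcl Delta -> Gamma `<=` dcl (homes Delta) ->
  succ_saturated M Delta ->
  @realizes _ N Gamma (cmap (@home _ M) H) (cmap (@home _ M) Q).
Proof.
move=> HD HG Hsat c p pG pfin.
pose D0 := [set z : elt M | Delta (home_elt (projT2 z)) \/
  exists i, z = in_elt (c i : M (srt (c := Q) i))].
pose hH := cmap (@home _ M) H; pose hQ := cmap (@home _ M) Q.
pose cat (y : env M H) : env N (csum hH hQ) := @env_cat _ N hH hQ y c.
have cD0 : D0 #<= Delta by exact: card_le_add_finite.
have par V : p V -> exists theta : pformula M H,
    over D0 theta /\ forall y, solutions theta y <-> V (cat y).
  move=> /pG/(defoverS HG)/defover_homes[P [r [W [Dr dW VE]]]].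
  pose T : ctx (lsort (langM S)) := csum H (csum Q (sv P)).
  pose K (x : csum (csum hH hQ) (hv P)) : env N (cmap (@home _ M) T) -> N (srt x) :=
    match x return env N (cmap (@home _ M) T) ->
                   N (srt (c := csum (csum hH hQ) (hv P)) x) with
    | inl (inl i) => fun e => e (inl i)
    | inl (inr i) => fun e => e (inr (inl i))
    | inr i => fun e => e (inr (inr i)) end.
  have dK x : tmf (K x).
    case: x => [[i|i]|i].
    - exact: (@tmf_var _ N (cmap (@home _ M) T) (inl i)).
    - exact: (@tmf_var _ N (cmap (@home _ M) T) (inr (inl i))).
    - exact: (@tmf_var _ N (cmap (@home _ M) T) (inr (inr i))).
  have [phi phiP] := dfn_home (dfn_subst dW dK).
  exists (PFormula (pctx := csum Q (sv P)) phi (env_cat (M := M) c r)); split.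
    by move=> [i|i]; [right; exists i|left; exact: (Dr i)].
  move=> y; rewrite /solutions /= phiP /= VE.
  rewrite (_ : (fun i => K i _) = env_cat (H := hv P) (cat y) r) //.
  by apply: functional_extensionality_dep => -[[]|].
have [] := Hsat D0 cD0 H [set theta | over D0 theta /\ exists V, p V /\
    forall y, solutions theta y <-> V (cat y)].
- by move=> theta [].
- move=> n theta Hth.
  have /depfun_choice[V VP] i := (Hth i).2.
  have [y yV] := pfin n V (fun i => (VP i).1).
  by exists y => i; apply/(VP i).2/yV.
move=> y Hy; exists y => V pV; have [theta [oth thE]] := par V pV.
by apply/thE/Hy; split=> //; exists V.
Qed.

End Saturation.

(** * Dividing *)

Lemma indiscernible_defover L (N : structure L) (D : set (elt N)) P
    (b : nat -> env N P) k (W : set (env N (crep k P))) (i j : 'I_k -> nat) :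
  indiscernible D b -> defover D W ->
  {homo i : x y / (x < y)%N} -> {homo j : x y / (x < y)%N} ->
  W (fun x => b (i x.1) x.2) -> W (fun x => b (j x.1) x.2).
Proof.
move=> ib [[Q phi c] [Dc ->]] ih jh.
by have := ib k Q phi c i j Dc ih jh; rewrite /solutions /= => ->.
Qed.

Lemma indiscernible_type L (N : structure L) (D : set (elt N)) P
    (b : nat -> env N P) (Z : set (env N P)) i j :
  indiscernible D b -> defover D Z -> Z (b i) -> Z (b j).
Proof.
move=> ib DZ.
pose K (x : P) : env N (crep 1 P) -> N (srt x) := fun e => e (ord0, x).
have dK x : tmf (K x) by exact: (@tmf_var _ N (crep 1 P) (ord0, x)).
apply: (indiscernible_defover (i := fun _ => i) (j := fun _ => j) ib
  (defover_subst DZ dK)) => x y; by rewrite !ord1.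
Qed.

Section Atoms.
Context {L : language} (N : structure L) (D : set (elt N)).
Context (G Q : ctx (lsort L)) (e : env N Q) (I : Type).
Context (R : I -> set (env N (csum G Q))).

(* The formula over [e] describing which of the [R i] hold at [x] does not divide. *)
Definition nondividing (x : env N G) : Prop :=
  forall b : nat -> env N Q, b 0%N = e -> indiscernible D b ->
  forall n, exists y, forall k, (k < n)%N -> forall i,
    R i (env_cat y (b k)) <-> R i (env_cat x e).

(** If every point of the [Y j] had a dividing atom over [e], then [p] would imply the disjunction
    of the dividing atoms, which is finite. *)
Lemma nonforking_nondividing (p : ptype N G) (J : Type) (Y : J -> set (env N G)) :
  listable I -> (forall i, dfn (R i)) -> ~ ptype_forks D p ->
  listable J -> (forall j, p (Y j)) ->
  exists x, (forall j, Y j x) /\ nondividing x.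
Proof.
move=> lI dR pf lJ pY; apply: contrapT => nex; apply: pf.
have dAt (f : I -> bool) :
    dfn [set z : env N (csum G Q) | forall i, R i z <-> f i = true].
  apply: dfn_forall => // i; case: (f i).
    by apply: dfn_iff (dR i) => z; split=> [Rz|[_ Rz]]; [split|exact: Rz].
  by apply: dfn_iff (dfnC (dR i)) => z; split=> [nRz|[Rz _] /Rz //]; split=> // /nRz.
(* Every pattern f needs a dividing formula. A pattern that does not divide is replaced by falsity,
   which divides along the constant sequence. *)
have /depfun_choice[phi phiP] (f : I -> bool) : exists phi : formula (csum G Q),
    divides D (PFormula phi e) /\
    (divides D (PFormula (projT1 (cid (dAt f))) e) ->
     forall z, (forall i, R i z <-> f i = true) -> sat phi z).
  have [df|ndf] := pselect (divides D (PFormula (projT1 (cid (dAt f))) e)).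
    exists (projT1 (cid (dAt f))); split=> // _ z Hz.
    by case: (cid (dAt f)) => phi phiP /=; apply/phiP.
  exists (fnot (ftrue _)); split=> // /=.
  exists (fun _ => e); split=> //; exists 1 => -[x /(_ 0 isT)]; exact.
have [n [h hP]] := listable_surj (listable_bool_fun lI).
have dTh : dfn [set z : env N (csum G Q) | exists k : 'I_n, sat (phi (h k)) z].
  apply: dfn_exists; first exact: (@listable_finite 'I_n).
  by move=> k; exists (phi (h k)).
have [th thP] := dTh.
exists (PFormula th e); split; last first.
  exists n, (fun k => PFormula (phi (h k)) e); split=> [k|x /thP //].
  by have [] := phiP (h k).
have [m [g gP]] := listable_surj lJ.
exists m, (Y \o g); split=> [i|x Yx]; first exact: pY.
have {}Yx j : Y j x by have [k <-] := gP j; exact: Yx.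
apply/thP; pose f i := `[< R i (env_cat x e) >].
have fP i : R i (env_cat x e) <-> f i = true.
  by split=> [?|/asboolP//]; exact/asboolP.
have [k kf] := hP f; exists k; rewrite kf; apply: (phiP f).2 => //.
have /existsNP[b] : ~ nondividing x by move=> ndx; apply: nex; exists x.
move=> /not_implyP[b0 /not_implyP[ib /existsNP[n' nex']]].
exists b; split=> //; exists n' => -[y Hy]; apply: nex'; exists y => i ik j.
have := Hy i ik; case: (cid (dAt f)) => psi psiP /= /psiP/(_ j) ->.
by rewrite fP.
Qed.

End Atoms.

(** * Indiscernible sequences of tuples of M over imaginary parameters *)

Section IndiscernibleSequences.
Context {L : language} {Phi : pp_family L} (S : pure_sequence Phi).

Notation M := (seqM S).
Notation N := (Meq (seqM S)).
Notation hc P := (cmap (@home _ M) P).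

Context (Gamma : set (elt N)).
Hypothesis (real : forall H Q : ctx (lsort (langM S)),
  @realizes _ N Gamma (hc H) (hc Q)).

Lemma indiscernible_extraction (P : ctx (lsort (langM S)))
    (e : env N (hc P)) (f : nat -> env N (hc P)) :
  (forall i Z, defover Gamma Z -> Z e -> Z (f i)) ->
  exists b : nat -> env N (hc P),
    [/\ b 0%N = e, indiscernible Gamma b
      & forall m (W : set (env N (crep m (hc P)))), defover Gamma W ->
          (forall i : nat -> nat, {homo i : x y / (x < y)%N} -> W (block (f \o i))) ->
          W (block b)].
Proof.
have [U [UU UN]] := ultraFilterLemma eventually_filter.
by apply: (@extraction U UU UN) => k; exact: (@real P (crep k P)).
Qed.

(** The type of [e] over [Gamma] is closed under finite intersections, so finite satisfiability
    together with [W] has to be checked for one [Z] at a time. *)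
Lemma realize_type (P Q : ctx (lsort (langM S))) (e : env N (hc P))
    (c : env N (hc Q)) (W : set (env N (csum (hc P) (hc Q)))) :
  defover Gamma W ->
  (forall Z, defover Gamma Z -> Z e -> exists y, Z y /\ W (env_cat y c)) ->
  exists y, (forall Z, defover Gamma Z -> Z e -> Z y) /\ W (env_cat y c).
Proof.
move=> DW HW.
pose inlZ (Z : set (env N (hc P))) : set (env N (csum (hc P) (hc Q))) :=
  [set z | Z (fun i => z (inl i))].
have DinlZ Z : defover Gamma Z -> defover Gamma (inlZ Z).
  exact: defover_inl.
have [] := @real P Q c [set V | exists Z, [/\ defover Gamma Z, Z e & V = inlZ Z `&` W]].
- by move=> _ [Z [DZ _ ->]]; apply: defoverI => //; exact: DinlZ.
- move=> n V /depfun_choice[Z HZ].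
  have DZ : defover Gamma [set y | forall i, Z i y].
    by apply: defover_forall => [|i]; [exact: (@listable_finite 'I_n)|have [] := HZ i].
  have [] := HW _ DZ; first by move=> i; have [] := HZ i.
  by move=> y [Zy Wy]; exists y => i; have [_ _ ->] := HZ i; split=> //; exact: Zy.
move=> y Hy; exists y; split=> [Z DZ Ze|].
  by have [] := Hy (inlZ Z `&` W); first by exists Z.
have DT : defover Gamma (@setT (env N (hc P))) by exact/dfn_defover/dfnT.
by have [] := Hy (inlZ setT `&` W); first by exists setT.
Qed.

(** The type of [e] has realizations with pairwise distinct values of [X]; extraction preserves the
    distinctness of two terms. *)
Lemma nonalgebraic_sequence (P : ctx (lsort (langM S))) (e : env N (hc P)) s
    (X : env N (hc P) -> N s) : tmf X -> ~ acl Gamma (in_elt (X e)) ->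
  exists b : nat -> env N (hc P),
    [/\ b 0%N = e, indiscernible Gamma b & X (b 0%N) <> X (b 1%N)].
Proof.
move=> dX nacl.
have next (l : seq (env N (hc P))) : exists y,
    (forall Z, defover Gamma Z -> Z e -> Z y) /\
    (forall x, List.In x l -> X y <> X x).
  pose n := size l; pose c : env N (hc (crep n P)) := fun x => nth e l x.1 x.2.
  pose T := csum (hc P) (hc (crep n P)).
  pose W : set (env N T) :=
    [set z | forall k : 'I_n, X (fun i => z (inl i)) <> X (fun i => z (inr (k, i)))].
  have dW : dfn W.
    apply: dfn_forall => [|k]; first exact: (@listable_finite 'I_n).
    apply: dfnC; apply: dfn_eq; first exact: tmf_inl.
    apply: (@tmf_subst _ N (hc P) T s X (fun i z => z (inr (k, i)))) => // i.
    exact: (@tmf_var _ N T (inr (k, i))).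
  have [] := realize_type (e := e) (c := c) (dfn_defover Gamma dW).
    (* Otherwise the image X(Z), definable over [Gamma], would be contained in the finite set of old
       values, and it contains X(e). *)
    move=> Z DZ Ze; apply: contrapT => nex; apply: nacl.
    pose H1 : ctx (lsort (eq_language M)) := cconst 1 s.
    have DY : defover Gamma [set z : env N H1 | exists y, Z y /\ X y = z ord0].
      have D1 : defover Gamma [set z : env N (csum H1 (hc P)) |
          Z (fun i => z (inr i)) /\ X (fun i => z (inr i)) = z (inl ord0)].
        apply: defoverI; first exact: defover_inr.
        apply/dfn_defover/dfn_eq; first exact: tmf_inr.
        exact: (@tmf_var _ N (csum H1 (hc P)) (inl ord0)).
      exact: (defover_ex D1).
    apply: (acl_def DY); first by exists e.
    apply: (@sub_finite_set _ _ ((fun k : 'I_n => X (fun i => c (k, i))) @` setT)).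
      move=> x [y [Zy xE]]; apply: contrapT => nk; apply: nex; exists y; split=> // k Xk.
      by apply: nk; exists k => //; rewrite -[x]/(env1 x ord0) -xE Xk.
    exact/finite_image/finite_finset.
  move=> y [Hy Wy]; exists y; split=> // x.
  move=> /(list_In_nth e)[k lk xE] Xk.
  apply: (Wy (Ordinal lk)); rewrite Xk; congr X.
  by rewrite -xE.
pose fix l k : seq (env N (hc P)) :=
  if k is k'.+1 then projT1 (cid (next (l k'))) :: l k' else [::].
pose f k := projT1 (cid (next (l k))).
have fP k : (forall Z, defover Gamma Z -> Z e -> Z (f k)) /\
    (forall x, List.In x (l k) -> X (f k) <> X x).
  exact: (projT2 (cid (next (l k)))).
have fl i j : (i < j)%N -> List.In (f i) (l j).
  elim: j => [//|j IH]; rewrite ltnS leq_eqVlt => /orP[/eqP ->|/IH]; first by left.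
  by right.
have [b [b0 ib bW]] := indiscernible_extraction (fun i => (fP i).1).
exists b; split=> //.
pose T := crep 2 (hc P).
pose W : set (env N T) :=
  [set z | X (fun i => z (ord0, i)) <> X (fun i => z (ord_max, i))].
have dW : dfn W.
  apply: dfnC; apply: dfn_eq.
    apply: (@tmf_subst _ N (hc P) T s X (fun i z => z (ord0, i))) => // i.
    exact: (@tmf_var _ N T (ord0, i)).
  apply: (@tmf_subst _ N (hc P) T s X (fun i z => z (ord_max, i))) => // i.
  exact: (@tmf_var _ N T (ord_max, i)).
apply: (bW 2 W (dfn_defover Gamma dW)) => i ih.
have := (fP (i 1%N)).2 (f (i 0%N)) (fl _ _ (ih 0%N 1%N isT)).
by move=> Hn Hx; apply: Hn; exact: (esym Hx).
Qed.

(** All terms d_k have the same type over [Gamma] as d_0 = F(e), so each has a preimage under [F]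
    that realizes the type of [e]. The preimages need not be indiscernible; a sequence extracted
    from them, starting at [e], is, and it inherits inconsistency. *)
Lemma divides_lift (P : ctx (lsort (langM S))) (G : ctx (lsort (eq_language M)))
    (eta : pformula N G) (e : env N (hc P))
    (F : forall j : pctx eta, env N (hc P) -> N (srt j)) :
  (forall j, tmf (F j)) -> (forall j, F j e = @pval _ _ _ eta j) ->
  divides Gamma eta ->
  exists b : nat -> env N (hc P),
    [/\ b 0%N = e, indiscernible Gamma b
      & exists n, ~ exists x : env N G, forall i, (i < n)%N ->
          sat (pform eta) (env_cat x (fun j => F j (b i)))].
Proof.
move=> dF FE [d [d0 id [n nd]]].
have {}FE : (fun j => F j e) = d 0%N.
  by rewrite d0; apply: functional_extensionality_dep => j; exact: FE.
pose Fe (y : env N (hc P)) : env N (pctx eta) := fun j => F j y.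
have lift_type Z k : defover Gamma Z -> Z e -> exists y, Z y /\ Fe y = d k.
  move=> DZ Ze.
  pose T := csum (pctx eta) (hc P).
  have DW : defover Gamma [set z : env N T | Z (fun i => z (inr i)) /\
      forall j, F j (fun i => z (inr i)) = z (inl j)].
    apply: defoverI; first exact: defover_inr.
    apply/dfn_defover/dfn_forall => [|j]; first exact: listable_shape.
    apply: dfn_eq; first exact: tmf_inr.
    exact: (@tmf_var _ N T (inl j)).
  have [|y [Zy Fy]] := @indiscernible_type _ N Gamma _ d _ 0%N k id (defover_ex DW).
    by exists e; split=> // j; exact: (congr1 (fun g : env N (pctx eta) => g j) FE).
  by exists y; split=> //; apply: functional_extensionality_dep => j; exact: Fy.
have /depfun_choice[f fP] k : exists y,
    (forall Z, defover Gamma Z -> Z e -> Z y) /\ Fe y = d k.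
  (* [realize_type] accepts only home tuples as extra parameters, and d_k may be imaginary. It is
     therefore named as F(c) for some preimage [c], without any condition on the type of [c]. *)
  have [c [_ cE]] := lift_type setT k (dfn_defover Gamma (dfnT _ _)) I.
  pose T := csum (hc P) (hc P).
  have dW : dfn [set z : env N T |
      forall j, F j (fun i => z (inl i)) = F j (fun i => z (inr i))].
    apply: dfn_forall => [|j]; first exact: listable_shape.
    by apply: dfn_eq; [exact: tmf_inl|exact: tmf_inr].
  have [] := realize_type (e := e) (c := c) (dfn_defover Gamma dW).
    move=> Z DZ Ze; have [y [Zy yE]] := lift_type Z k DZ Ze.
    exists y; split=> // j /=.
    by have := congr1 (fun g : env N (pctx eta) => g j) (etrans yE (esym cE)).
  move=> y [Hy Wy]; exists y; split=> //; rewrite -cE.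
  by apply: functional_extensionality_dep => j; exact: (Wy j).
have [b [b0 ib bW]] := indiscernible_extraction (fun i => (fP i).1).
exists b; split=> //; exists n.
(* With [K] the identity it speaks of terms of [d], with [K] equal to [Fe] of their lifts. *)
pose consistent (P' : ctx (lsort (eq_language M)))
    (K : env N P' -> env N (pctx eta)) : set (env N (crep n P')) :=
  [set z | exists x : env N G, forall l : 'I_n,
     sat (pform eta) (env_cat x (K (fun p => z (l, p))))].
have dcons P' K : (forall j, tmf (fun z => K z j)) -> dfn (@consistent P' K).
  move=> dK; pose T := csum (crep n P') G.
  have dl (l : 'I_n) : dfn [set z : env N T | sat (pform eta)
      (env_cat (fun i => z (inr i)) (K (fun p => z (inl (l, p)))))].
    have dphi : dfn [set z : env N (csum G (pctx eta)) | sat (pform eta) z].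
      by exists (pform eta).
    pose J (x : csum G (pctx eta)) : env N T -> N (srt x) :=
      match x return env N T -> N (srt (c := csum G (pctx eta)) x) with
      | inl i => fun z => z (inr i)
      | inr j => fun z => K (fun p => z (inl (l, p))) j end.
    have dJ x : tmf (J x).
      case: x => j; first exact: (@tmf_var _ N T (inr j)).
      apply: (@tmf_subst _ N P' T _ (fun y => K y j) (fun p z => z (inl (l, p)))) => // p.
      exact: (@tmf_var _ N T (inl (l, p))).
    have := dfn_subst dphi dJ; apply: dfn_iff => z /=.
    rewrite (_ : (fun i => J i z) =
      env_cat (fun i => z (inr i)) (K (fun p => z (inl (l, p))))) //.
    by apply: functional_extensionality_dep => -[].
  by have := dfn_ex (dfn_forall (@listable_finite 'I_n) dl); apply: dfn_iff.
(* Only n terms with increasing indices matter. If some such subfamily of [d] were consistent,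
   indiscernibility would make the first n terms consistent as well. *)
have nW : (~` consistent _ Fe) (block b).
  apply: (bW n _ (dfn_defover Gamma (dfnC (dcons _ _ dF)))) => i ih [x Hx].
  have Did : defover Gamma (consistent _ (fun y : env N (pctx eta) => y)).
    by apply/dfn_defover/dcons => j; exact: tmf_var.
  apply: nd; have [] := @indiscernible_defover _ N Gamma _ d n _
    (fun l : 'I_n => i l) (fun l => l) id Did.
  - by move=> l l' ll'; exact: ih.
  - by [].
  - exists x => l; rewrite -[sat _ _]/(sat (pform eta) (env_cat x (d (i l)))).
    by rewrite -(fP (i l)).2; exact: (Hx l).
  by move=> x' Hx'; exists x' => l ln; exact: (Hx' (Ordinal ln)).
move=> [x Hx]; apply: nW; exists x => l; exact: (Hx l).
Qed.

End IndiscernibleSequences.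

(** * A-formulas and C-formulas *)

Section TermSplitting.
Context {L : language} {Phi : pp_family L}.
Notation GL := (glanguage L).

(** Additivity, with each block of variables set to 0 in turn. The sign is chosen so that the result
    is a difference, as in A-formulas and in the comparison of cosets. *)
Lemma term_split (G H : ctx (lsort GL)) s (t : term (csum G H) s) :
  exists (t1 : term G s) (t2 : term H s), forall (A : group_structure L), abelian A ->
  forall (b : env A G) (e : env A H),
    eval (env_cat b e) t = (eval b t1 - eval e t2 :> gcarrier A s)%R.
Proof.
pose g1 (x : csum G H) : term G (srt x) :=
  match x return term G (srt (c := csum G H) x) with
  | inl i => tvar i | inr j => tzero G (srt j) end.
pose g2 (x : csum G H) : term H (srt x) :=
  match x return term H (srt (c := csum G H) x) with
  | inl i => tzero H (srt i) | inr j => tvar j end.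
exists (tsubst g1 t), (@tapp GL H (@gopp L s) (fun _ => tsubst g2 t)) => A HA b e.
rewrite /= !eval_tsubst opprK -(eval_add HA) (_ : env_add _ _ = env_cat b e) //.
apply: functional_extensionality_dep => -[i|j]; rewrite /env_add /=.
  exact: addr0.
exact: add0r.
Qed.

Lemma tuple_split (phi : Phi) (G H : ctx (lsort GL)) (t : term_tuple phi (csum G H)) :
  exists (t1 : term_tuple phi G) (t2 : term_tuple phi H),
  forall (A : group_structure L), abelian A -> forall (b : env A G) (e : env A H),
    eval_tuple t (env_cat b e) = env_sub (eval_tuple t1 b) (eval_tuple t2 e).
Proof.
have /depfun_choice[t1 /depfun_choice[t2 tE]] := fun j => term_split (t j).
exists t1, t2 => A HA b e; apply: functional_extensionality_dep => j.
exact: tE.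
Qed.

End TermSplitting.

Lemma dcl_term L (N : structure L) (D : set (elt N)) G s (F : env N G -> N s)
    (e : env N G) : tmf F -> params_in D e -> dcl D (in_elt (F e)).
Proof.
move=> dF De; pose H := cconst 1 s.
have dX : dfn [set z : env N (csum H G) | z (inl ord0) = F (fun i => z (inr i))].
  apply: dfn_eq; last exact: tmf_inr.
  exact: (@tmf_var _ N (csum H G) (inl ord0)).
exact: (dcl_def (defover_param De (dfn_defover D dX))).
Qed.

Section Formulas.
Context {L : language} {Phi : pp_family L} (S : pure_sequence Phi).

Notation M := (seqM S).
Notation N := (Meq (seqM S)).
Notation GL := (glanguage L).
Notation langB := (@langB L).
Notation hc P := (cmap (@home _ M) P).

Definition onA (P : split S) (A : env (Astar S) (pA P) -> env (Bstr S) (pB P) -> Prop) :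
    set (env M (sv P)) := [set z | A (wA z) (wB z)].
Definition onC (P : split S)
    (C : env (Cstar S) (cmap (sortC S) (pB P)) -> env (Cstar S) (pC P) -> Prop) :
    set (env M (sv P)) := [set z | C (nu_env (wB z)) (wC z)].

Lemma coset_eq (phi : Phi) (a b : env (grC S) (pp_ctx phi)) :
  coset (S := S) a = coset b <-> sat (pp_form phi) (env_sub b a).
Proof. exact: (qclass_eq _ _ (coset_equivalence S phi)). Qed.

Lemma tmf_nu_tuple (P : split S) (phi : Phi) (t : term_tuple phi (pB P)) (j : pp_ctx phi) :
  @tmf _ M (sv P) (inC (sortC S (srt j))) (fun x => nu (eval_tuple t (wB x) j)).
Proof.
apply: (@tmf_app _ M (sv P) (@fun_nu _ _ S (srt j)) (fun _ x => eval_tuple t (wB x) j)) => k0.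
apply: (@tmf_B _ _ S (sv P) _ _ (t j) (fun k e => wB e k)) => k.
exact: (@tmf_var _ M (sv P) (inl (inr k))).
Qed.

Lemma tmf_coset (P : split S) (phi : Phi) (t : term_tuple phi (pB P)) :
  @tmf _ N (hv P) (imag (coset_equiv S phi))
    (fun x => coset (S := S) (nu_env (S := S) (eval_tuple t (wB x)))).
Proof.
apply: (@tmf_app _ N (hv P) (eproj (coset_equiv S phi))
  (fun j x => nu (eval_tuple t (wB x) j))) => j.
exact: (tmf_meq (@tmf_nu_tuple P phi t j)).
Qed.

Lemma C_formula_not (GA : ctx (lsort (langA S))) GB (GC : ctx (lsort (langC S)))
    (D : set (elt N)) (X : set (env N (vars GA GB GC))) :
  C_formula D X -> C_formula D (~` X).
Proof.
move=> [Q [psi [gamma [Dg ->]]]]; exists Q, (fnot psi), gamma; split=> //.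
Qed.

Lemma C_formula_defover (GA : ctx (lsort (langA S))) GB (GC : ctx (lsort (langC S)))
    (D : set (elt N)) (X : set (env N (vars GA GB GC))) :
  C_formula D X -> defover D X.
Proof.
move=> [Q [psi [gamma [Dg ->]]]]; apply/defoverP.
pose P := Split GA GB GC; pose H := hc (cmap (@inC _ _ S) Q).
pose T := csum (hv P) H.
pose G := csum (csum (cmap (sortC S) GB) GC) Q.
have dpsi : dfn [set e : env (Cstar S) G | sat psi e] by exists psi.
pose K (x : hc (cmap (@inC _ _ S) G)) : env N T -> N (srt x) :=
  match x return env N T -> N (srt (c := hc (cmap (@inC _ _ S) G)) x) with
  | inl (inl i) => fun z => nu (z (inl (inl (inr i))))
  | inl (inr i) => fun z => z (inl (inr i))
  | inr i => fun z => z (inr i) end.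
have dK x : tmf (K x).
  case: x => [[i|i]|i].
  - apply: (@tmf_app _ N T (efunc M (@fun_nu _ _ S (srt (c := GB) i)))
      (fun _ z => z (inl (inl (inr i))))) => k0.
    exact: (@tmf_var _ N T (inl (inl (inr i)))).
  - exact: (@tmf_var _ N T (inl (inr i))).
  - exact: (@tmf_var _ N T (inr i)).
have := dfn_subst (dfn_meq (dfn_Cstar dpsi)) dK.
set Y := (X in dfn X) => dY; exists H, Y, gamma; split=> // [j|x]; first by have [] := Dg j.
rewrite /Y /= (_ : (fun i => K i _) = env_cat (M := Cstar S)
  (env_cat (M := Cstar S) (H := GC) (nu_env (xB x) : env (Cstar S) (cmap (sortC S) GB))
    (xC x)) gamma) //.
by apply: functional_extensionality_dep => -[[]|].
Qed.

End Formulas.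

Section FormulaSets.
Context {L : language} {Phi : pp_family L} (S : pure_sequence Phi).

Notation M := (seqM S).
Notation N := (Meq (seqM S)).
Notation GL := (glanguage L).
Notation langB := (@langB L).
Notation hc P := (cmap (@home _ M) P).

Lemma tmf_BN (T : ctx (lsort (eq_language M))) (G : ctx (lsort langB)) s (t : term G s)
    (F : forall i : G, env N T -> Bstr S (srt i)) :
  (forall i, @tmf _ N T (home M (inB S (srt i))) (F i)) ->
  @tmf _ N T (home M (inB S s)) (fun e => eval (M := Bstr S) (fun i => F i e) t).
Proof.
move=> HF; elim: t => [//|f ts IH] /=.
exact: (@tmf_app _ N T (efunc M (@funB _ _ S f))).
Qed.

Lemma tmf_rho_sub (T : ctx (lsort (eq_language M))) (phi : Phi)
    (F G : forall j : pp_ctx phi, env N T -> Bstr S (srt j)) :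
  (forall j, @tmf _ N T (home M (inB S (srt j))) (F j)) ->
  (forall j, @tmf _ N T (home M (inB S (srt j))) (G j)) ->
  @tmf _ N T (home M (inA (sortQ S phi)))
    (fun e => rho (@env_sub L (grB S) _ (fun j => F j e) (fun j => G j e))).
Proof.
move=> dF dG.
pose K (j : pp_ctx phi) (e : env N T) : Bstr S (srt j) :=
  (F j e - G j e : gcarrier (grB S) (srt j))%R.
suff dK : forall j, @tmf _ N T (home M (inB S (srt j))) (K j).
  exact: (@tmf_app _ N T (efunc M (@fun_rho _ _ S phi)) K).
move=> j.
pose V : ctx (lsort langB) := cconst 2 (srt (c := pp_ctx phi) j).
pose r : term V (srt j) := @tapp GL V (@gadd L (srt j)) (fun i : 'I_2 =>
  if i == ord0 then @tvar GL V ord0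
  else @tapp GL V (@gopp L (srt j)) (fun _ => @tvar GL V ord_max)).
apply: (@tmf_BN T V _ r (fun i : 'I_2 => if i == ord0 then F j else G j)) => i.
by case: ifP => _; [exact: dF|exact: dG].
Qed.

Lemma A_formula_defover (GA : ctx (lsort (langA S))) GB (GC : ctx (lsort (langC S)))
    (D : set (elt N)) (X : set (env N (vars GA GB GC))) :
  A_formula D X -> defover D X.
Proof.
move=> [PA [alpha [n [phi [t [beta [psi [Da Db ->]]]]]]]].
pose P := Split GA GB GC; pose HQ := hc (cmap (@inA _ _ S) (quot_ctx S phi)).
pose T := csum (hv P) HQ.
pose rhoi i (z : env N (hv P)) := rho (S := S) (@env_sub L (grB S) _
  (eval_tuple (t i) (xB (S := S) (GA := GA) (GC := GC) z)) (beta i)).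
have D1 : defover D [set z : env N T | forall i : 'I_n,
    rhoi i (fun k => z (inl k)) = z (inr i)].
  apply: defover_forall => [|i]; first exact: (@listable_finite 'I_n).
  pose HB := hc (cmap (@inB _ _ S) (pp_ctx (phi i))).
  have Dbi : @params_in _ N D HB (beta i) by move=> j; have [] := Db i j.
  pose TB := csum T HB.
  apply: (defover_param (X := [set z : env N TB | rho (S := S) (@env_sub L (grB S) _
    (eval_tuple (t i) (fun k => z (inl (inl (inl (inr k)))) : Bstr S (srt (c := GB) k)))
    (fun j => z (inr j) : Bstr S (srt j))) = z (inl (inr i))]) Dbi).
  apply: dfn_defover; apply: (@dfn_eq _ N TB (home M (inA (sortQ S (phi i))))); last first.
    exact: (@tmf_var _ N TB (inl (inr i))).
  apply: tmf_rho_sub => j; last exact: (@tmf_var _ N TB (inr j)).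
  apply: (@tmf_BN TB GB _ (t i j) (fun k z => z (inl (inl (inl (inr k)))))) => k.
  exact: (@tmf_var _ N TB (inl (inl (inl (inr k))))).
pose HA := hc (cmap (@inA _ _ S) PA).
have Da' : @params_in _ N D HA alpha by move=> j; have [] := Da j.
pose G := csum (csum PA GA) (quot_ctx S phi).
pose TA := csum T HA.
have dpsi : dfn [set e : env (Astar S) G | sat psi e] by exists psi.
pose K (x : hc (cmap (@inA _ _ S) G)) : env N TA -> N (srt x) :=
  match x return env N TA -> N (srt (c := hc (cmap (@inA _ _ S) G)) x) with
  | inl (inl i) => fun z => z (inr i)
  | inl (inr i) => fun z => z (inl (inl (inl (inl i))))
  | inr i => fun z => z (inl (inr i)) end.
have dK x : tmf (K x).
  case: x => [[i|i]|i].
  - exact: (@tmf_var _ N TA (inr i)).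
  - exact: (@tmf_var _ N TA (inl (inl (inl (inl i))))).
  - exact: (@tmf_var _ N TA (inl (inr i))).
have D2 := defover_param Da' (dfn_defover D (dfn_subst (dfn_meq (dfn_A dpsi)) dK)).
have := defover_ex (defoverI D1 D2); apply: defover_iff => x; rewrite /setI /=.
have eqK q : (fun i => K i (env_cat (env_cat (H := HQ) x q) (alpha : env N HA))) =
    env_cat (M := Astar S) (env_cat (M := Astar S) alpha (xA x)) q.
  by apply: functional_extensionality_dep => -[[]|].
split=> [[q [Hq]]|Hx].
  rewrite eqK (_ : q = fun i => rhoi i x) //.
  by apply: functional_extensionality_dep => i; exact/esym/Hq.
exists (fun i => rhoi i x); split; first by [].
by rewrite eqK.
Qed.

Lemma p0_defover (GA : ctx (lsort (langA S))) GB (GC : ctx (lsort (langC S)))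
    (D : set (elt N)) (u : env N (vars GA GB GC)) X :
  p0 u D X -> defover D X /\ X u.
Proof.
pose P := Split GA GB GC.
pose F (phi : Phi) (t : term_tuple phi GB) (x : env N (hv P)) :=
  coset (S := S) (nu_env (S := S) (eval_tuple t (xB (GA := GA) (GC := GC) x))).
have D1 (phi : Phi) (t : term_tuple phi GB) (c : quot (@eq_rel _ _ (coset_equiv S phi))) :
    D (imag_elt c) -> defover D [set x : env N (hv P) | F phi t x = c].
  move=> Dc; pose H1 : ctx (lsort (eq_language M)) := cconst 1 (imag (coset_equiv S phi)).
  have Dc' : @params_in _ N D H1 (fun _ => c) by [].
  apply: (defover_param (X := [set z : env N (csum (hv P) H1) |
    F phi t (fun i => z (inl i)) = z (inr ord0)]) Dc').
  apply: dfn_defover.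
  apply: (@dfn_eq _ N (csum (hv P) H1) (imag (coset_equiv S phi))); last first.
    exact: (@tmf_var _ N (csum (hv P) H1) (inr ord0)).
  exact: (tmf_inl H1 (@tmf_coset _ _ S P phi t)).
move=> [[phi [t [Dc ->]]]|[phi [t [c [nDc Dc ->]]]]]; last first.
  split; first exact: (defoverC (D1 phi t c Dc)).
  by move=> /= E; apply: nDc; rewrite /E0plus E.
have cosE x : F phi t x = F phi t u <->
    sat (M := grC S) (pp_form phi) (nu_env (S := S) (G := pp_ctx phi)
      (eval_tuple t (@env_sub L (grB S) GB (xB x) (xB u)))).
  rewrite eval_tuple_sub; last exact: abelianB.
  rewrite nu_env_sub coset_eq; split; apply: pp_subC; by [exact: abelianC|exact: pp_formP].
split; last exact/cosE.
by apply: defover_iff (D1 phi t _ Dc) => x; exact: cosE.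
Qed.

Definition nu_params (P0 : split S) (e0 : env M (sv P0)) :
    env (Cstar S) (csum (cmap (sortC S) (pB P0)) (pC P0)) :=
  env_cat (nu_env (wB e0) : env (Cstar S) (@cmap _ (lsort (langC S)) (sortC S) (pB P0)))
    (wC e0).

Lemma partC_nu_params (P0 : split S) (D : set (elt N)) (e0 : env M (sv P0)) :
  D = dcl D -> @params_in _ N D (hv P0) e0 ->
  forall j, partC D (home_elt (nu_params e0 j : M (inC (srt j)))).
Proof.
move=> HD De [i|i]; split.
- have dnu : @tmf _ N (hv P0) (home M (inC (sortC S (srt (c := pB P0) i))))
      (fun x => nu (wB x i)).
    apply: (@tmf_meq _ M (sv P0) (inC (sortC S (srt (c := pB P0) i)))
      (fun x => nu (wB x i))).
    apply: (@tmf_app _ M (sv P0) (@fun_nu _ _ S (srt (c := pB P0) i))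
      (fun _ x => wB x i)) => k.
    exact: (@tmf_var _ M (sv P0) (inl (inr i))).
  by rewrite HD; exact: (dcl_term dnu De).
- by exists (sortC S (srt (c := pB P0) i)), (nu (wB e0 i)).
- exact: (De (inr i)).
- by exists (srt i), (wC e0 i).
Qed.

Lemma Cset_C_formula (P P0 : split S) (D : set (elt N)) (e0 : env M (sv P0))
    (C : env (Cstar S) (cmap (sortC S) (pB (scat P P0))) ->
         env (Cstar S) (pC (scat P P0)) -> Prop) :
  D = dcl D -> @params_in _ N D (hv P0) e0 -> Cset C ->
  C_formula (S := S) (GA := pA P) (GB := pB P) (GC := pC P) D
    [set x : env M (sv P) | onC C (jn x e0)].
Proof.
move=> HD De dC; pose Q := csum (cmap (sortC S) (pB P0)) (pC P0).
pose G := csum (cmap (sortC S) (csum (pB P) (pB P0))) (csum (pC P) (pC P0)).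
pose T := csum (csum (cmap (sortC S) (pB P)) (pC P)) Q.
pose K (x : G) : env (Cstar S) T -> Cstar S (srt x) :=
  match x return env (Cstar S) T -> Cstar S (srt (c := G) x) with
  | inl (inl i) => fun z => z (inl (inl i))
  | inl (inr i) => fun z => z (inr (inl i))
  | inr (inl i) => fun z => z (inl (inr i))
  | inr (inr i) => fun z => z (inr (inr i)) end.
have dK x : tmf (K x).
  case: x => [[i|i]|[i|i]].
  - exact: (@tmf_var _ _ T (inl (inl i))).
  - exact: (@tmf_var _ _ T (inr (inl i))).
  - exact: (@tmf_var _ _ T (inl (inr i))).
  - exact: (@tmf_var _ _ T (inr (inr i))).
have [psi psiP] := dfn_subst dC dK.
exists Q, psi, (nu_params e0); split; first exact: partC_nu_params.
apply/seteqP; split=> x /=; rewrite psiP /onC /=.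
  congr C; apply: functional_extensionality_dep => -[] //.
by congr C; apply: functional_extensionality_dep => -[].
Qed.

End FormulaSets.

(** * Formulas over [Delta] as A-formulas and C-formulas *)

Section TypeSplitting.
Context {L : language} {Phi : pp_family L} (S : pure_sequence Phi).

Notation M := (seqM S).
Notation N := (Meq (seqM S)).
Notation langB := (@langB L).

(** With t(x, e0) = t1(x) - t2(e0), the tuples t2(e0) become the parameters beta of the A-formula;
    they lie in [D] because it is closed under dcl. *)
Lemma Aset_A_formula (P P0 : split S) (D : set (elt N)) (e0 : env M (sv P0))
    (A : env (Astar S) (pA (scat P P0)) -> env (Bstr S) (pB (scat P P0)) -> Prop) :
  D = dcl D -> @params_in _ N D (hv P0) e0 -> Aset A ->
  A_formula (S := S) (GA := pA P) (GB := pB P) (GC := pC P) D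
    [set x : env M (sv P) | onA A (jn x e0)].
Proof.
move=> HD De [I [phi [t [Y [dY AE]]]]].
have /depfun_choice[t1 /depfun_choice[t2 tE]] := fun i => tuple_split (t i).
have [n [h hP]] := listable_surj (listable_shape I).
have /depfun_choice[k kP] := hP.
pose phi' l := phi (h l).
pose G := csum (csum (pA P0) (pA P)) (quot_ctx S phi').
(* [A_formula] is indexed by an ordinal and [Aset] by a shape; [k] selects an ordinal for each i,
   and the cast moves its value along h (k i) = i. *)
pose castQ l i (E : h l = i) : env (Astar S) G -> Astar S (sortQ S (phi i)) :=
  match E in _ = j return env (Astar S) G -> Astar S (sortQ S (phi j)) with
  | erefl => fun e => e (inr l) end.
pose K (x : csum (csum (pA P) (pA P0)) (qctx S phi)) : env (Astar S) G -> Astar S (srt x) :=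
  match x return env (Astar S) G ->
                 Astar S (srt (c := csum (csum (pA P) (pA P0)) (qctx S phi)) x) with
  | inl (inl i) => fun e => e (inl (inr i))
  | inl (inr i) => fun e => e (inl (inl i))
  | inr i => castQ (k i) i (kP i) end.
have dK x : tmf (K x).
  case: x => [[i|i]|i].
  - exact: (@tmf_var _ _ G (inl (inr i))).
  - exact: (@tmf_var _ _ G (inl (inl i))).
  rewrite /K; move: (kP i); rewrite /castQ; move: (k i) => l; case: _ /.
  exact: (@tmf_var _ _ G (inr l)).
have [psi psiP] := dfn_subst dY dK.
exists (pA P0), (wA e0), n, phi', (fun l => t1 (h l)).
exists (fun l => eval_tuple (t2 (h l)) (wB e0)), psi; split.
- move=> j; split; first exact: (De (inl (inl j))).
  by exists (srt j), (wA e0 j).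
- move=> l j; split; last by exists (srt j), (eval_tuple (t2 (h l)) (wB e0) j).
  have dt : @tmf _ N (hv P0) (home M (inB S (srt j)))
      (fun x => eval_tuple (t2 (h l)) (wB (P := P0) x) j).
    apply: (@tmf_BN _ _ S (hv P0) (pB P0) _ (t2 (h l) j) (fun i x => wB (P := P0) x i)) => i.
    exact: (@tmf_var _ N (hv P0) (inl (inr i))).
  by rewrite HD; exact: (dcl_term dt De).
have KE (x : env M (sv P)) : (fun i => K i (env_cat (M := Astar S)
    (H := quot_ctx S phi') (env_cat (M := Astar S) (wA e0) (wA x))
    (fun l : 'I_n => rho (S := S) (@env_sub L (grB S) _ (eval_tuple (t1 (h l)) (wB x))
                (eval_tuple (t2 (h l)) (wB e0)))))) =
    env_cat (M := Astar S) (wA (jn x e0)) (rhos t (wB (jn x e0))).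
  apply: functional_extensionality_dep => -[[i|i]|i] //=.
  rewrite /rhos (tE _ _ (abelianB S)); move: (kP i).
  by move: (k i) => l; case: _ /.
apply/seteqP; split=> x; rewrite /= psiP /= /onA /= AE.
  by rewrite -KE.
by rewrite -KE.
Qed.

Lemma dfn_pr (P Q : split S) (W : set (env N (csum (hv P) (hv Q)))) : dfn W ->
  dfn [set z : env M (sv (scat P Q)) | W (@env_cat _ N (hv P) (hv Q) (pr1 z) (pr2 z))].
Proof.
move=> dW; apply/dfn_jn; apply: dfn_iff dW => e /=; rewrite pr1_jn pr2_jn.
by rewrite -{1}(env_catK (M := N) e).
Qed.

Hypothesis (HPhi : fundamental_system Phi (grB S)).

(** The formula, with parameters made home elements by (H2), splits into finitely many pieces, and
    the piece containing [u] is kept. Hence tp_A and tp_C together imply tp(u/D). *)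
Lemma type_splitting (P : split S) (D : set (elt N)) (Y : set (env M (sv P)))
    (u : env M (sv P)) :
  D = dcl (homes D) -> @defover _ N D (hv P) Y -> Y u ->
  exists (P0 : split S) (e0 : env M (sv P0))
    (A : env (Astar S) (pA (scat P P0)) -> env (Bstr S) (pB (scat P P0)) -> Prop)
    (C : env (Cstar S) (cmap (sortC S) (pB (scat P P0))) ->
         env (Cstar S) (pC (scat P P0)) -> Prop),
    [/\ @params_in _ N D (hv P0) e0, Aset A, Cset C,
        onA A (jn u e0) /\ onC C (jn u e0)
      & forall x, onA A (jn x e0) -> onC C (jn x e0) -> Y x].
Proof.
move=> HD; rewrite {1}HD => /defover_homes[P0 [e0 [W [De dW YE]]]] Yu.
have [I [A [C [lI AA CC XE]]]] := splitting HPhi (dfn_pr dW).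
have YE' x : Y x <-> exists i, A i (wA (jn x e0)) (wB (jn x e0)) /\
    C i (nu_env (wB (jn x e0))) (wC (jn x e0)).
  by rewrite YE -XE /= pr1_jn pr2_jn.
have [i [Ai Ci]] := (YE' u).1 Yu.
by exists P0, e0, (A i), (C i); split=> // x Ax Cx; apply/YE'; exists i.
Qed.

Lemma env_emptyE L0 (M0 : structure L0) (e : env M0 cempty) : e = env_empty M0.
Proof. by apply: functional_extensionality_dep => -[]. Qed.

(** The coset is imaginary, whereas C-formulas take parameters in C. (H2) makes it definable over
    home elements, and the definition is split in a context [Gz] with variables of C-sorts only:
    there the A-sets concern the parameters alone and reduce to the truth values [J]. *)
Lemma coset_C_formula (GA : ctx (lsort (langA S))) GB (GC : ctx (lsort (langC S)))
    (D : set (elt N)) (phi : Phi) (t : term_tuple phi GB)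
    (c : quot (@eq_rel _ _ (coset_equiv S phi))) :
  D = dcl D -> D = dcl (homes D) -> D (imag_elt c) ->
  C_formula D [set x : env N (vars GA GB GC) |
    coset (S := S) (nu_env (S := S) (eval_tuple t (xB x))) = c].
Proof.
move=> HD HD' Dc.
pose Gz : split S := Split cempty cempty (cmap (sortC S) (pp_ctx phi)).
pose V : set (env M (sv Gz)) :=
  [set z | coset (S := S) (@wC _ _ S Gz z : env (grC S) (pp_ctx phi)) = c].
have DV : @defover _ N (dcl (homes D)) (hv Gz) V.
  rewrite -HD'.
  pose H1 : ctx (lsort (eq_language M)) := cconst 1 (imag (coset_equiv S phi)).
  have Dc' : @params_in _ N D H1 (fun _ => c) by [].
  apply: (defover_param (X := [set z : env N (csum (hv Gz) H1) |
    coset (S := S) (fun i : pp_ctx phi =>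
      z (inl (inr i)) : grC S (srt (c := pp_ctx phi) i)) = z (inr ord0)]) Dc').
  apply: dfn_defover.
  apply: (@dfn_eq _ N (csum (hv Gz) H1) (imag (coset_equiv S phi))); last first.
    exact: (@tmf_var _ N (csum (hv Gz) H1) (inr ord0)).
  pose K (j : pp_ctx phi) (z : env N (csum (hv Gz) H1)) : grC S (srt j) := z (inl (inr j)).
  suff dK : forall j, @tmf _ N (csum (hv Gz) H1) (home M (inC (sortC S (srt j)))) (K j).
    exact: (@tmf_app _ N _ (eproj (coset_equiv S phi)) K).
  by move=> j; exact: (@tmf_var _ N (csum (hv Gz) H1) (inl (inr j))).
have [P0 [e0 [W [De dW VE]]]] := defover_homes DV.
have [I [A [C [lI AA CC XE]]]] := splitting HPhi (dfn_pr dW).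
pose J i := A i (env_cat (env_empty _) (wA e0)) (env_cat (env_empty _) (wB e0)).
have VE' z : V z <-> exists i, J i /\ C i (nu_env (wB (jn z e0))) (wC (jn z e0)).
  rewrite VE /J; have := XE (jn z e0); rewrite /= pr1_jn pr2_jn => ->.
  have -> : wA (jn z e0) = env_cat (env_empty _) (wA e0).
    by rewrite -(env_emptyE (wA z)).
  have -> // : wB (jn z e0) = env_cat (env_empty _) (wB e0).
  by rewrite -(env_emptyE (wB z)).
pose GN := cmap (sortC S) GB.
pose Q := csum (cmap (sortC S) (pB P0)) (pC P0).
pose T := csum (csum GN GC) Q.
pose G := csum (cmap (sortC S) (pB (scat Gz P0))) (pC (scat Gz P0)).
pose K (x : G) : env (Cstar S) T -> Cstar S (srt x) :=
  match x return env (Cstar S) T -> Cstar S (srt (c := G) x) with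
  | inl (inl i) => False_rect _ (notF (ltn_ord i))
  | inl (inr i) => fun z => z (inr (inl i))
  | inr (inl j) => fun z =>
      eval (M := grC S) (fun k => z (inl (inl k)) : grC S (srt (c := GB) k)) (t j)
  | inr (inr i) => fun z => z (inr (inr i)) end.
have dK x : tmf (K x).
  case: x => [[[]|i]|[j|i]] //.
  - exact: (@tmf_var _ _ T (inr (inl i))).
  - apply: (@tmf_subst _ (Cstar S) GN T _ _ (fun k z => z (inl (inl k))) (tmf_C S (t j))).
    by move=> k; exact: (@tmf_var _ _ T (inl (inl k))).
  - exact: (@tmf_var _ _ T (inr (inr i))).
have [psi psiP] : dfn [set z : env (Cstar S) T | exists i, J i /\
    C i (fun x => K (inl x) z) (fun x => K (inr x) z)].
  apply: dfn_exists => // i; have [Ji|nJi] := pselect (J i).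
    by apply: dfn_iff (dfn_subst (CC i) dK) => z /=; split=> [|[]].
  by apply: dfn_iff (dfnC (dfnT _ T)) => z; split=> [[]|[]].
exists Q, psi, (nu_params e0); split; first exact: partC_nu_params.
pose zx (x : env N (vars GA GB GC)) : env M (sv Gz) :=
  @wtuple _ _ S Gz (env_empty _) (env_empty _)
    (nu_env (S := S) (eval_tuple t (xB x)) : env (Cstar S) (pC Gz)).
pose pt (x : env N (vars GA GB GC)) : env (Cstar S) T :=
  @env_cat _ (Cstar S) (csum GN GC) Q (@env_cat _ (Cstar S) GN GC
    (nu_env (S := S) (xB x)) (xC x)) (nu_params e0).
have K1 x : (fun y => K (inl y) (pt x)) = nu_env (wB (jn (zx x) e0)).
  by apply: functional_extensionality_dep => -[[]|] //.
have K2 x : (fun y => K (inr y) (pt x)) = wC (jn (zx x) e0).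
  apply: functional_extensionality_dep => -[j|] //.
  have := nu_eval_tuple t (xB x).
  by move=> /(congr1 (fun g : env (grC S) (pp_ctx phi) => g j))/esym.
have ptE x : V (zx x) <-> sat psi (pt x).
  by rewrite psiP /= K1 K2 VE'.
by apply/seteqP; split=> x Hx; [apply: (ptE x).1|apply: (ptE x).2].
Qed.

End TypeSplitting.

(** * Recombining an A-type and a C-type *)

Section Combination.
Context {L : language} {Phi : pp_family L} (S : pure_sequence Phi).

Notation M := (seqM S).
Notation N := (Meq (seqM S)).

Lemma Aset_det GA GB (A : env (Astar S) GA -> env (Bstr S) GB -> Prop) : Aset A ->
  exists (I : shape) (phi : I -> Phi) (t : forall i, term_tuple (phi i) GB),
  forall a b b', (forall i, rho (S := S) (eval_tuple (t i) b) =
                            rho (S := S) (eval_tuple (t i) b')) -> A a b -> A a b'.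
Proof.
move=> [I [phi [t [Y [_ AE]]]]]; exists I, phi, t => a b b' Hr; rewrite !AE.
rewrite (_ : rhos t b = rhos t b') //.
by apply: functional_extensionality_dep => i; exact: Hr.
Qed.

Definition in_coset (P : split S) (phi : Phi) (t : term_tuple phi (pB P)) :
    set (env M (sv P)) :=
  [set z | sat (M := grC S) (pp_form phi) (nu_env (S := S) (eval_tuple t (wB z)))].

Lemma dfn_in_coset (P : split S) (phi : Phi) (t : term_tuple phi (pB P)) :
  dfn (in_coset t).
Proof.
have := @Cset_dfn_seq _ _ S P _ (Cset_coset (pC P) t); apply: dfn_iff => z.
by rewrite /in_coset /= nu_eval_tuple.
Qed.

(** By the agreement, t1_l(v' - v'') is in phi_l(C) whenever the l-th coset condition holds at some
    k. Purity gives one a for which v' - v'' - iota(a) satisfies all these pp-conditions in B, and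
    the B-part of w is that of v' minus iota(a). No finiteness of [K] is needed. *)
Lemma combination (P Q : split S) (E K : Type) (phi : E -> Phi)
    (t : forall l, term_tuple (phi l) (pB (scat P Q))) (e : K -> env M (sv Q))
    (v' v'' : env M (sv P)) :
  listable E ->
  (forall k l, in_coset (t l) (jn v' (e k)) <-> in_coset (t l) (jn v'' (e k))) ->
  exists w : env M (sv P), [/\ wA w = wA v'', wC w = wC v',
      nu_env (wB w) = nu_env (wB v')
    & forall k l, rho (S := S) (eval_tuple (t l) (wB (jn w (e k)))) =
                  rho (S := S) (eval_tuple (t l) (wB (jn v'' (e k))))].
Proof.
move=> lE Hin.
have /depfun_choice[t1 /depfun_choice[t2 tE]] := fun l => tuple_split (t l).
have HB := abelianB S; have HC := abelianC S.
have pf l : is_pp (fsubst (pp_form (phi l)) (t1 l)) by exact/fsubst_pp/pp_formP.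
have [chi [pchi chiE]] :=
  fand_all (fun l => exists k, in_coset (t l) (jn v'' (e k))) lE pf.
have [a Ha] : exists a, sat chi (env_sub (env_sub (wB v' : env (grB S) _) (wB v'')) (iota_env a)).
  apply/(nu_pp _ pchi)/chiE => l [k Hk]; apply/sat_fsubst_tuple.
  have Hk' := (Hin k l).2 Hk.
  rewrite nu_env_sub (eval_tuple_sub HC); move: Hk Hk'.
  rewrite /in_coset /= !(tE _ _ HB) !nu_env_sub !nu_eval_tuple => Hk Hk'.
  have := pp_sub HC (pp_formP _) Hk' Hk.
  by rewrite env_sub_sub.
pose wb := env_sub (wB v' : env (grB S) _) (iota_env a).
have nuw : nu_env wb = nu_env (wB v') by exact: nu_env_iota.
exists (@wtuple _ _ S P (wA v'') wb (wC v')); split=> // k l.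
have inw : in_coset (t l) (@jn _ _ S P Q (@wtuple _ _ S P (wA v'') wb (wC v')) (e k)) <->
    in_coset (t l) (jn v' (e k)).
  by rewrite /in_coset /= !nu_eval_tuple !nu_env_cat nuw.
(* Outside the coset, [rho] has its default value at both points; inside, t1_l takes values at w and
   v'' that are congruent modulo phi_l(B). *)
have [Hk|Hk] := pselect (in_coset (t l) (jn v'' (e k))); last first.
  by rewrite !rho_out //; move/inw/Hin.
apply: rho_congr; rewrite -(eval_tuple_sub HB) env_sub_cat env_subrr (tE _ _ HB).
have zero2 : eval_tuple (t2 l) (@env_zero _ (grB S) (pB Q)) = @env_zero _ (grB S) _.
  by apply: functional_extensionality_dep => j; exact: (eval_zero HB).
rewrite zero2 env_subr0.
have /(_ (ex_intro _ k Hk))/sat_fsubst_tuple := (chiE _ _).1 Ha l.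
rewrite (_ : env_sub (env_sub _ _) _ = env_sub wb (wB v'')) //.
apply: functional_extensionality_dep => i; rewrite /env_sub /wb /env_sub.
by rewrite addrAC.
Qed.

End Combination.

Section Forking.
Context {L : language} {Phi : pp_family L} (S : pure_sequence Phi).

Notation M := (seqM S).
Notation N := (Meq (seqM S)).

Context (Gamma Delta : set (elt N)).
Hypothesis (HGD : Gamma `<=` Delta).
Hypothesis (HDelta : Delta = dcl Delta).
Hypothesis (H2 : Delta = dcl (homes Delta)).
Context (GA : ctx (lsort (langA S))) (GB : ctx (lsort (@langB L))).
Context (GC : ctx (lsort (langC S))) (u : env N (vars GA GB GC)).

Lemma ptype_forksS (p q : ptype N (vars GA GB GC)) :
  p `<=` q -> ptype_forks Gamma p -> ptype_forks Gamma q.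
Proof.
move=> pq [theta [[n [Y [pY Ytheta]]] ftheta]]; exists theta; split=> //.
by exists n, Y; split=> // i; exact/pq/pY.
Qed.

Lemma tp_C_sub : tp_C u Delta `<=` tp u Delta.
Proof.
by move=> X [/C_formula_defover[theta [otheta ->]] Xu]; exists theta.
Qed.

Lemma p0_tp_A_sub : p0 u Gamma `|` tp_A u Delta `<=` tp u Delta.
Proof.
move=> X [/p0_defover[/(defoverS HGD)[theta [otheta ->]] Xu]|]; first by exists theta.
by move=> [/A_formula_defover[theta [otheta ->]] Xu]; exists theta.
Qed.

Hypothesis (Hsat : succ_saturated M Delta).
Hypothesis (H1 : forall (phi : Phi) (X : quot (@eq_rel _ _ (coset_equiv S phi))),
  acl Gamma (imag_elt X) -> Gamma (imag_elt X)).

Notation Gs := (Split GA GB GC).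

Lemma realizes_Gamma (H Q : ctx (lsort (langM S))) :
  @realizes _ N Gamma (cmap (@home _ M) H) (cmap (@home _ M) Q).
Proof. by apply: (meq_realizes HDelta _ Hsat); rewrite -H2. Qed.

(** Otherwise (H1) makes the coset non-algebraic over [Gamma], and some indiscernible sequence
    starting at [e] has different cosets at its first two terms. The atom at (v, e), transported to
    both terms, would force a(y) to equal both. *)
Lemma nondividing_coset (P : split S) (e : env M (sv P)) (I : Type)
    (R : I -> set (env N (csum (hv Gs) (hv P)))) (v : env M (sv Gs)) (phi : Phi)
    (a : env M (sv Gs) -> quot (@eq_rel _ _ (coset_equiv S phi)))
    (t : term_tuple phi (pB P)) (i : I) :
  (forall x y, R i (@env_cat _ N (hv Gs) (hv P) x y) <->
     a x = coset (S := S) (nu_env (S := S) (eval_tuple t (wB y)))) ->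
  @nondividing _ N Gamma (hv Gs) (hv P) e I R v ->
  R i (@env_cat _ N (hv Gs) (hv P) v e) ->
  Gamma (imag_elt (coset (S := S) (nu_env (S := S) (eval_tuple t (wB e))))).
Proof.
move=> RE nd Rv; apply: H1; apply: contrapT => nacl.
have [b [b0 ib nX]] := nonalgebraic_sequence (P := sv P) (e := e) realizes_Gamma
  (@tmf_coset _ _ S P phi t) nacl.
have [y Hy] := nd b b0 ib 2; apply: nX.
have E k : (k < 2)%N -> a y = coset (S := S) (nu_env (S := S) (eval_tuple t (wB (P := P) (b k)))).
  by move=> k2; apply/RE/(Hy k k2).
by rewrite -(E 0) // -(E 1).
Qed.

End Forking.

(** * Non-forking of tp(u/Delta) *)

Section MainArgument.
Context {L : language} {Phi : pp_family L} (S : pure_sequence Phi).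
Hypothesis (HPhi : fundamental_system Phi (grB S)).

Notation M := (seqM S).
Notation N := (Meq (seqM S)).

Context (Gamma Delta : set (elt N)).
Hypothesis (HGD : Gamma `<=` Delta).
Hypothesis (HDelta : Delta = dcl Delta).
Hypothesis (H2 : Delta = dcl (homes Delta)).
Context (GA : ctx (lsort (langA S))) (GB : ctx (lsort (@langB L))).
Context (GC : ctx (lsort (langC S))) (u : env N (vars GA GB GC)).
Hypothesis (Hsat : succ_saturated M Delta).
Hypothesis (H1 : forall (phi : Phi) (X : quot (@eq_rel _ _ (coset_equiv S phi))),
  acl Gamma (imag_elt X) -> Gamma (imag_elt X)).

Notation Gs := (Split GA GB GC).

Definition coset_of (P : split S) (phi : Phi) (t : term_tuple phi (pB P))
    (x : env M (sv P)) : quot (@eq_rel _ _ (coset_equiv S phi)) :=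
  coset (S := S) (nu_env (S := S) (eval_tuple t (wB x))).

Lemma in_cosetE (P Q : split S) (phi : Phi) (t : term_tuple phi (pB (scat P Q)))
    (t1 : term_tuple phi (pB P)) (t2 : term_tuple phi (pB Q)) :
  (forall b e, eval_tuple (M := grB S) t (env_cat b e) =
               env_sub (eval_tuple t1 b) (eval_tuple t2 e)) ->
  forall x y, in_coset t (jn x y) <-> coset_of t1 x = coset_of t2 y.
Proof.
move=> tE x y; rewrite /in_coset /= tE nu_env_sub /coset_of coset_eq.
by split; apply: pp_subC; by [exact: abelianC|exact: pp_formP].
Qed.

Lemma coset_of_sub (phi : Phi) (t : term_tuple phi GB) (x v : env N (vars GA GB GC)) :
  coset_of (P := Gs) t x = coset_of (P := Gs) t v <->
  sat (M := grC S) (pp_form phi) (nu_env (S := S) (G := pp_ctx phi)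
    (eval_tuple t (@env_sub L (grB S) GB (xB x) (xB v)))).
Proof.
rewrite /coset_of eval_tuple_sub; last exact: abelianB.
rewrite nu_env_sub coset_eq.
by split; apply: pp_subC; by [exact: abelianC|exact: pp_formP].
Qed.

(* The information on the coset of [t] that both [p0] and the C-type provide: its value if
   it lies in [Gamma], else that it differs from [c], provided [c] lies in [Gamma]. *)
Definition coset_info (phi : Phi) (t : term_tuple phi GB)
    (c : quot (@eq_rel _ _ (coset_equiv S phi))) (X0 : set (env N (vars GA GB GC))) :
    set (env N (vars GA GB GC)) :=
  if pselect (E0plus u Gamma t) then
    [set x | coset_of (P := Gs) t x = coset_of (P := Gs) t u]
  else if pselect (Gamma (imag_elt c)) then [set x | coset_of (P := Gs) t x <> c]
  else X0.

Lemma coset_info_tp_C phi (t : term_tuple phi GB) c X0 :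
  tp_C u Delta X0 -> tp_C u Delta (coset_info t c X0).
Proof.
move=> HX0; rewrite /coset_info.
case: pselect => [Ep|Em] /=.
  split=> //;
  apply: (@coset_C_formula _ _ S HPhi GA GB GC Delta phi t (coset_of (P := Gs) t u)) => //.
  exact: HGD.
case: pselect => [Gc|nGc] //=; split; last first.
  by move=> /= E; apply: Em; rewrite /E0plus -[coset _]/(coset_of (P := Gs) t u) E.
apply: C_formula_not; apply: (@coset_C_formula _ _ S HPhi GA GB GC Delta phi t c) => //.
exact: HGD.
Qed.

Lemma coset_info_p0 phi (t : term_tuple phi GB) c X0 :
  tp_A u Delta X0 -> (p0 u Gamma `|` tp_A u Delta) (coset_info t c X0).
Proof.
move=> HX0; rewrite /coset_info.
case: pselect => [Ep|Em] /=.
  left; left; exists phi, t; split=> //.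
  by apply/seteqP; split=> x /=; rewrite coset_of_sub.
by case: pselect => [Gc|nGc] /=; [left; right; exists phi, t, c|right].
Qed.

Lemma nonforking_tp :
  ~ ptype_forks Gamma (tp_C u Delta) ->
  ~ ptype_forks Gamma (p0 u Gamma `|` tp_A u Delta) ->
  ~ ptype_forks Gamma (tp u Delta).
Proof.
move=> nfC nfA [theta [[m [Y [HY Ysub]]] [n [eta [Heta etasub]]]]].
have real := realizes_Gamma HGD HDelta H2 Hsat.
pose YY : set (env M (sv Gs)) := [set x | forall i, Y i x].
have DYY : @defover _ N Delta (hv Gs) YY.
  apply: defover_forall => [|i]; first exact: (@listable_finite 'I_m).
  by have [theta' [? -> _]] := HY i; exists theta'.
have Yu : YY u by move=> i; have [theta' [_ _ ?]] := HY i.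
have [P0 [e0 [A0 [C0 [De0 AA0 CC0 [Au Cu] AC0]]]]] := type_splitting HPhi H2 DYY Yu.
pose J := {i : 'I_n & pctx (eta i)}.
have lJ : listable J.
  by apply: listable_sigma => [|i]; [exact: (@listable_finite 'I_n)|exact: listable_shape].
have [P1 [e1 [F [dF FE _]]]] := @representation _ _ S J (fun j => srt (projT2 j))
  (fun j => @pval _ _ _ (eta (projT1 j)) (projT2 j)) lJ.
(* e0 carries the parameters from [Delta] of the formulas that imply [theta], and e1 represents the
   parameters of all the [eta]. Joining them makes one finite algebra serve both purposes. *)
pose P := scat P0 P1; pose e := jn e0 e1.
pose F' i (j : pctx (eta i)) : env N (hv P) -> N (srt j) :=
  fun y => F (existT _ i j) (pr2 (P := P0) (Q := P1) y).
have dF' i j : tmf (F' i j).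
  apply: (@tmf_subst _ N (hv P1) (hv P) _ (F (existT _ i j)) (fun k y => pr2 y k)) => // k.
  exact: (tmf_meq (@tmf_pr2 _ _ S P0 P1 k)).
have F'E i j : F' i j e = @pval _ _ _ (eta i) j.
  by rewrite /F' pr2_jn FE.
pose hat i : set (env N (csum (hv Gs) (hv P))) := [set z | sat (pform (eta i))
  (@env_cat _ N (hv Gs) (pctx (eta i)) (fun k => z (inl k))
   (fun j => F' i j (fun k => z (inr k))))].
have dhat i : dfn (hat i).
  have dphi : dfn [set z : env N (csum (hv Gs) (pctx (eta i))) | sat (pform (eta i)) z].
    by exists (pform (eta i)).
  pose K (x : csum (hv Gs) (pctx (eta i))) : env N (csum (hv Gs) (hv P)) -> N (srt x) :=
    match x return env N (csum (hv Gs) (hv P)) -> N (srt (c := csum (hv Gs) (pctx (eta i))) x)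
    with inl k => fun z => z (inl k) | inr j => fun z => F' i j (fun k => z (inr k)) end.
  have dK x : tmf (K x).
    case: x => k; first exact: (@tmf_var _ N (csum (hv Gs) (hv P)) (inl k)).
    exact: (@tmf_inr _ N (hv Gs) (hv P) _ _ (dF' i k)).
  have := dfn_subst dphi dK; apply: dfn_iff => z; rewrite /hat /=.
  rewrite (_ : (fun k => K k z) = @env_cat _ N (hv Gs) (pctx (eta i)) (fun k => z (inl k))
    (fun j => F' i j (fun k => z (inr k)))) //.
  by apply: functional_extensionality_dep => -[].
have /depfun_choice[I /depfun_choice[A /depfun_choice[C HAC]]] :=
  fun i => splitting HPhi (dfn_pr (dhat i)).
have hatE i x y : hat i (@env_cat _ N (hv Gs) (hv P) x y) <-> exists k,
    onA (A i k) (jn x y) /\ onC (C i k) (jn x y).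
  by have [_ _ _ /(_ (jn x y))] := HAC i; rewrite /= pr1_jn pr2_jn.
pose I' := {i : 'I_n & I i}.
have lI' : listable I'.
  by apply: listable_sigma => [|i]; [exact: (@listable_finite 'I_n)|have [] := HAC i].
pose FA (i : pA (scat Gs P0)) : env (Astar S) (pA (scat Gs P)) -> Astar S (srt i) :=
  match i return env (Astar S) (pA (scat Gs P)) -> Astar S (srt (c := pA (scat Gs P0)) i)
  with inl i => fun a => a (inl i) | inr i => fun a => a (inr (inl i)) end.
have dFA i : tmf (FA i).
  case: i => i; first exact: (@tmf_var _ _ (pA (scat Gs P)) (inl i)).
  exact: (@tmf_var _ _ (pA (scat Gs P)) (inr (inl i))).
pose sgB (i : pB (scat Gs P0)) : term (pB (scat Gs P)) (srt i) :=
  match i return term (pB (scat Gs P)) (srt (c := pB (scat Gs P0)) i) with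
  | inl i => @tvar (glanguage L) (pB (scat Gs P)) (inl i)
  | inr i => @tvar (glanguage L) (pB (scat Gs P)) (inr (inl i)) end.
(* [None] is A0 read over the larger tuple [e]. Its terms must take part in the recombination, since
   w is to satisfy A0 as well. *)
pose AA (o : option I') : env (Astar S) (pA (scat Gs P)) ->
    env (Bstr S) (pB (scat Gs P)) -> Prop :=
  match o with
  | Some x => A (projT1 x) (projT2 x)
  | None => fun a b => A0 (fun i => FA i a) (fun i => eval (M := Bstr S) b (sgB i))
  end.
have AAA o : Aset (AA o).
  case: o => [[i k]|]; first by have [_ + _ _] := HAC i; exact.
  exact: (Aset_subst sgB AA0 dFA).
have AA0E x y0 y1 : onA (AA None) (jn x (jn y0 y1)) = onA A0 (jn x y0).
  rewrite /onA /AA /=; congr A0; apply: functional_extensionality_dep;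
    by case.
have /depfun_choice[It /depfun_choice[phi /depfun_choice[t det]]] :=
  fun o => Aset_det (AAA o).
pose E := {o : option I' & It o}.
have lE : listable E.
  apply: listable_sigma; first exact: listable_option.
  by move=> o; exact: listable_shape.
pose tE (l : E) : term_tuple (phi (projT1 l) (projT2 l)) (pB (scat Gs P)) :=
  t (projT1 l) (projT2 l).
have /depfun_choice[t1 /depfun_choice[t2 tsplit]] := fun l => tuple_split (tE l).
have cosE l := in_cosetE (tsplit l _ (abelianB S)).
(* The coset conditions belong to the algebra, so that tuples found along an indiscernible sequence
   inherit the agreement of u' and u''. *)
pose X (i : I' + I' + E) : set (env M (sv (scat Gs P))) :=
  match i with
  | inl (inl x) => onA (A (projT1 x) (projT2 x))
  | inl (inr x) => onC (C (projT1 x) (projT2 x))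
  | inr l => in_coset (tE l)
  end.
pose R i : set (env N (csum (hv Gs) (hv P))) :=
  [set z | X i (jn (fun k : sv Gs => z (inl k)) (fun k : sv P => z (inr k)))].
have dR i : dfn (R i).
  apply/dfn_jn; case: i => [[[i k]|[i k]]|l] /=.
  - by have [_ HA _ _] := HAC i; exact: Aset_dfn_seq.
  - by have [_ _ HC _] := HAC i; exact: Cset_dfn_seq.
  - exact: dfn_in_coset.
have lX : listable (I' + I' + E)%type by exact: (listable_sum (listable_sum lI' lI') lE).
pose XA : set (env N (vars GA GB GC)) := [set x | onA A0 (jn (P := Gs) x e0)].
pose XC : set (env N (vars GA GB GC)) := [set x | onC C0 (jn (P := Gs) x e0)].
have HXA : tp_A u Delta XA by split=> //; exact: (Aset_A_formula HDelta De0 AA0).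
have HXC : tp_C u Delta XC by split=> //; exact: (Cset_C_formula HDelta De0 CC0).
pose YX X0 (o : option E) : set (env N (vars GA GB GC)) :=
  if o is Some l then coset_info (t1 l) (coset_of (t2 l) e) X0 else X0.
have [u' [Yu' nd']] : exists x, (forall o, YX XC o x) /\
    @nondividing _ N Gamma (hv Gs) (hv P) e _ R x.
  apply: (@nonforking_nondividing _ N Gamma (hv Gs) (hv P) e _ R (tp_C u Delta)
    (option E) (YX XC) lX dR nfC (listable_option lE)).
  by case=> [l|] //; exact: coset_info_tp_C.
have [u'' [Yu'' nd'']] : exists x, (forall o, YX XA o x) /\
    @nondividing _ N Gamma (hv Gs) (hv P) e _ R x.
  apply: (@nonforking_nondividing _ N Gamma (hv Gs) (hv P) e _ R
    (p0 u Gamma `|` tp_A u Delta) (option E) (YX XA) lX dR nfA (listable_option lE)).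
  by case=> [l|]; [exact: coset_info_p0|right].
have nG l v : @nondividing _ N Gamma (hv Gs) (hv P) e _ R v ->
    coset_of (P := Gs) (t1 l) v = coset_of (t2 l) e ->
    Gamma (imag_elt (coset_of (t2 l) e)).
  move=> ndv cv; apply: (nondividing_coset HGD HDelta H2 Hsat H1
    (a := coset_of (P := Gs) (t1 l)) (i := inr l) _ ndv).
    by move=> x y; exact: cosE.
  exact/cosE.
(* If the coset of t1(u) lies in [Gamma], both tuples have this same coset. If only that of t2(e)
   lies in [Gamma], both avoid it. If neither does, [nG] excludes equality for both. *)
have agree l : in_coset (tE l) (jn (P := Gs) u' e) <-> in_coset (tE l) (jn (P := Gs) u'' e).
  rewrite !cosE; move: (Yu' (Some l)) (Yu'' (Some l)); rewrite /YX /coset_info.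
  case: pselect => [Ep|Em] /=; first by move=> -> ->.
  case: pselect => [Gc|nGc] /=; first by split.
  by move=> _ _; split=> Hc; case: nGc; [exact: nG nd' Hc|exact: nG nd'' Hc].
have transA o w v y : wA w = wA v ->
    (forall l, rho (S := S) (eval_tuple (tE l) (wB (jn (P := Gs) w y))) =
               rho (S := S) (eval_tuple (tE l) (wB (jn (P := Gs) v y)))) ->
    onA (AA o) (jn v y) -> onA (AA o) (jn w y).
  move=> wv Hr Hv; rewrite /onA /= [wA _](_ : _ = wA (jn v y)); last first.
    by rewrite /jn /wA /= -/(wA w) wv.
  by apply: det Hv => i; exact/esym/(Hr (existT _ o i)).
have transC (Q : split S) (CC : env (Cstar S) (cmap (sortC S) (pB (scat Gs Q))) ->
    env (Cstar S) (pC (scat Gs Q)) -> Prop) (w v : env M (sv Gs)) (y : env M (sv Q)) :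
    nu_env (wB w) = nu_env (wB v) -> wC w = wC v -> onC CC (jn v y) -> onC CC (jn w y).
  move=> nwv wv; rewrite /onC /=.
  rewrite (_ : nu_env (wB (jn w y)) = nu_env (wB (jn v y))); last first.
    exact: etrans (nu_env_cat (wB w) (wB y))
      (etrans (congr1 (fun g => env_cat g _) nwv) (esym (nu_env_cat (wB v) (wB y)))).
  rewrite (_ : wC (jn w y) = wC (jn v y)) //.
  exact: (congr1 (fun g => env_cat g (wC y)) wv).
have [w [wAE wCE nuw rhow]] := combination (K := unit) (e := fun _ => e) (t := tE) lE
  (fun _ l => agree l).
have w_theta : solutions theta w.
  apply: Ysub; apply: AC0.
    rewrite -(AA0E w e0 e1); apply: (transA None w u'' e wAE (rhow tt)).
    by rewrite AA0E; exact: (Yu'' None).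
  by apply: (transC P0 C0 w u' e0) => //; exact: (Yu' None).
have [i w_eta] := etasub w w_theta.
have : hat i (@env_cat _ N (hv Gs) (hv P) w e).
  move: w_eta; rewrite /solutions /hat /=.
  rewrite (_ : @pval _ _ _ (eta i) = fun j => F' i j e) //.
  by apply: functional_extensionality_dep => j; rewrite F'E.
move=> /hatE[k [wA_ik wC_ik]].
(* The pieces found at w are carried back to u'' and u', because the atoms known not to divide are
   those of u'' and u', not that of w. *)
have A_ik : onA (A i k) (jn (P := Gs) u'' e).
  by apply: (transA (Some (existT _ i k)) u'' w e _ _ wA_ik) => // l; exact/esym/(rhow tt).
have C_ik : onC (C i k) (jn (P := Gs) u' e) by apply: (transC P (C i k) u' w e).
have [b [b0 ib [n' nb]]] := divides_lift real (P := sv P) (e := e) (dF' i) (F'E i) (Heta i).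
have [y' Hy'] := nd' b b0 ib n'; have [y'' Hy''] := nd'' b b0 ib n'.
(* The coset conditions of y' and y'' over each [b k] copy those of u' and u'' over [e], hence
   agree; one w' then serves the first n' terms together. *)
have [w' [wAE' wCE' nuw' rhow']] := combination (K := 'I_n') (e := fun k => b k) (t := tE)
  (v' := y') (v'' := y'') lE (fun k l => iff_trans (Hy' k (ltn_ord k) (inr l))
    (iff_trans (agree l) (iff_sym (Hy'' k (ltn_ord k) (inr l))))).
apply: nb; exists w' => k' k'n.
suff : hat i (@env_cat _ N (hv Gs) (hv P) w' (b k')) by [].
apply/hatE; exists k; split.
  apply: (transA (Some (existT _ i k)) w' y'' (b k') wAE' (rhow' (Ordinal k'n))).
  exact: ((Hy'' k' k'n (inl (inl (existT _ i k)))).2 A_ik).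
apply: (transC P (C i k) w' y' (b k') nuw' wCE').
exact: ((Hy' k' k'n (inl (inr (existT _ i k)))).2 C_ik).
Qed.

End MainArgument.

Theorem mainTheorem6 (L : language) (Phi : pp_family L) (S : pure_sequence Phi)
    (HPhi : fundamental_system Phi (grB S))
    (Gamma Delta : set (elt (Meq (seqM S))))
    (HGD : Gamma `<=` Delta)
    (HGamma : Gamma = dcl Gamma) (HDelta : Delta = dcl Delta)
    (Hsat : succ_saturated (seqM S) Delta)
    (Hhom : succ_strongly_homogeneous (seqM S) Delta)
    (GA : ctx (lsort (langA S))) (GB : ctx (lsort (@langB L)))
    (GC : ctx (lsort (langC S)))
    (uA : env (Astar S) GA) (uB : env (Bstr S) GB) (uC : env (Cstar S) GC)
    (H1 : forall (phi : Phi) (X : quot (@eq_rel _ _ (coset_equiv S phi))),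
        acl Gamma (imag_elt X) -> Gamma (imag_elt X))
    (H2 : Delta = dcl (partA Delta `|` partB Delta `|` partC Delta)) :
  let u := seq_tuple uA uB uC in
  ~ ptype_forks Gamma (tp u Delta) <->
  (~ ptype_forks Gamma (tp_C u Delta) /\
   ~ ptype_forks Gamma (p0 u Gamma `|` tp_A u Delta)).
Proof.
move=> u; have H2' : Delta = dcl (homes Delta) := H2; split.
  move=> nf; split=> Hf; apply: nf; apply: ptype_forksS Hf.
    exact: tp_C_sub.
  exact: p0_tp_A_sub.
by move=> [nfC nfA]; exact: nonforking_tp.
Qed.
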